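(* Let $0\le\alpha<d$, $1<p<\infty$, $\frac1q=\frac1p-\frac\alpha d>0$, and let $q\le s\le\infty$. Let $w$ be a weight on $\mathbb R^d$ and write $\sigma=w^{-p'}$. There exists a constant $c_d\in(0,1)$ depending only on $d$ such that $$[w]_{A_{(p,p),(q,s)}}\lesssim\|M_\alpha\|_{L^{p,p}_w\to L^{q,s}_w}\lesssim[w]_{A_{(p,p),(q,s)}}\,[\sigma]_{\mathcal R_{c_d}}^{1/q}.$$ Moreover, $$[\sigma]_{\mathcal R_{c_d}}\lesssim[w]_{A_{(p,p),(q,s)}}^{p'},$$ and consequently $$\|M_\alpha\|_{L^{p,p}_w\to L^{q,s}_w}\lesssim[w]_{A_{(p,p),(q,s)}}^{1+p'/q}.$$ All implicit constants are independent of $w$.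
   Context: A weight is a measurable function on $\mathbb R^d$ with values in $(0,\infty)$ almost everywhere; cubes have sides parallel to the axes. For a measurable $f$ on $\mathbb R^d$ with decreasing rearrangement $f^*$, $\|f\|_{L^{a,b}}:=\big(\frac ba\int_0^\infty[t^{1/a}f^*(t)]^b\frac{dt}t\big)^{1/b}$ for $0<a,b<\infty$, and $\|f\|_{L^{a,\infty}}:=\sup_{t>0}t^{1/a}f^*(t)$. $L^{a,b}_w:=\{f: fw\in L^{a,b}(\mathbb R^d)\}$ with $\|f\|_{L^{a,b}_w}:=\|fw\|_{L^{a,b}}$. For a cube $Q$, $\|h\|_{L^{a,b}(Q)}:=|Q|^{-1/a}\|h\mathbf 1_Q\|_{L^{a,b}}$. Primes denote conjugate exponents. $M_\alpha f(x)=\sup_{Q\ni x}|Q|^{\alpha/d}\frac1{|Q|}\int_Q|f|$, the supremum over cubes containing $x$. $$[w]_{A_{(p,p),(q,s)}}:=\sup_Q\|w\|_{L^{q,s}(Q)}\,\Big(\frac1{|Q|}\int_Qw^{-p'}\Big)^{1/p'}\in[0,\infty].$$ For a locally finite positive measure $\sigma$ (a function is identified with the measure having it as density, $\sigma(E)=\int_E\sigma\,dx$) and $0<c<1$, the reverse measure constant is $$[\sigma]_{\mathcal R_c}:=\sup_Q\ \sup_{E\subset Q,\ |E|\ge c|Q|}\frac{\sigma(Q)}{\sigma(E)},$$ over cubes $Q$ and measurable sets $E$; if $\sigma$ is not locally finite, set $[\sigma]_{\mathcal R_c}=\infty$ (in that case $[w]_{A_{(p,p),(q,s)}}=\infty$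 as well). *)

(* Defs.v *)
From HB Require Import structures.
From mathcomp Require Import all_boot all_order all_algebra.
From mathcomp Require Import all_classical all_reals all_analysis.
From mathcomp Require Import measurable_realfun.

Set Implicit Arguments.
Unset Strict Implicit.
Unset Printing Implicit Defensive.

Import Order.TTheory GRing.Theory Num.Theory.
Import numFieldNormedType.Exports.

Local Open Scope classical_set_scope.
Local Open Scope ring_scope.
Local Open Scope ereal_scope.

(* Lebesgue measure on R^d: the iterated product of the one-dimensional
   Lebesgue measure on the Borel sets of d-tuples, then completed, so that
   "measurable" below means Lebesgue measurable. *)

Section LebesgueMeasureRd.
Context {R : realType}.
Local Notation T1 := (measurableTypeR R).

Definition cons_pair n (xy : T1 * n.-tuple T1) : n.+1.-tuple T1 :=
  [tuple of xy.1 :: xy.2].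

Lemma measurable_cons_pair n : measurable_fun [set: T1 * n.-tuple T1]
  (@cons_pair n).
Proof. exact: measurable_cons. Qed.

Section Step.
Variables (n : nat) (m : {sigma_finite_measure set (n.-tuple T1) -> \bar R}).

Definition lebesgue_step : set (n.+1.-tuple T1) -> \bar R :=
  pushforward (@lebesgue_measure R \x m) (@cons_pair n).

Let step0 : lebesgue_step set0 = 0.
Proof. by rewrite /lebesgue_step /pushforward preimage_set0 measure0. Qed.

Let step_ge0 A : 0 <= lebesgue_step A.
Proof. by rewrite /lebesgue_step /pushforward; exact: measure_ge0. Qed.

Let step_sigma_additive : semi_sigma_additive lebesgue_step.
Proof.
move=> F mF tF mUF; rewrite /lebesgue_step /pushforward preimage_bigcup.
apply: measure_semi_sigma_additive.
- by move=> k; rewrite -[X in measurable X]setTI; exact: measurable_cons_pair.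
- apply/trivIsetP => /= i j _ _ ij; rewrite -preimage_setI.
  by move/trivIsetP : tF => /(_ _ _ _ _ ij) ->//; rewrite preimage_set0.
- rewrite -preimage_bigcup -[X in measurable X]setTI.
  exact: measurable_cons_pair.
Qed.

HB.instance Definition _ := isMeasure.Build _ _ _ lebesgue_step
  step0 step_ge0 step_sigma_additive.

Let step_sigma_finite : sigma_finite setT lebesgue_step.
Proof.
have /sigma_finiteP[F [TF ndF Foo]] := sigma_finiteT (@lebesgue_measure R).
have /sigma_finiteP[G [TG ndG Goo]] := sigma_finiteT m.
pose u (x : n.+1.-tuple T1) : T1 * n.-tuple T1 :=
  (tnth x ord0, [tuple of behead x]).
have uK xy : u (cons_pair xy) = xy.
  by case: xy => a b; rewrite /u /cons_pair; congr pair; apply/val_inj.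
have mu : measurable_fun [set: n.+1.-tuple T1] u.
  apply/measurable_fun_pairP; split;
    [exact: measurable_tnth|exact: measurable_behead].
exists (fun k => u @^-1` (F k `*` G k)).
  rewrite -preimage_bigcup; apply/esym; rewrite -subTset => x _ /=.
  have [i _ Fi] : (\bigcup_k F k) (u x).1 by rewrite -TF.
  have [j _ Gj] : (\bigcup_k G k) (u x).2 by rewrite -TG.
  exists (maxn i j) => //; split.
  - by move: Fi; exact/subsetPset/ndF/leq_maxl.
  - by move: Gj; exact/subsetPset/ndG/leq_maxr.
move=> k; have [? ?] := Foo k; have [? ?] := Goo k; split.
  by rewrite -[X in measurable X]setTI; apply: mu => //; exact: measurableX.
rewrite /lebesgue_step /pushforward -comp_preimage.
rewrite (_ : u \o _ = id); last by apply/funext => xy /=; rewrite uK.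
by rewrite preimage_id product_measure1E// lte_mul_pinfty// ge0_fin_numE.
Qed.

HB.instance Definition _ := Measure_isSigmaFinite.Build _ _ _ lebesgue_step
  step_sigma_finite.

End Step.

Fixpoint borel_lebesgue n : {sigma_finite_measure set (n.-tuple T1) -> \bar R} :=
  match n with
  | 0 => \d_([tuple] : 0.-tuple T1)
  | n'.+1 => lebesgue_step (borel_lebesgue n')
  end.

End LebesgueMeasureRd.

Definition Rd (R : realType) (d : nat) : Type :=
  caratheodory_type ((@borel_lebesgue R d)^*)%mu.

HB.instance Definition _ (R : realType) (d : nat) := Measurable.on (Rd R d).

Definition lebesgue_d (R : realType) (d : nat) :
    {measure set (Rd R d) -> \bar R} :=
  @completed_measure_extension _ _ _ (@borel_lebesgue R d).

Definition coordinate {R : realType} {d : nat} (x : Rd R d) (i : 'I_d) : R :=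
  tnth (x : d.-tuple R) i.

(* Half-open cubes; since boundaries are null sets and every cube is contained
   in a slightly larger half-open one, none of the suprema below depends on
   which part of the boundary is included. *)
Definition cube {R : realType} {d : nat} (Q : set (Rd R d)) : Prop :=
  exists (a : 'I_d -> R) (l : R), (0 < l)%R /\
    Q = [set x | forall i, (a i <= coordinate x i < a i + l)%R].

Section Lorentz.
Context {R : realType} {d : nat}.
Local Notation T := (Rd R d).
Local Notation mu := (@lebesgue_d R d).
Implicit Types (f g w : T -> \bar R) (Q E : set T) (a : R) (b : \bar R).

Definition rearrangement f (t : R) : \bar R :=
  ereal_inf [set y | 0 <= y /\ mu [set x | y < `|f x|] <= t%:E].

(* The branch b = -oo is never used. *)
Definition lorentz_norm a b f : \bar R :=
  match b with
  | b'%:E =>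
      ((b' / a)%:E *
       \int[lebesgue_measure]_(t in `]0%R, +oo[%classic)
         (((t `^ a^-1)%:E * rearrangement f t) `^ b' * (t^-1)%:E)) `^ b'^-1
  | _ => ereal_sup [set (t `^ a^-1)%:E * rearrangement f t
                   | t in `]0%R, +oo[%classic]
  end.

Definition weighted_lorentz_norm w a b f : \bar R :=
  lorentz_norm a b (f \* w).

Definition local_lorentz_norm Q a b f : \bar R :=
  mu Q `^ (- a^-1) * lorentz_norm a b (f \_ Q).

Definition average Q f : \bar R := (mu Q)^-1 * \int[mu]_(x in Q) f x.

Definition fractional_maximal (alpha : R) f (x : T) : \bar R :=
  ereal_sup [set mu Q `^ (alpha / d%:R) * average Q (fun y => `|f y|)
            | Q in [set Q | cube Q /\ Q x]].

(* The best constant C in "N2 (M f) <= C N1 f" over all measurable f with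
   N1 f finite; +oo when there is none. *)
Definition operator_norm (M : (T -> \bar R) -> (T -> \bar R))
    (N1 N2 : (T -> \bar R) -> \bar R) : \bar R :=
  ereal_inf [set C%:E | C in [set C : R | (0 <= C)%R /\
    forall f, measurable_fun [set: T] f -> N1 f < +oo ->
      N2 (M f) <= C%:E * N1 f]].

Definition weight w : Prop :=
  measurable_fun [set: T] w /\ {ae mu, forall x, 0 < w x < +oo}.

Definition conj_exp (p : R) : R := fine (hoelder_conjugate p%:E).

Definition dual_weight (p : R) w (x : T) : \bar R := w x `^ (- conj_exp p).

Definition A_const (p q : R) (s : \bar R) w : \bar R :=
  ereal_sup [set local_lorentz_norm Q q s w *
                 average Q (dual_weight p w) `^ (conj_exp p)^-1 | Q in cube].

Definition density (sigma : T -> \bar R) E : \bar R :=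
  \int[mu]_(x in E) sigma x.

Definition locally_finite_on_cubes (nu : set T -> \bar R) : Prop :=
  forall Q, cube Q -> nu Q < +oo.

Definition reverse_const (c : R) (nu : set T -> \bar R) : \bar R :=
  if `[< locally_finite_on_cubes nu >] then
    ereal_sup [set nu QE.1 / nu QE.2 | QE in [set QE : set T * set T |
      [/\ cube QE.1, measurable QE.2, QE.2 `<=` QE.1
        & c%:E * mu QE.1 <= mu QE.2]]]
  else +oo.

(* Domination up to a constant independent of the weight. *)
Definition lesssim (F G : (T -> \bar R) -> \bar R) : Prop :=
  exists2 C : R, (0 < C)%R & forall w, weight w -> F w <= C%:E * G w.

End Lorentz.

(* Main.v *)
(* Sufficiency. Every cube lies in a cube of comparable size from one of the [3^d]
   shifted dyadic grids, so M_alpha is controlled by maximal functions over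
   finite nested families F of cubes.  Let a(Q) be the fractional average of f
   over Q.  Discarding each cube lying in another one with at least half its
   value leaves principal cubes P, and M f is at most twice the maximum of the
   a(P) 1_P.  Since s >= q, the q-th power of the L^{q,s} norm of a maximum is
   at most the sum of the q-th powers: distribution functions are subadditive
   and, by Minkowski in L^{s/q}, so is that power as a function of them.  The
   A-constant turns the P-th term into a multiple of X_P^p sigma(P) with
   X_P = sigma(P)^{-1} int_P f, the excess power q - p being absorbed by
   Hoelder.  The part of P outside the cubes Q of F with a(Q) > 2 a(P) has
   measure at least |P|/2, and these parts are disjoint, so the reverse
   constant (with c = 1/2) bounds the sum of the X_P^p sigma(P) by the L^p(sigma)
   norm of the sigma-maximal function, which Doob's inequality handles.

   Necessity is tested on sigma 1_{Q, w > 1/n}.  The bound on the reverse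
   constant follows from Chebyshev: on half of E the density sigma is at most
   twice its mean over E, so w is bounded below there. *)

Require Import Defs.
From HB Require Import structures.
From mathcomp Require Import all_boot all_order all_algebra.
From mathcomp Require Import all_classical all_reals all_analysis.
From mathcomp Require Import measurable_realfun.
From mathcomp Require Import ring lra.

Set Implicit Arguments.
Unset Strict Implicit.
Unset Printing Implicit Defensive.

Import Order.TTheory GRing.Theory Num.Theory.
Import numFieldNormedType.Exports.

Local Open Scope classical_set_scope.
Local Open Scope ring_scope.
Local Open Scope ereal_scope.

(** * Lebesgue measure on R^d: null sets, boxes and cubes *)

Section LebesgueFacts.
Context {R : realType}.

(** The value [c = 1/2] is the factor 2 of the principal selection seen from the other side. Since
    [beta >= 0], a subcube whose fractional average exceeds twice that of [P] also has ordinary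
    average more than twice that of [P], so all such subcubes together fill at most half of [P]; no
    dimensional constant enters. The weighted argument closes by a count of exponents: volumes drop
    out of [a(P)] times the A-condition because [beta - 1 + 1/q + 1/p' = 0], and the remaining
    [y = (int_P f) sigma(P)^(-1/p')] satisfies both [y^p = X_P^p sigma(P)] and, by Hoelder,
    [y <= |f w|_p]. Families stay finite until the end: this gives the principal selection by
    induction, and makes finite the integral that Doob's inequality divides by. All cubes are
    reached afterwards by monotone convergence along an enumeration of the grids. Rearrangements at
    a fixed argument are not subadditive under maxima, so the norms are first rewritten through
    distribution functions. *)

Lemma lebesgue_d_sigma_finite (d : nat) :
  sigma_finite [set: Rd R d] (@lebesgue_d R d).
Proof.
apply: completed_measure_extension_sigma_finite; exact: sigma_finiteT.
Qed.

HB.instance Definition _ (d : nat) := Measure_isSigmaFinite.Build _ _ _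
  (@completed_measure_extension _ _ _ (@borel_lebesgue R d))
  (@lebesgue_d_sigma_finite d).

(** The same measure bundled with its sigma-finiteness, in the form that Tonelli requires. *)
Definition lebesgue_sf (d : nat) : {sigma_finite_measure set (Rd R d) -> \bar R} :=
  @completed_measure_extension _ _ _ (@borel_lebesgue R d).

(* [lebesgue_d] is an outer measure, so the next two facts need no
   measurability. *)
Lemma le_lebesgue_d (d : nat) (A B : set (Rd R d)) :
  A `<=` B -> lebesgue_d R d A <= lebesgue_d R d B.
Proof. exact: (@le_mu_ext _ _ R (@borel_lebesgue R d)). Qed.

Lemma lebesgue_dU (d : nat) (A B : set (Rd R d)) :
  lebesgue_d R d (A `|` B) <= lebesgue_d R d A + lebesgue_d R d B.
Proof. exact: (@outer_measureU2 _ _ ((@borel_lebesgue R d)^*)%mu). Qed.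

(** Caratheodory's criterion: the trace of a test set on [A] has outer measure 0, so splitting along
    [A] costs nothing. *)
Lemma lebesgue_d_complete (d : nat) (A B : set (Rd R d)) :
  A `<=` B -> lebesgue_d R d B = 0 -> measurable A.
Proof.
move=> AB B0.
apply: le_caratheodory_measurable => X.
have B0' : ((@borel_lebesgue R d)^*)%mu B = 0 by [].
rewrite [X in X + _](_ : _ = 0); last first.
  apply/le_anti/andP; split; last exact: mu_ext_ge0.
  rewrite -[leRHS]B0'; apply: (@le_mu_ext _ _ R (@borel_lebesgue R d)).
  by apply: subset_trans AB; exact: subIsetr.
rewrite add0e; apply: (@le_mu_ext _ _ R (@borel_lebesgue R d)).
exact: subIsetl.
Qed.

Definition box (d : nat) (a b : 'I_d -> R) : set (d.-tuple (measurableTypeR R)) :=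
  [set x | forall i, (a i <= tnth x i < b i)%R].

Lemma borel_box (d : nat) (a b : 'I_d -> R) : measurable (box a b).
Proof.
rewrite (_ : box a b = \bigcap_(i in [set: 'I_d])
    ((fun x => tnth x i) @^-1` `[a i, b i[%classic)).
  apply: fin_bigcap_measurable => // i _.
  rewrite -[X in measurable X]setTI; apply: measurable_tnth => //.
apply/seteqP; split => x /=.
  by move=> xab i _; rewrite /= in_itv/=.
by move=> xab i; have := xab i I; rewrite /= in_itv.
Qed.

Lemma borel_lebesgue_box (d : nat) (a b : 'I_d -> R) :
  (forall i, (a i <= b i)%R) ->
  borel_lebesgue d (box a b) = (\prod_(i < d) (b i - a i))%:E.
Proof.
elim: d a b => [|d ih] a b ab.
  rewrite big_ord0 /= diracE mem_set//= => -[] //.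
rewrite /= /lebesgue_step /pushforward.
rewrite (_ : _ @^-1` _ =
  `[a ord0, b ord0[%classic `*` box (a \o lift ord0) (b \o lift ord0)).
  rewrite product_measure1E//; last exact: borel_box.
  rewrite big_ord_recl EFinM; congr (_ * _); last by apply: ih => i /=.
  transitivity ((@lebesgue_measure R) `[a ord0, b ord0[%classic) => //.
  rewrite lebesgue_measure_itv/= lte_fin; case: ltgtP (ab ord0) => // ->.
  by rewrite subrr.
apply/seteqP; split => -[x y]/=.
  move=> xy; split; first by have := xy ord0; rewrite tnth0 in_itv.
  by move=> i; have := xy (lift ord0 i); rewrite tnthS.
rewrite in_itv/= => -[xab yab] i.
case: (unliftP ord0 i) => [j|] ->; last by rewrite tnth0.
by rewrite tnthS; exact: yab.
Qed.

Definition cube_at (d : nat) (a : 'I_d -> R) (l : R) : set (Rd R d) :=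
  [set x | forall i, (a i <= coordinate x i < a i + l)%R].

Lemma measurable_cube_at (d : nat) (a : 'I_d -> R) (l : R) :
  measurable (cube_at a l).
Proof.
apply: sub_caratheodory; apply: sub_sigma_algebra.
exact: (borel_box a (fun i => a i + l)%R).
Qed.

Lemma lebesgue_cube_at (d : nat) (a : 'I_d -> R) (l : R) : (0 < l)%R ->
  lebesgue_d R d (cube_at a l) = (l ^+ d)%:E.
Proof.
move=> l0; transitivity (borel_lebesgue d (box a (fun i => a i + l)%R)).
  apply: (@measurable_mu_extE _ _ _ (@borel_lebesgue R d)).
  exact: borel_box.
rewrite borel_lebesgue_box => [|i]; last by rewrite lerDl ltW.
rewrite (eq_bigr (fun=> l)) => [|i _]; last by rewrite addrC addKr.
by rewrite prodr_const card_ord.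
Qed.

Lemma measurable_cube (d : nat) (Q : set (Rd R d)) : cube Q -> measurable Q.
Proof. by move=> [a [l [_ ->]]]; exact: measurable_cube_at. Qed.

Lemma lebesgue_cube_gt0 (d : nat) (Q : set (Rd R d)) :
  cube Q -> 0 < lebesgue_d R d Q < +oo.
Proof.
move=> [a [l [l0 ->]]].
by rewrite [X in _ < X < _]lebesgue_cube_at// lte_fin exprn_gt0// ltry.
Qed.

Lemma lebesgue_cube_fine (d : nat) (Q : set (Rd R d)) : cube Q ->
  exists2 V : R, (0 < V)%R & lebesgue_d R d Q = V%:E.
Proof.
move=> [a [l [l0 ->]]]; exists (l ^+ d)%R; first by rewrite exprn_gt0.
exact: lebesgue_cube_at.
Qed.

(** A vanishing integral would force [sigma = 0] almost everywhere on [D]. Applied to the dual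
    weight, this makes the ratios of masses in the reverse constant genuine quotients. *)
Lemma positive_integral (d : nat) (sigma : Rd R d -> \bar R)
    (D : set (Rd R d)) : measurable D ->
  measurable_fun setT sigma -> (forall x, 0 < sigma x) -> 0 < lebesgue_d R d D ->
  0 < \int[lebesgue_d R d]_(x in D) sigma x.
Proof.
move=> mD ms s0 D0; rewrite lt_neqAle integral_ge0 ?andbT; last first.
  by move=> x _; exact: ltW.
apply/eqP => /esym I0.
have /ae_eq_integral_abs : \int[lebesgue_d R d]_(x in D) `|sigma x| = 0.
  by rewrite -[RHS]I0; apply: eq_integral => x _; rewrite gee0_abs// ltW.
move=> /(_ mD (measurable_funTS ms)) [N [mN N0 DN]].
move: D0; suff -> : lebesgue_d R d D = 0 by rewrite ltxx.
apply/le_anti; rewrite measure_ge0 andbT -N0; apply: le_lebesgue_d => x Dx.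
by apply: DN => /= /(_ Dx)/eqP; rewrite gt_eqF.
Qed.

End LebesgueFacts.

(** * Integrals of powers *)

Section PowerIntegral.
Context {R : realType}.
Local Notation leb := (@lebesgue_measure R).

(** The derivative of [t ^ r], so that its mass on [(0, x)] is [x ^ r]. *)
Definition power_density (r t : R) : \bar R := (r * t `^ (r - 1))%:E.

Lemma measurable_power_density (r : R) (D : set R) :
  measurable_fun D (power_density r).
Proof.
apply/measurable_EFinP; apply: measurable_funM => //.
exact: measurable_funTS (measurable_powR _).
Qed.

Lemma power_density_ge0 (r t : R) : (0 <= r)%R -> 0 <= power_density r t.
Proof. by move=> r0; rewrite lee_fin mulr_ge0 ?powR_ge0. Qed.

Lemma integral_power_cc (r e x : R) : (0 < e)%R -> (e < x)%R ->
  \int[leb]_(t in `[e, x]) power_density r t = (x `^ r - e `^ r)%:E.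
Proof.
move=> e0 ex; have dP (t : R) : (0 < t)%R ->
    is_derive t 1%R ((@powR R)^~ r) (r * t `^ (r - 1))%R.
  exact: is_derive1_powR.
have cP (s t : R) : (0 < t)%R -> {for t, continuous ((@powR R)^~ s)}.
  move=> t0; apply/differentiable_continuous/derivable1_diffP.
  by apply: derivable_powR; rewrite in_itv/= andbT.
rewrite (@continuous_FTC2 _ _ ((@powR R)^~ r)) ?EFinB//.
- apply: continuous_in_subspaceT => t; rewrite inE/= in_itv/= => /andP[et _].
  apply: cvgM; first exact: cvg_cst.
  by apply: cP; apply: lt_le_trans et.
- split.
  + move=> t; rewrite in_itv/= => /andP[et _].
    by apply: derivable_powR; rewrite in_itv/= andbT (lt_trans e0).
  + by apply: cvg_at_right_filter; apply: cP.
  + by apply: cvg_at_left_filter; apply: cP; exact: lt_trans ex.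
- move=> t; rewrite in_itv/= => /andP[et _].
  by rewrite derive1E; apply: derive_val; apply: dP; exact: lt_trans et.
Qed.

Lemma integral_power_oo (r x : R) : (0 < r)%R -> (0 < x)%R ->
  \int[leb]_(t in `]0%R, x[) power_density r t = (x `^ r)%:E.
Proof.
move=> r0 x0; rewrite integral_itv_bndo_bndc; last exact: measurable_power_density.
have xr0 : (0 < x `^ r)%R by rewrite powR_gt0.
(* For [r < 1] the density is singular at 0, so the fundamental theorem is used on [[e n, x]] only.
   The choice makes [e n ^ r = x ^ r / (n + 2)]; with [n + 1] the first interval would
   degenerate. *)
pose e n : R := ((x `^ r * n.+2%:R^-1) `^ r^-1)%R.
have h0 n : (0 < x `^ r * n.+2%:R^-1)%R by rewrite mulr_gt0 ?invr_gt0.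
have e0 n : (0 < e n)%R by rewrite powR_gt0.
have eE n : (e n `^ r = x `^ r * n.+2%:R^-1)%R.
  by rewrite /e -powRrM mulVf ?gt_eqF// powRr1 ?ltW.
have lt_pow (s t : R) : (0 < s)%R -> (0 < t)%R -> (s `^ r <= t `^ r)%R -> (s <= t)%R.
  move=> s0 t0; apply: contraTT; rewrite -!ltNge => ts.
  by rewrite gt0_ltr_powR// nnegrE ltW.
have ex n : (e n < x)%R.
  rewrite lt_neqAle lt_pow// ?eE ?ger_pMr// ?invf_le1 ?ler1n// andbT.
  apply/eqP => /(congr1 (fun t => t `^ r)%R); rewrite eE -[RHS]mulr1.
  move=> /(mulfI (lt0r_neq0 xr0))/eqP; rewrite invr_eq1.
  by rewrite (eqr_nat R n.+2 1).
rewrite (_ : `]0%R, x]%classic = \bigcup_n `[e n, x]%classic); last first.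
  apply/seteqP; split => t /=; rewrite in_itv/=.
    move=> /andP[t0 tx]; have tr0 : (0 < t `^ r)%R by rewrite powR_gt0.
    exists (Num.truncn (x `^ r / t `^ r)) => //; rewrite /= in_itv/= tx andbT.
    apply: lt_pow => //; rewrite eE ler_pdivrMr// mulrC -ler_pdivrMr//.
    apply: ltW; apply: lt_le_trans (truncnS_gt _) _.
    by rewrite ler_nat.
  by move=> [n _] /=; rewrite in_itv/= => /andP[et ->]; rewrite (lt_le_trans _ et).
have incr : {homo (fun n => `[e n, x]%classic) : n m / (n <= m)%N >-> (n <= m)%O}.
  move=> n m nm; apply/subsetPset => t /=; rewrite !in_itv/= => /andP[et ->].
  rewrite andbT; apply: le_trans et; apply: (lt_pow _ _ (e0 m) (e0 n)).
  by rewrite !eE ler_pM2l// lef_pV2 ?posrE// ler_nat !ltnS.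
have cvgI : \int[leb]_(t in `[e n, x]) power_density r t @[n --> \oo] -->
    \int[leb]_(t in \bigcup_n `[e n, x]%classic) power_density r t.
  apply: ge0_nondecreasing_set_cvg_integral => //.
    by move=> n; exact: measurable_power_density.
  by move=> n t _; exact: power_density_ge0 (ltW r0).
apply: (cvg_unique _ cvgI) => //.
rewrite (_ : (fun _ => _) = EFin \o (fun n => x `^ r - x `^ r * n.+2%:R^-1)%R); last first.
  by apply/funext => n; rewrite integral_power_cc// eE.
apply: cvg_EFin; first exact: nearW.
rewrite -[X in _ --> X]subr0; apply: cvgB; first exact: cvg_cst.
rewrite -(mulr0 (x `^ r)%R); apply: cvgM; first exact: cvg_cst.
by have := @cvg_harmonic R; rewrite -cvg_shiftS.
Qed.

Lemma integral_power (r : R) (D : \bar R) : (0 < r)%R -> 0 <= D ->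
  \int[leb]_(t in [set t | (0 < t)%R /\ t%:E < D]) power_density r t = D `^ r.
Proof.
move=> r0; case: D => [x|_|//].
  rewrite lee_fin le_eqVlt => /predU1P[<-|x0].
    rewrite poweR0r ?gt_eqF// (_ : [set _ | _] = set0) ?integral_set0//.
    by apply/seteqP; split => t //= [t0]; rewrite lte_fin ltNge ltW.
  rewrite poweR_EFin -integral_power_oo//; congr (integral _ _ _).
  by apply/seteqP; split => t /=; rewrite in_itv/= lte_fin => /andP.
(* An infinite [D] reduces to finite ones: [(0, A^(1/r))] alone already has mass [A]. *)
rewrite poweRyr ?gt_eqF//; apply/eqyP => A A0.
have A'0 : (0 < A `^ r^-1)%R by rewrite powR_gt0.
rewrite -[A](powRr1 (ltW A0)) -(mulVf (lt0r_neq0 r0)) powRrM -integral_power_oo//.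
have mS : measurable [set t : R | (0 < t)%R /\ t%:E < +oo].
  rewrite (_ : [set _ | _] = `]0%R, +oo[%classic)//.
  by apply/seteqP; split => t /=; rewrite in_itv/= ltry andbT => // -[].
apply: ge0_subset_integral => //; first exact: measurable_power_density.
  by move=> t _; exact: power_density_ge0 (ltW r0).
by move=> t /=; rewrite in_itv/= => /andP[-> _]; rewrite ltry.
Qed.

End PowerIntegral.

(** * The layer-cake formula *)

Section LayerCake.
Context {R : realType}.
Local Notation leb := (@lebesgue_measure R).

(** Write [g x ^ r] as the mass of [0 < l < g x] under [power_density r] and apply Tonelli. The
    weight [rho] is 1 for L^p norms, a power density for Lorentz norms, and [sigma] or the averaged
    function in Doob's inequality. *)
Lemma layer_cake d (T : measurableType d)
    (nu : {sigma_finite_measure set T -> \bar R}) (rho g : T -> \bar R) (r : R) :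
  measurable_fun [set: T] rho -> measurable_fun [set: T] g ->
  (forall x, 0 <= rho x) -> (forall x, 0 <= g x) -> (0 < r)%R ->
  \int[nu]_x (rho x * g x `^ r) =
  \int[leb]_(l in `]0%R, +oo[) (power_density r l *
    \int[nu]_(x in [set x | l%:E < g x]) rho x).
Proof.
move=> mrho mg rho0 g0 r0.
pose S := [set z : T * measurableTypeR R | (0 < z.2)%R /\ z.2%:E < g z.1].
pose k := (fun z : T * measurableTypeR R => rho z.1 * power_density r z.2) \_ S.
have mS : measurable S.
  rewrite (_ : S = (setT `*` `]0%R, +oo[) `&` (setT `&` [set z | z.2%:E < g z.1])).
    apply: measurableI; first exact: measurableX.
    apply: measurable_lte => //; first exact: measurableT_comp.
    exact: measurableT_comp.
  by apply/seteqP; split => -[x l]/=; rewrite /S /= in_itv/= andbT; tauto.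
have mk : measurable_fun setT k.
  apply/(measurable_restrictT _ _).1 => //; apply: measurable_funTS.
  apply: emeasurable_funM; first exact: measurableT_comp.
  apply: (@measurableT_comp _ _ _ _ _ _ (power_density r)) => //.
  exact: measurable_power_density.
have k0 z : 0 <= k z.
  by apply: erestrict_ge0 => y _; rewrite mule_ge0// power_density_ge0 ?ltW.
have mSx x : measurable [set l : measurableTypeR R | (0 < l)%R /\ l%:E < g x].
  rewrite (_ : [set _ | _] = `]0%R, +oo[ `&` (setT `&` [set l | l%:E < g x])).
    apply: measurableI => //; exact: measurable_lte.
  by apply/seteqP; split => l/=; rewrite in_itv/= andbT; tauto.
have mSl (l : R) : measurable [set x : T | l%:E < g x].
  by rewrite -[X in measurable X]setTI; exact: measurable_lte.
transitivity (\int[nu]_x \int[leb]_l k (x, l)).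
  apply: eq_integral => x _.
  rewrite -(integral_power r0 (g0 x)).
  rewrite -ge0_integralZl//; last 2 first.
  - exact: measurable_power_density.
  - by move=> l _; exact: power_density_ge0 (ltW r0).
  rewrite integral_mkcond; apply: eq_integral => l _.
  by rewrite /k !patchE; congr (if _ then _ else _).
rewrite fubini_tonelli// [in RHS]integral_mkcond; apply: eq_integral => l _.
rewrite patchE; case: ifPn => [|].
  rewrite inE/= in_itv/= andbT => l0.
  rewrite -ge0_integralZl//; last 2 first.
  - exact: measurable_funTS.
  - exact: power_density_ge0 (ltW r0).
  rewrite [in RHS]integral_mkcond; apply: eq_integral => x _.
  rewrite /k !patchE; case: ifPn => [|xl]; last first.
    rewrite ifF//; apply/negP; rewrite inE/= => lg; move/negP: xl; apply.
    by rewrite inE.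
  rewrite inE => -[_ lg]; rewrite ifT ?inE//.
  by rewrite muleC.
move=> l0; apply: integral0_eq => x _; rewrite /k patchE ifF//.
by apply/negP; rewrite inE => -[/= l0' _]; move/negP: l0; rewrite inE/= in_itv/= l0'.
Qed.

End LayerCake.

(** * Powers, approximation and monotonicity in the extended reals *)

Section ErealFacts.
Context {R : realType}.
Implicit Types x y : \bar R.

Lemma poweRK x (r : R) : (r != 0)%R -> 0 <= x -> (x `^ r) `^ r^-1 = x.
Proof. by move=> r0 x0; rewrite -poweRrM mulfV// poweRe1. Qed.

Lemma lee_poweR x y (r : R) : (0 <= r)%R -> 0 <= x -> x <= y -> x `^ r <= y `^ r.
Proof.
move=> r0 x0 xy; apply: gt0_ler_poweR => //; rewrite in_itv/= leey andbT//.
exact: le_trans xy.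
Qed.

Lemma lee_poweR2 x y (r : R) : (0 < r)%R -> 0 <= x -> 0 <= y ->
  (x `^ r <= y `^ r) = (x <= y).
Proof.
move=> r0 x0 y0; apply/idP/idP; last exact: lee_poweR (ltW r0) x0.
rewrite -{2}(poweRK (lt0r_neq0 r0) x0) -{2}(poweRK (lt0r_neq0 r0) y0).
by apply: lee_poweR; rewrite ?poweR_ge0// invr_ge0 ltW.
Qed.

Lemma lte_poweR2 x y (r : R) : (0 < r)%R -> 0 <= x -> 0 <= y ->
  (x `^ r < y `^ r) = (x < y).
Proof. by move=> r0 x0 y0; rewrite !ltNge lee_poweR2. Qed.

Lemma poweR_lee_inv x y (r : R) : (0 < r)%R -> 0 <= x -> 0 <= y ->
  (x <= y `^ r^-1) = (x `^ r <= y).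
Proof.
move=> r0 x0 y0; rewrite -(@lee_poweR2 x _ r)// ?poweR_ge0//.
by rewrite -poweRrM mulVf ?gt_eqF// poweRe1.
Qed.

Lemma lee_approx x y : 0 <= y ->
  (forall l : R, (0 < l)%R -> l%:E < x -> l%:E <= y) -> x <= y.
Proof.
move=> y0 xy; rewrite leNgt; apply/negP => yx.
move: y y0 xy yx => [y| |//] y0; last by rewrite ltNge leey.
rewrite lee_fin in y0.
move: x => [x| |//] xy yx.
  rewrite lte_fin in yx.
  have := xy ((x + y) / 2)%R; rewrite lte_fin lee_fin => h.
  suff : ((x + y) / 2 <= y)%R by lra.
  by apply: h; lra.
suff : (y + 1 <= y)%R by lra.
by rewrite -lee_fin; apply: xy; rewrite ?ltry//; lra.
Qed.

Lemma lee_approxZ (c : R) x y : (0 < c)%R -> 0 <= y ->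
  (forall l : R, (0 < l)%R -> l%:E < x -> c%:E * l%:E <= y) -> c%:E * x <= y.
Proof.
move=> c0 y0 xy; rewrite -lee_pdivlMl//; apply: lee_approx.
  by rewrite mule_ge0// lee_fin invr_ge0 ltW.
by move=> l l0 lx; rewrite lee_pdivlMl//; exact: xy.
Qed.

(** The integral of a nonnegative function is a supremum over simple functions below it, so
    monotonicity holds without measurability. *)
Lemma le_integral_nonneg d (T : measurableType d)
    (nu : {measure set T -> \bar R}) (D : set T) (f g : T -> \bar R) :
  (forall t, D t -> 0 <= f t) -> (forall t, D t -> f t <= g t) ->
  \int[nu]_(x in D) f x <= \int[nu]_(x in D) g x.
Proof.
move=> f0 fg; rewrite [leLHS]integral_mkcond [leRHS]integral_mkcond.
rewrite !ge0_integralTE; last 2 first.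
- by apply: erestrict_ge0 => x Dx; exact: le_trans (f0 _ Dx) (fg _ Dx).
- exact: erestrict_ge0.
apply: le_ereal_sup => _ [h hf <-]; exists h => // x.
apply: le_trans (hf x) _; rewrite !patchE; case: ifPn => //.
by rewrite inE; exact: fg.
Qed.

End ErealFacts.

(** * Distribution functions and rearrangements *)

Section Distribution.
Context {R : realType} {d : nat}.
Local Notation T := (Rd R d).
Local Notation mu := (@lebesgue_d R d).
Local Notation leb := (@lebesgue_measure R).
Implicit Types f g : T -> \bar R.

Definition distribution_fun f (l : R) : \bar R := mu [set x | l%:E < `|f x|].

Lemma distribution_fun_ge0 f l : 0 <= distribution_fun f l.
Proof. exact: measure_ge0. Qed.

Lemma distribution_fun_nincr f (l l' : R) : (l <= l')%R ->
  distribution_fun f l' <= distribution_fun f l.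
Proof.
by move=> ll'; apply: le_lebesgue_d => x /=; apply: le_lt_trans; rewrite lee_fin.
Qed.

Lemma le_distribution_fun f g l : (forall x, `|f x| <= `|g x|) ->
  distribution_fun f l <= distribution_fun g l.
Proof.
by move=> fg; apply: le_lebesgue_d => x /= /lt_le_trans; apply.
Qed.

Lemma rearrangement_ge0 f t : 0 <= rearrangement f t.
Proof. by apply: le_ereal_inf_tmp => y []. Qed.

Lemma le_rearrangement f g t : (forall x, `|f x| <= `|g x|) ->
  rearrangement f t <= rearrangement g t.
Proof.
move=> fg; apply: le_ereal_inf => y [y0 gy]; split => //.
by apply: le_trans gy; apply: le_lebesgue_d => x /= /lt_le_trans; apply.
Qed.

(** Holds for arbitrary functions because the measure is monotone on all sets; hence
    [fractional_maximal] never has to be shown measurable. *)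
Lemma le_lorentz_norm (a : R) (b : \bar R) f g : (0 < a)%R -> 0 <= b ->
  (forall x, `|f x| <= `|g x|) -> lorentz_norm a b f <= lorentz_norm a b g.
Proof.
move=> a0; case: b => [b|_|]; last by move=> b0; exfalso; move: b0.
  rewrite lee_fin => b0 fg; apply: lee_poweR; first by rewrite invr_ge0.
    apply: mule_ge0; first by rewrite lee_fin divr_ge0// ltW.
    apply: integral_ge0 => t; rewrite /= in_itv/= andbT => t0.
    by rewrite mule_ge0 ?poweR_ge0// lee_fin invr_ge0 ltW.
  apply: lee_wpmul2l; first by rewrite lee_fin divr_ge0// ltW.
  apply: le_integral_nonneg => t; rewrite /= in_itv/= andbT => t0.
    by rewrite mule_ge0 ?poweR_ge0// lee_fin invr_ge0 ltW.
  apply: lee_wpmul2r; first by rewrite lee_fin invr_ge0 ltW.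
  apply: lee_poweR => //.
    by rewrite mule_ge0 ?rearrangement_ge0// lee_fin powR_ge0.
  by apply: lee_wpmul2l; rewrite ?lee_fin ?powR_ge0// le_rearrangement.
move=> fg; apply: ge_ereal_sup => _ [t t0 <-].
apply: le_trans (_ : (t `^ a^-1)%:E * rearrangement g t <= _).
  by apply: lee_wpmul2l; rewrite ?lee_fin ?powR_ge0// le_rearrangement.
by apply: ereal_sup_ubound; exists t.
Qed.

Lemma measurable_superlevel f (l : \bar R) : measurable_fun setT f ->
  measurable [set x | l < `|f x|].
Proof.
move=> mf; rewrite -[X in measurable X]setTI.
exact: (@emeasurable_fun_o_infty _ _ _ _ _ measurableT (measurableT_comp _ mf)).
Qed.

(** Rearrangement and distribution function are generalized inverses. From right to left this rests
    on right continuity of the distribution function, obtained from continuity of the measure along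
    the sets [F n]; measurability of [f] enters there. *)
Lemma lt_rearrangement f (l t : R) : measurable_fun setT f -> (0 <= l)%R ->
  l%:E < rearrangement f t <-> t%:E < distribution_fun f l.
Proof.
move=> mf l0; split; last first.
  apply: contraPT; rewrite -!leNgt => rl; apply/negP; rewrite -leNgt.
  pose F n := [set x | (l + n.+1%:R^-1)%:E < `|f x|].
  have FE : [set x | l%:E < `|f x|] = \bigcup_n F n.
    apply/seteqP; split => x /=; last first.
      move=> [n _] /=; apply: le_lt_trans.
      by rewrite lee_fin lerDl invr_ge0.
    have := abse_ge0 (f x); case fxE : `|f x| => [y| |//] _.
      rewrite lte_fin => ly; have [n yn] := ltr_add_invr ly.
      by exists n => //; rewrite /F/= fxE lte_fin.
    by exists 0%N => //; rewrite /F/= fxE ltry.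
  have mF n : measurable (F n) by exact: measurable_superlevel.
  have ndF : {homo F : n m / (n <= m)%N >-> (n <= m)%O}.
    move=> n m nm; apply/subsetPset => x /=; apply: le_lt_trans.
    by rewrite lee_fin lerD2l lef_pV2 ?posrE// ler_nat ltnS.
  rewrite /distribution_fun FE.
  have := @nondecreasing_cvg_mu _ _ R mu F mF (bigcup_measurable (fun n _ => mF n)) ndF.
  apply: cvge_le; apply: nearW => n /=.
  have : rearrangement f t < (l + n.+1%:R^-1)%:E.
    by apply: le_lt_trans rl _; rewrite lte_fin ltrDl invr_gt0.
  move=> /ereal_inf_lt[y [y0 yt] yl]; apply: le_trans yt.
  by apply: le_lebesgue_d => x; apply: lt_trans.
apply: contraPT; rewrite -leNgt => lt; apply/negP; rewrite -leNgt.
by apply: ereal_inf_lbound; split => //; rewrite lee_fin.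
Qed.

End Distribution.

(** * Lorentz norms through the distribution function *)

Section LorentzDistribution.
Context {R : realType} {d : nat}.
Local Notation T := (Rd R d).
Local Notation mu := (@lebesgue_d R d).
Local Notation leb := (@lebesgue_measure R).
Implicit Types f g : T -> \bar R.

(** The Lorentz norm as a function of the distribution function [D] alone, which lets Minkowski's
    inequality and monotone convergence act on [D]. *)
Definition lorentz_functional (a : R) (b : \bar R) (D : R -> \bar R) : \bar R :=
  match b with
  | s%:E => (\int[leb]_(l in `]0%R, +oo[)
               (power_density s l * D l `^ (s / a))) `^ s^-1
  | _ => ereal_sup [set l%:E * D l `^ a^-1 | l in `]0%R, +oo[%classic]
  end.

Lemma nincr_measurable (D : R -> \bar R) :
  (forall l l' : R, (l <= l')%R -> D l' <= D l) ->
  measurable_fun [set: measurableTypeR R] D.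
Proof.
move=> Dn; apply: (measurability _ (ErealGenOInfty.measurableE R)) => // _ [_ [x ->] <-].
rewrite setTI; apply: is_interval_measurable => l l' /=.
rewrite !in_itv/= !andbT => xl xl' z /andP[lz zl'].
by rewrite in_itv/= andbT (lt_le_trans xl')// Dn.
Qed.

Lemma rearrangement_nincr f (t t' : R) : (t <= t')%R ->
  rearrangement f t' <= rearrangement f t.
Proof.
move=> tt'; apply: le_ereal_inf => y [y0 yt]; split => //.
by apply: le_trans yt _; rewrite lee_fin.
Qed.

(** The layer-cake formula on the half-line, with weight [power_density (s / a)] and function
    [rearrangement f]. The superlevel set at [l] is [(0, D l)] for the distribution function [D], of
    weighted mass [D l ^ (s / a)]. The normalising factor [s / a] of the norm is exactly the one in
    the density. *)
Lemma lorentz_normE_fin (a s : R) f : (0 < a)%R -> (0 < s)%R ->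
  measurable_fun setT f ->
  lorentz_norm a s%:E f = lorentz_functional a s%:E (distribution_fun f).
Proof.
move=> a0 s0 mf; have sa0 : (0 < s / a)%R by rewrite divr_gt0.
rewrite /lorentz_norm /lorentz_functional; congr (_ `^ _).
have powE (t : R) : (0 < t)%R ->
    (t^-1 * t `^ (a^-1 * s) = t `^ (s / a - 1))%R.
  move=> t0; rewrite powRB ?(lt0r_neq0 t0) ?implybT// powRr1 ?ltW//.
  by rewrite [LHS]mulrC (mulrC a^-1%R).
pose I : set (measurableTypeR R) := `]0%R, +oo[%classic.
have mI : measurable I by exact: measurable_itv.
pose rho := (power_density (s / a) : measurableTypeR R -> \bar R) \_ I.
pose g := (rearrangement f : measurableTypeR R -> \bar R) \_ I.
have lt_g (l t : R) : (0 < l)%R ->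
    l%:E < g t <-> (0 < t)%R /\ t%:E < distribution_fun f l.
  move=> l0; rewrite -(lt_rearrangement _ mf (ltW l0)) /g patchE.
  case: ifPn => [|/negP]; rewrite inE /I/= in_itv/= andbT => t0; first by tauto.
  by split => [|[]//]; rewrite ltNge lee_fin ltW.
have g0 t : 0 <= g t.
  by apply: erestrict_ge0 => y _; exact: rearrangement_ge0.
have mrho : measurable_fun setT rho.
  apply/(measurable_restrictT _ _).1 => //; exact: measurable_power_density.
have mre : measurable_fun I (rearrangement f).
  apply: (measurable_funS measurableT) => //.
  by apply: nincr_measurable => l l'; exact: rearrangement_nincr.
have mg : measurable_fun setT g by exact/(measurable_restrictT _ _).1.
have rho0 t : 0 <= rho t.
  by apply: erestrict_ge0 => y _; exact: power_density_ge0 (ltW sa0).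
have := layer_cake leb mrho mg rho0 g0 s0.
rewrite -ge0_integralZl_EFin//; last 3 first.
- move=> t; rewrite /= in_itv/= andbT => t0.
  by rewrite mule_ge0 ?poweR_ge0// lee_fin invr_ge0 ltW.
- apply: emeasurable_funM; last first.
    apply: (eq_measurable_fun (fun t : R => (t `^ (-1))%:E)).
      move=> t; rewrite inE/= in_itv/= andbT => t0.
      by rewrite powR_inv1 ?ltW.
    by apply/measurable_EFinP; exact: measurable_funTS (measurable_powR _).
  apply: (@measurableT_comp _ _ _ _ _ _ (fun x => x `^ s)).
    exact: measurable_poweR.
  apply: emeasurable_funM.
    by apply/measurable_EFinP; exact: measurable_funTS (measurable_powR _).
  exact: mre.
- by rewrite divr_ge0 ?ltW.
move=> lc; transitivity (\int[leb]_x (rho x * g x `^ s)).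
  rewrite [LHS]integral_mkcond; apply: eq_integral => t _.
  rewrite /rho /g !patchE; case: ifPn; last by rewrite mul0e.
  rewrite inE/= in_itv/= andbT => t0.
  rewrite poweRM ?rearrangement_ge0 ?lee_fin ?powR_ge0//.
  rewrite muleA (muleC _ (t^-1)%:E) muleA muleA poweR_EFin -powRrM.
  rewrite -!EFinM; congr (_%:E * _); rewrite -mulrA mulrCA; congr (_ * _)%R.
  exact: powE.
rewrite lc; apply: eq_integral => l; rewrite inE/= in_itv/= andbT => l0.
congr (_ * _); rewrite -(integral_power sa0 (distribution_fun_ge0 f l)).
rewrite (_ : [set x | l%:E < g x] =
    [set t : measurableTypeR R | (0 < t)%R /\ t%:E < distribution_fun f l]).
  apply: eq_integral => t; rewrite inE /= => -[t0 _].
  by rewrite /rho patchE ifT// inE /I/= in_itv/= t0.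
by apply/seteqP; split => t /=; rewrite lt_g.
Qed.

(** Each term of one supremum is approximated from below by terms of the other:
    [l < rearrangement f t] and [t < distribution_fun f l] are the same condition. *)
Lemma lorentz_normE_infty (a : R) f : (0 < a)%R -> measurable_fun setT f ->
  lorentz_norm a +oo f = lorentz_functional a +oo (distribution_fun f).
Proof.
move=> a0 mf; rewrite /lorentz_norm /lorentz_functional.
have sup0 (h : R -> \bar R) : (forall t : R, (0 < t)%R -> 0 <= h t) ->
    0 <= ereal_sup [set h t | t in `]0%R, +oo[%classic].
  move=> h0; apply: le_trans (h0 1%R ltr01) _; apply: ereal_sup_ubound.
  by exists 1%R => //=; rewrite in_itv/= andbT.
apply/le_anti/andP; split; apply: ge_ereal_sup => _ [t /= + <-];
    rewrite in_itv/= andbT => t0.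
  apply: lee_approxZ; first by rewrite powR_gt0.
    by apply: sup0 => l l0; rewrite mule_ge0 ?poweR_ge0// lee_fin ltW.
  move=> l l0 /(lt_rearrangement _ mf (ltW l0)) tl.
  apply: le_trans (_ : l%:E * distribution_fun f l `^ a^-1 <= _).
    rewrite muleC; apply: lee_wpmul2l; first by rewrite lee_fin ltW.
    rewrite -poweR_EFin; apply: lee_poweR (ltW tl); last by rewrite lee_fin ltW.
    by rewrite invr_ge0 ltW.
  by apply: ereal_sup_ubound; exists l => //=; rewrite in_itv/= l0.
apply: lee_approxZ => //.
  apply: sup0 => l _; rewrite mule_ge0 ?lee_fin ?powR_ge0//.
  exact: rearrangement_ge0.
(* In this direction the letters change roles: [t] is the level and [l ^ a] the argument of the
   rearrangement. *)
move=> l l0 lD; have la0 : (0 < l `^ a)%R by rewrite powR_gt0.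
have tD : (l `^ a)%:E < distribution_fun f t.
  rewrite -(@lte_poweR2 _ _ _ a^-1) ?invr_gt0 ?lee_fin ?powR_ge0 ?distribution_fun_ge0//.
  by rewrite poweR_EFin -powRrM mulfV ?gt_eqF// powRr1 ?ltW.
apply: le_trans (_ : ((l `^ a) `^ a^-1)%:E * rearrangement f (l `^ a)%R <= _).
  rewrite -powRrM mulfV ?gt_eqF// powRr1 ?(ltW l0)// muleC.
  apply: lee_wpmul2l; first by rewrite lee_fin ltW.
  by apply: ltW; apply/lt_rearrangement => //; exact: ltW.
by apply: ereal_sup_ubound; exists (l `^ a)%R => //=; rewrite in_itv/= la0.
Qed.

Lemma lorentz_normE (a : R) (b : \bar R) f : (0 < a)%R -> 0 < b ->
  measurable_fun setT f ->
  lorentz_norm a b f = lorentz_functional a b (distribution_fun f).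
Proof.
move=> a0; case: b => [s|_|//]; last exact: lorentz_normE_infty.
by rewrite lte_fin; exact: lorentz_normE_fin.
Qed.

Lemma lorentz_norm_pp (p : R) f : (0 < p)%R -> measurable_fun setT f ->
  lorentz_norm p p%:E f = (\int[mu]_x `|f x| `^ p) `^ p^-1.
Proof.
move=> p0 mf; rewrite lorentz_normE ?lte_fin//=; congr (_ `^ _).
have mf' : measurable_fun setT (fun x => `|f x|) by exact: measurableT_comp.
have := layer_cake (@lebesgue_sf R d) (measurable_cst 1) mf'
  (fun=> lee01) (fun x => abse_ge0 (f x)) p0.
under eq_integral do rewrite mul1e.
move=> ->; apply: eq_integral => l; rewrite inE/= in_itv/= andbT => l0.
congr (_ * _); rewrite divff ?gt_eqF// poweRe1 ?distribution_fun_ge0//.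
rewrite integral_cst ?mul1e//; exact: measurable_superlevel.
Qed.

Lemma lorentz_norm_ge0 (a : R) (b : \bar R) f : 0 <= b -> 0 <= lorentz_norm a b f.
Proof.
case: b => [b _|_|//]; first exact: poweR_ge0.
apply: le_trans (_ : (1 `^ a^-1)%:E * rearrangement f 1 <= _).
  by rewrite mule_ge0 ?rearrangement_ge0// lee_fin powR_ge0.
by apply: ereal_sup_ubound; exists 1%R => //=; rewrite in_itv/= andbT.
Qed.

Lemma rearrangementZ_le (c : R) f t : (0 < c)%R ->
  rearrangement (fun x => c%:E * f x) t <= c%:E * rearrangement f t.
Proof.
move=> c0; rewrite -lee_pdivrMl//; apply: le_ereal_inf_tmp => y [y0 yt].
rewrite lee_pdivrMl//; apply: ereal_inf_lbound; split.
  by rewrite mule_ge0// lee_fin ltW.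
apply: le_trans yt; apply: le_lebesgue_d => x /=.
by rewrite abseM gee0_abs ?lee_fin ?ltW// lte_pmul2l.
Qed.

Lemma rearrangementZ (c : R) f t : (0 < c)%R ->
  rearrangement (fun x => c%:E * f x) t = c%:E * rearrangement f t.
Proof.
move=> c0; apply/le_anti; rewrite rearrangementZ_le//= -lee_pdivlMl//.
rewrite [X in X t](_ : _ = rearrangement (fun x => c^-1%:E * (c%:E * f x))).
  by apply: rearrangementZ_le; rewrite invr_gt0.
congr rearrangement; apply/funext => x.
by rewrite muleA -EFinM mulVf ?gt_eqF// mul1e.
Qed.

Lemma lorentz_normZ (a c : R) (b : \bar R) f : (0 < a)%R -> 0 < b -> (0 < c)%R ->
  lorentz_norm a b (fun x => c%:E * f x) = c%:E * lorentz_norm a b f.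
Proof.
move=> a0; case: b => [s|_|//] /=; rewrite ?lte_fin.
  move=> s0 c0; pose I t := ((t `^ a^-1)%:E * rearrangement f t) `^ s * (t^-1)%:E.
  have IZ (t : R) : ((t `^ a^-1)%:E * rearrangement (fun x => c%:E * f x) t) `^ s *
      (t^-1)%:E = (c `^ s)%:E * I t.
    rewrite (rearrangementZ _ _ c0) muleCA poweRM.
    - by rewrite /I muleA poweR_EFin.
    - by rewrite lee_fin ltW.
    - by rewrite mule_ge0 ?rearrangement_ge0// lee_fin powR_ge0.
  have -> : \int[leb]_(t in `]0%R, +oo[)
      (((t `^ a^-1)%:E * rearrangement (fun x => c%:E * f x) t) `^ s * (t^-1)%:E) =
      \int[leb]_(t in `]0%R, +oo[) ((c `^ s)%:E * I t).
    by apply: eq_integral => t _; exact: IZ.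
  have mI : measurable_fun (`]0%R, +oo[%classic : set (measurableTypeR R)) I.
    apply: emeasurable_funM; last first.
      apply: (eq_measurable_fun (fun t : R => (t `^ (-1))%:E)).
        move=> t; rewrite inE/= in_itv/= andbT => t0.
        by rewrite powR_inv1 ?ltW.
      by apply/measurable_EFinP; exact: measurable_funTS (measurable_powR _).
    apply: (@measurableT_comp _ _ _ _ _ _ (fun x => x `^ s)).
      exact: measurable_poweR.
    apply: emeasurable_funM.
      by apply/measurable_EFinP; exact: measurable_funTS (measurable_powR _).
    apply: (measurable_funS measurableT) => //.
    by apply: nincr_measurable => l l'; exact: rearrangement_nincr.
  have I0 t : `]0%R, +oo[%classic t -> 0 <= I t.
    rewrite /= in_itv/= andbT => t0.
    by rewrite mule_ge0 ?poweR_ge0// lee_fin invr_ge0 ltW.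
  rewrite ge0_integralZl_EFin ?powR_ge0// muleCA [in LHS]poweRM ?lee_fin ?powR_ge0//.
    by rewrite poweR_EFin -powRrM mulfV ?gt_eqF// powRr1 ?(ltW c0).
  by rewrite mule_ge0 ?integral_ge0// lee_fin divr_ge0 ?ltW.
move=> c0; apply/le_anti/andP; split.
  apply: ge_ereal_sup => _ [t t0 <-]; rewrite rearrangementZ// muleCA.
  apply: lee_wpmul2l; first by rewrite lee_fin ltW.
  by apply: ereal_sup_ubound; exists t.
rewrite -lee_pdivlMl//; apply: ge_ereal_sup => _ [t t0 <-].
rewrite lee_pdivlMl//; apply: ereal_sup_ubound; exists t => //.
by rewrite rearrangementZ// muleCA.
Qed.

End LorentzDistribution.

(** * Lower bound, monotone limits and subadditivity of the functional *)

Section LorentzFunctional.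
Context {R : realType}.
Local Notation leb := (@lebesgue_measure R).
Implicit Types D : R -> \bar R.

Lemma measurable_functional_integrand (s r : R) D :
  (forall l l' : R, (l <= l')%R -> D l' <= D l) ->
  measurable_fun [set: measurableTypeR R]
    (fun l : measurableTypeR R => power_density s l * D l `^ r).
Proof.
move=> Dn; apply: emeasurable_funM; first exact: measurable_power_density.
apply: (@measurableT_comp _ _ _ _ _ _ (fun x => x `^ r)).
  exact: measurable_poweR.
exact: nincr_measurable.
Qed.

Lemma lorentz_functional_ge0 (a : R) (b : \bar R) D :
  (forall l, 0 <= D l) -> 0 <= lorentz_functional a b D.
Proof.
have sup0 : 0 <= ereal_sup [set l%:E * D l `^ a^-1 | l in `]0%R, +oo[%classic].
  apply: le_trans (_ : 1%:E * D 1%R `^ a^-1 <= _).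
    by rewrite mul1e poweR_ge0.
  by apply: ereal_sup_ubound; exists 1%R => //=; rewrite in_itv/= andbT.
by case: b => [s| |] _ //; exact: poweR_ge0.
Qed.

Lemma lorentz_functional_le (a s : R) (D : R -> \bar R) (K : \bar R) :
  (0 < s)%R -> 0 <= K -> (lorentz_functional a s%:E D <= K) =
  (\int[leb]_(l in `]0%R, +oo[) (power_density s l * D l `^ (s / a)) <= K `^ s).
Proof.
move=> s0 K0; have I0 : 0 <= \int[leb]_(l in `]0%R, +oo[)
    (power_density s l * D l `^ (s / a)).
  apply: integral_ge0 => l _; rewrite mule_ge0 ?poweR_ge0//.
  exact: power_density_ge0 (ltW s0).
rewrite /lorentz_functional -(@lee_poweR2 _ _ K s)// ?poweR_ge0//.
by rewrite -poweRrM mulVf ?gt_eqF// poweRe1.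
Qed.

(** Chebyshev's inequality for Lorentz norms: [D] is at least [D l] on [(0, l)], an interval of mass
    [l ^ s] under [power_density s]. The normalisation makes the constant 1. *)
Lemma lorentz_functional_lower (a : R) (b : \bar R) D (l : R) :
  (forall l, 0 <= D l) ->
  (forall l l' : R, (l <= l')%R -> D l' <= D l) -> (0 < a)%R -> 0 < b ->
  (0 < l)%R -> l%:E * D l `^ a^-1 <= lorentz_functional a b D.
Proof.
move=> D0 Dn a0 b0 l0; have supl :
    l%:E * D l `^ a^-1 <= ereal_sup [set l%:E * D l `^ a^-1 | l in `]0%R, +oo[%classic].
  by apply: ereal_sup_ubound; exists l => //=; rewrite in_itv/= l0.
case: b b0 => [s| |]//; rewrite lte_fin => s0.
have L0 : 0 <= l%:E * D l `^ a^-1 by rewrite mule_ge0 ?poweR_ge0// lee_fin ltW.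
rewrite /lorentz_functional poweR_lee_inv//; last first.
  apply: integral_ge0 => x _; rewrite mule_ge0 ?poweR_ge0//.
  exact: power_density_ge0 (ltW s0).
rewrite poweRM ?lee_fin ?(ltW l0) ?poweR_ge0// -[in X in _ * X]poweRrM (mulrC a^-1%R).
rewrite poweR_EFin -integral_power_oo//.
rewrite -ge0_integralZr//; last 3 first.
- exact: measurable_power_density.
- by move=> t _; exact: power_density_ge0 (ltW s0).
- exact: poweR_ge0.
apply: (@le_trans _ _ (\int[leb]_(t in `]0%R, l[) (power_density s t * D t `^ (s / a)))).
  apply: le_integral_nonneg => t; rewrite /= in_itv/= => /andP[t0 tl].
    by rewrite mule_ge0 ?poweR_ge0//; exact: power_density_ge0 (ltW s0).
  apply: lee_wpmul2l; first exact: power_density_ge0 (ltW s0).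
  by apply: lee_poweR => //; [rewrite divr_ge0 ?ltW|apply: Dn; exact: ltW].
apply: ge0_subset_integral => //.
- apply: (measurable_funS measurableT) => //.
  exact: measurable_functional_integrand.
- move=> t _; rewrite mule_ge0 ?poweR_ge0//; exact: power_density_ge0 (ltW s0).
- by move=> t /=; rewrite !in_itv/= andbT => /andP[].
Qed.

(** For nondecreasing sequences limits are suprema, and positive powers commute with suprema; a
    limit [+oo] needs no separate treatment. *)
Lemma poweR_nd_cvg (u : (\bar R)^nat) (x : \bar R) (r : R) : (0 < r)%R ->
  (forall n, 0 <= u n) -> {homo u : n m / (n <= m)%N >-> n <= m} ->
  u @ \oo --> x -> (fun n => u n `^ r) @ \oo --> x `^ r.
Proof.
move=> r0 u0 ndu ux.
have ndur : {homo (fun n => u n `^ r) : n m / (n <= m)%N >-> n <= m}.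
  by move=> n m nm; apply: lee_poweR; rewrite ?(ltW r0)//; exact: ndu.
have xE : x = ereal_sup (range u).
  exact/(cvg_unique _ ux)/ereal_nondecreasing_cvgn.
have x0 : 0 <= x.
  by rewrite xE; apply: le_trans (u0 0%N) _; apply: ereal_sup_ubound; exists 0%N.
suff -> : x `^ r = ereal_sup (range (fun n => u n `^ r)).
  exact: ereal_nondecreasing_cvgn.
have s0 : 0 <= ereal_sup (range (fun n => u n `^ r)).
  apply: le_trans (poweR_ge0 (u 0%N) r) _.
  by apply: ereal_sup_ubound; exists 0%N.
apply/le_anti/andP; split.
  rewrite -poweR_lee_inv// xE; apply: ge_ereal_sup => _ [n _ <-].
  by rewrite poweR_lee_inv//; apply: ereal_sup_ubound; exists n.
apply: ge_ereal_sup => _ [n _ <-]; apply: lee_poweR => //; first exact: ltW.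
by rewrite xE; apply: ereal_sup_ubound; exists n.
Qed.

Lemma lorentz_functional_fatou (a : R) (b : \bar R) (K : \bar R)
    (Dn : nat -> R -> \bar R) D : (0 < a)%R -> 0 < b -> 0 <= K ->
  (forall n l, 0 <= Dn n l) ->
  (forall n (l l' : R), (l <= l')%R -> Dn n l' <= Dn n l) ->
  (forall l, {homo Dn^~ l : n m / (n <= m)%N >-> n <= m}) ->
  (forall l, (0 < l)%R -> Dn^~ l @ \oo --> D l) ->
  (forall n, lorentz_functional a b (Dn n) <= K) ->
  lorentz_functional a b D <= K.
Proof.
move=> a0 + K0 Dn0 Dnn ndD cvD; case: b => [s| |//]; last first.
  move=> _ DK; apply: ge_ereal_sup => _ [l /=+ <-]; rewrite in_itv/= andbT => l0.
  have ai0 : (0 < a^-1)%R by rewrite invr_gt0.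
  have cv : (fun n => l%:E * Dn n l `^ a^-1) @ \oo --> l%:E * D l `^ a^-1.
    by apply: cvgeZl => //; exact: poweR_nd_cvg (cvD _ l0).
  apply: (cvge_le _ cv); apply: nearW => n; apply: le_trans (DK n).
  by apply: ereal_sup_ubound; exists l => //=; rewrite in_itv/= l0.
rewrite lte_fin => s0 DK; rewrite lorentz_functional_le//.
have sa0 : (0 < s / a)%R by rewrite divr_gt0.
pose g n l := power_density s l * Dn n l `^ (s / a).
have cvg l : (0 < l)%R -> g^~ l @ \oo --> power_density s l * D l `^ (s / a).
  by move=> l0; apply: cvgeZl => //; exact: poweR_nd_cvg (cvD _ l0).
rewrite [leLHS](_ : _ = \int[leb]_(l in `]0%R, +oo[) limn (g^~ l)); last first.
  apply: eq_integral => l; rewrite inE/= in_itv/= andbT => l0.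
  by apply/esym/cvg_lim => //; exact: cvg.
have g0 n l : 0 <= g n l.
  by rewrite mule_ge0 ?poweR_ge0//; exact: power_density_ge0 (ltW s0).
have cvI : \int[leb]_(l in `]0%R, +oo[) g n l @[n --> \oo] -->
    \int[leb]_(l in `]0%R, +oo[) limn (g^~ l).
  apply: cvg_monotone_convergence => //.
    move=> n; apply: (measurable_funS measurableT) => //.
    by apply: measurable_functional_integrand; exact: Dnn.
  move=> l _ n m nm; apply: lee_wpmul2l; first exact: power_density_ge0 (ltW s0).
  by apply: lee_poweR; rewrite ?(ltW sa0)//; exact: ndD.
apply: (cvge_le _ cvI); apply: nearW => n.
by have := DK n; rewrite lorentz_functional_le.
Qed.

(* For [b >= a] the map sending a distribution function to the [a]-th power of
   the Lorentz norm is a norm, namely that of a weighted [L^(b/a)]. *)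
Lemma lorentz_functionalD (a : R) (b : \bar R) (D D1 D2 : R -> \bar R) :
  (0 < a)%R -> a%:E <= b ->
  (forall l, 0 <= D l) ->
  (forall l, 0 <= D1 l) -> (forall l, 0 <= D2 l) ->
  (forall l, (0 < l)%R -> D1 l < +oo) -> (forall l, (0 < l)%R -> D2 l < +oo) ->
  (forall l l' : R, (l <= l')%R -> D1 l' <= D1 l) ->
  (forall l l' : R, (l <= l')%R -> D2 l' <= D2 l) ->
  (forall l, (0 < l)%R -> D l <= D1 l + D2 l) ->
  lorentz_functional a b D `^ a <=
    lorentz_functional a b D1 `^ a + lorentz_functional a b D2 `^ a.
Proof.
move=> a0 + D0 D10 D20 D1f D2f D1n D2n DD; case: b => [s| |//]; last first.
  move=> _; rewrite -poweR_lee_inv ?lorentz_functional_ge0 ?adde_ge0 ?poweR_ge0//.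
  apply: ge_ereal_sup => _ [l /=+ <-]; rewrite in_itv/= andbT => l0.
  have la E : 0 <= E -> (l%:E * E `^ a^-1) `^ a = (l `^ a)%:E * E.
    move=> E0; rewrite poweRM ?poweR_ge0 ?lee_fin ?(ltW l0)// -[in X in _ * X]poweRrM.
    by rewrite mulVf ?gt_eqF// poweRe1.
  have l00 E : 0 <= l%:E * E `^ a^-1 by rewrite mule_ge0 ?poweR_ge0// lee_fin ltW.
  rewrite poweR_lee_inv ?adde_ge0 ?poweR_ge0// la//.
  apply: (@le_trans _ _ ((l `^ a)%:E * (D1 l + D2 l))).
    by apply: lee_wpmul2l; rewrite ?lee_fin ?powR_ge0//; exact: DD.
  rewrite ge0_muleDr// -!la//; apply: leeD; apply: lee_poweR; rewrite ?(ltW a0)//.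
    exact: (@lorentz_functional_lower a +oo D1).
  exact: (@lorentz_functional_lower a +oo D2).
rewrite lee_fin => as_; have s0 : (0 < s)%R := lt_le_trans a0 as_.
pose r := (s / a)%R; have r1 : (1 <= r)%R by rewrite ler_pdivlMr// mul1r.
have r0 : (0 < r)%R := lt_le_trans ltr01 r1.
pose I : set (measurableTypeR R) := `]0%R, +oo[%classic.
have mI : measurable I by exact: measurable_itv.
(* The [1/r]-th power of the density is moved into the function, which turns the weighted norm into
   a plain L^r norm, the setting of Minkowski's inequality. [fine] loses nothing, as [E l] is finite
   for [l > 0]. *)
pose phi (E : R -> \bar R) : measurableTypeR R -> R :=
  (fun l => ((s * l `^ (s - 1)) `^ r^-1 * fine (E l))%R) \_ I.
have mphi (E : R -> \bar R) : (forall l l' : R, (l <= l')%R -> E l' <= E l) ->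
    measurable_fun setT (phi E).
  move=> En; apply/(measurable_restrictT _ _).1 => //; apply: measurable_funTS.
  apply: measurable_funM.
    apply: (@measurableT_comp _ _ _ _ _ _ (fun x => x `^ r^-1)%R).
      exact: measurable_powR.
    by apply: measurable_funM => //; exact: measurable_powR.
  by apply: measurableT_comp => //; exact: nincr_measurable.
have phiE (E : R -> \bar R) : (forall l, 0 <= E l) ->
    (forall l, (0 < l)%R -> E l < +oo) ->
    'N[leb]_r%:E[EFin \o phi E] = lorentz_functional a s%:E E `^ a.
  move=> E0 Ef; rewrite unlock /lorentz_functional -poweRrM; congr (_ `^ _); last first.
    by rewrite /r invf_div mulrC.
  rewrite [RHS]integral_mkcond; apply: eq_integral => l _.
  rewrite /phi /= !patchE -/I; case: ifPn => [|_]; last first.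
    by rewrite normr0 powR0 ?gt_eqF.
  rewrite inE /I/= in_itv/= andbT => l0.
  have El : E l \is a fin_num by rewrite ge0_fin_numE ?Ef.
  rewrite -{2}(fineK El) poweR_EFin -EFinM; congr (_%:E).
  have sl : (0 <= s * l `^ (s - 1))%R by rewrite mulr_ge0 ?powR_ge0 ?ltW.
  rewrite ger0_norm ?mulr_ge0 ?powR_ge0 ?fine_ge0//.
  by rewrite powRM ?powR_ge0 ?fine_ge0// -powRrM mulVf ?gt_eqF// powRr1.
rewrite -(phiE D1)// -(phiE D2)//.
apply: le_trans (minkowski_EFin _ (mphi _ D1n) (mphi _ D2n) r1).
rewrite unlock /lorentz_functional -poweRrM invf_div (mulrC s^-1%R).
apply: lee_poweR; first by rewrite mulr_ge0 ?invr_ge0 ?ltW.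
  apply: integral_ge0 => l _; rewrite mule_ge0 ?poweR_ge0//.
  exact: power_density_ge0 (ltW s0).
rewrite [leLHS]integral_mkcond; apply: le_integral_nonneg => l _.
  by apply: erestrict_ge0 => x _; rewrite mule_ge0 ?poweR_ge0// power_density_ge0 ?ltW.
rewrite /phi /= !patchE -/I; case: ifPn => [|_]; last by rewrite lee_fin powR_ge0.
rewrite inE /I/= in_itv/= andbT => l0.
have D1l : D1 l \is a fin_num by rewrite ge0_fin_numE ?D1f.
have D2l : D2 l \is a fin_num by rewrite ge0_fin_numE ?D2f.
have sl : (0 <= s * l `^ (s - 1))%R by rewrite mulr_ge0 ?powR_ge0 ?ltW.
rewrite -mulrDr normrM (ger0_norm (powR_ge0 _ _)) ger0_norm ?addr_ge0 ?fine_ge0//.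
rewrite (@powRM _ ((s * l `^ (s - 1)) `^ r^-1)%R) ?powR_ge0 ?addr_ge0 ?fine_ge0//.
rewrite -powRrM mulVf ?gt_eqF// powRr1//.
rewrite EFinM; apply: lee_wpmul2l; first by rewrite lee_fin.
rewrite -poweR_EFin EFinD !fineK//; apply: lee_poweR => //; first exact: ltW.
exact: DD.
Qed.

End LorentzFunctional.

(** * Lorentz norms of maxima and of increasing limits *)

Section LorentzNorm.
Context {R : realType} {d : nat}.
Local Notation T := (Rd R d).
Local Notation mu := (@lebesgue_d R d).
Implicit Types f g h : T -> \bar R.

Lemma lorentz_norm_lower (a l : R) (b : \bar R) f : (0 < a)%R -> 0 < b ->
  measurable_fun setT f -> (0 < l)%R ->
  l%:E * mu [set x | l%:E < `|f x|] `^ a^-1 <= lorentz_norm a b f.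
Proof.
move=> a0 b0 mf l0; rewrite lorentz_normE//.
exact: (lorentz_functional_lower (distribution_fun_ge0 f)
  (@distribution_fun_nincr _ _ f) a0 b0 l0).
Qed.

Lemma lorentz_norm0 (a : R) (b : \bar R) : (0 < a)%R -> 0 < b ->
  lorentz_norm a b (cst 0 : T -> \bar R) = 0.
Proof.
move=> a0 b0; rewrite lorentz_normE//.
have D0 (l : R) : (0 < l)%R -> distribution_fun (cst 0 : T -> \bar R) l = 0.
  move=> l0; rewrite /distribution_fun (_ : [set _ | _] = set0) ?measure0//.
  by apply/seteqP; split => x //=; rewrite normr0 lte_fin ltNge ltW.
case: b b0 => [s|_|//] /=.
  rewrite lte_fin => s0; rewrite integral0_eq ?poweR0r ?invr_neq0 ?gt_eqF// => l.
  rewrite /= in_itv/= andbT => l0; rewrite D0// poweR0r ?mule0//.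
  by rewrite mulf_neq0 ?invr_neq0 ?gt_eqF.
rewrite (_ : [set _ | _ in _] = [set 0]) ?ereal_sup1//.
apply/seteqP; split => [_ [l /=+ <-]|_ ->].
  by rewrite in_itv/= andbT => l0; rewrite D0// poweR0r ?mule0// invr_neq0 ?gt_eqF.
exists 1%R; first by rewrite /= in_itv/= andbT.
by rewrite D0// poweR0r ?mule0// invr_neq0 ?gt_eqF.
Qed.

(** Convergence is stated in the form used: the superlevel sets of the [F n] increase to those of
    [f], so the distribution functions converge by continuity of the measure. *)
Lemma lorentz_norm_fatou (a : R) (b K : \bar R) (F : nat -> T -> \bar R) f :
  (0 < a)%R -> 0 < b -> 0 <= K ->
  (forall n, measurable_fun setT (F n)) -> measurable_fun setT f ->
  (forall x, {homo (fun n => `|F n x|) : n m / (n <= m)%N >-> n <= m}) ->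
  (forall n x, `|F n x| <= `|f x|) ->
  (forall x (l : R), l%:E < `|f x| -> exists n, l%:E < `|F n x|) ->
  (forall n, lorentz_norm a b (F n) <= K) -> lorentz_norm a b f <= K.
Proof.
move=> a0 b0 K0 mF mf ndF Ff fF FK; rewrite lorentz_normE//.
apply: (@lorentz_functional_fatou _ _ _ _ (fun n => distribution_fun (F n))) => //.
- by move=> n l l'; exact: distribution_fun_nincr.
- by move=> l n m nm; apply: le_distribution_fun => x; exact: ndF.
- move=> l l0; have mS n : measurable [set x | l%:E < `|F n x|].
    exact: measurable_superlevel.
  rewrite /distribution_fun.
  rewrite (_ : [set x | l%:E < `|f x|] = \bigcup_n [set x | l%:E < `|F n x|]).
    apply: nondecreasing_cvg_mu => //; first exact: bigcup_measurable.
    move=> n m nm; apply/subsetPset => x /= lF.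
    by apply: lt_le_trans lF _; exact: ndF.
  apply/seteqP; split => x /=; first by move=> /fF[n lF]; exists n.
  by move=> [n _] /= lF; exact: lt_le_trans lF (Ff _ _).
- by move=> n; rewrite -lorentz_normE.
Qed.

Lemma lorentz_norm_maxe (a : R) (b : \bar R) f g : (0 < a)%R -> a%:E <= b ->
  measurable_fun setT f -> measurable_fun setT g ->
  (forall l, (0 < l)%R -> distribution_fun f l < +oo) ->
  (forall l, (0 < l)%R -> distribution_fun g l < +oo) ->
  lorentz_norm a b (fun x => maxe `|f x| `|g x|) `^ a <=
    lorentz_norm a b f `^ a + lorentz_norm a b g `^ a.
Proof.
move=> a0 ab mf mg ff gf; have b0 : 0 < b by rewrite (lt_le_trans _ ab)// lte_fin.
have mfg : measurable_fun setT (fun x => maxe `|f x| `|g x|).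
  by apply: measurable_maxe; exact: measurableT_comp.
rewrite (lorentz_normE a0 b0 mf) (lorentz_normE a0 b0 mg) (lorentz_normE a0 b0 mfg).
apply: lorentz_functionalD => //.
- by move=> ? ? ?; exact: distribution_fun_nincr.
- by move=> ? ? ?; exact: distribution_fun_nincr.
move=> l l0; apply: le_trans (lebesgue_dU _ _).
apply: le_lebesgue_d => x /=.
by rewrite gee0_abs ?le_max ?abse_ge0// lt_max => /orP[]; [left|right].
Qed.

Lemma lorentz_norm_bigmaxe (I : Type) (r : seq I) (a : R) (b : \bar R)
    (F : I -> T -> \bar R) : (0 < a)%R -> a%:E <= b ->
  (forall i, measurable_fun setT (F i)) ->
  (forall i l, (0 < l)%R -> distribution_fun (F i) l < +oo) ->
  lorentz_norm a b (fun x => \big[maxe/0]_(i <- r) `|F i x|) `^ a <=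
    \sum_(i <- r) lorentz_norm a b (F i) `^ a.
Proof.
move=> a0 ab mF Ff; have b0 : 0 < b by rewrite (lt_le_trans _ ab)// lte_fin.
have bigge0 x s : 0 <= \big[maxe/0]_(i <- s) `|F i x|.
  by elim/big_ind : _ => // y z y0 z0; rewrite le_max y0.
have mbig s : measurable_fun setT (fun x => \big[maxe/0]_(i <- s) `|F i x|).
  elim: s => [|i s ih].
    rewrite (_ : (fun _ => _) = cst 0); first exact: measurable_cst.
    by apply/funext => x; rewrite big_nil.
  rewrite (_ : (fun _ => _) =
      fun x => maxe `|F i x| (\big[maxe/0]_(i <- s) `|F i x|)); last first.
    by apply/funext => x; rewrite big_cons.
  by apply: measurable_maxe; [apply: measurableT_comp => //; exact: mF|exact: ih].
have bigf s l : (0 < l)%R ->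
    distribution_fun (fun x => \big[maxe/0]_(i <- s) `|F i x|) l < +oo.
  move=> l0; elim: s => [|i s ih].
    rewrite /distribution_fun (_ : [set _ | _] = set0) ?measure0//.
    by apply/seteqP; split => x //=; rewrite big_nil abse0 lte_fin ltNge ltW.
  apply: le_lt_trans (lte_add_pinfty (Ff i _ l0) ih).
  apply: le_trans (lebesgue_dU _ _); apply: le_lebesgue_d => x /=.
  rewrite big_cons gee0_abs ?le_max ?abse_ge0//.
  by rewrite lt_max => /orP[]; [left|right; rewrite gee0_abs].
elim: r => [|i r ih].
  rewrite (_ : (fun _ => _) = cst 0); last by apply/funext => x; rewrite big_nil.
  by rewrite big_nil (@lorentz_norm0 a b)// poweR0r ?gt_eqF.
rewrite big_cons; apply: le_trans (leeD2l _ ih).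
have -> : (fun x => \big[maxe/0]_(j <- i :: r) `|F j x|) =
    fun x => maxe `|F i x| `| \big[maxe/0]_(j <- r) `|F j x| |.
  by apply/funext => x; rewrite big_cons [in RHS](gee0_abs (bigge0 _ _)).
exact: (lorentz_norm_maxe a0 ab (mF i) (mbig r) (Ff i) (bigf r)).
Qed.

End LorentzNorm.

(** * Nested families and principal sets *)

Section NestedFamilies.
Context {T : Type} {R : realType}.
Implicit Types (F S : seq (set T)) (P Q : set T).

Definition nested F := forall P Q, P \in F -> Q \in F ->
  [\/ P `<=` Q, Q `<=` P | P `&` Q = set0].

Definition union_of F : set T := [set x | exists2 Q, Q \in F & Q x].

Lemma nested_sub F S : {subset S <= F} -> nested F -> nested S.
Proof. by move=> SF nF P Q /SF PF /SF QF; exact: nF. Qed.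

Lemma exists_minimal F : F != [::] ->
  exists2 Q, Q \in F & forall P, P \in F -> P `<=` Q -> P = Q.
Proof.
elim: F => // Q F ih _; have [->|F0] := eqVneq F [::].
  by exists Q; rewrite ?mem_head// => P; rewrite inE => /eqP.
have [M MF Mmin] := ih F0.
have [QM|QM] := pselect (Q `<=` M).
  exists Q; first exact: mem_head.
  move=> P; rewrite inE => /predU1P[//|PF] PQ.
  have PM := Mmin _ PF (subset_trans PQ QM).
  by apply/seteqP; split => //; rewrite PM.
exists M; first by rewrite inE MF orbT.
by move=> P; rewrite inE => /predU1P[->|/Mmin]//.
Qed.

(* [S] is the family of principal cubes: a set is discarded exactly when some
   principal set above it carries at least half its value. *)
Lemma principal_family F (a : set T -> R) :
  (forall Q, Q \in F -> (0 <= a Q)%R) ->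
  exists S, [/\ uniq S, {subset S <= F},
    forall Q, Q \in F -> exists P, [/\ P \in S, Q `<=` P & (a Q <= 2 * a P)%R]
    & forall P P', P \in S -> P' \in S -> P' `<=` P -> P' != P ->
        (2 * a P < a P')%R].
Proof.
have [n sF] := ubnP (size F); elim: n F sF => // n ih F sF a0.
have [->|F0] := eqVneq F [::]; first by exists [::].
(* The induction removes a minimal [Q]. If [Q] must be added to the principal family of the rest, it
   contains no other member, so the jump condition is new only for [Q] as the smaller set, where it
   is the failure of the domination test. *)
have [Q QF Qmin] := exists_minimal F0.
pose F' := [seq P <- F | P != Q].
have FE P : (P \in F) = (P == Q) || (P \in F').
  by rewrite mem_filter; have [->|] := eqVneq P Q; rewrite ?QF.
have sF' : (size F' < n)%N.
  apply: leq_trans (_ : size F <= n)%N; last by rewrite -ltnS.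
  rewrite size_filter -(count_predC (pred1 Q) F) -[X in (X < _)%N]add0n.
  by rewrite ltn_add2r -has_count has_pred1.
have [P PF'|S [uS SF FS Sprin]] := ih F' sF'; first by apply: a0; rewrite FE PF' orbT.
have SF' P : P \in S -> P \in F by move=> /SF; rewrite mem_filter => /andP[].
have [[P [PS QP aQP]]|noP] :=
    pselect (exists P, [/\ P \in S, Q `<=` P & (a Q <= 2 * a P)%R]).
  exists S; split => // Q'; rewrite FE => /predU1P[->|/FS//].
  by exists P.
have QS : Q \notin S by apply/negP => /SF; rewrite mem_filter eqxx.
exists (Q :: S); split.
- by rewrite /= QS.
- by move=> P; rewrite inE => /predU1P[->//|/SF'].
- move=> Q'; rewrite FE => /predU1P[->|/FS[P [PS QP aQP]]]; last first.
    by exists P; rewrite inE PS orbT.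
  by exists Q; rewrite mem_head; split => //; rewrite ler_peMl ?a0// ler1n.
- move=> P P'; rewrite !inE => /predU1P[->|PS] /predU1P[->|P'S]//.
  + by rewrite eqxx.
  + by move=> /(Qmin _ (SF' _ P'S)) ->; rewrite eqxx.
  + move=> QP _; rewrite ltNge; apply/negP => aQP.
    by apply: noP; exists P.
  + exact: Sprin.
Qed.

End NestedFamilies.

(** * Comparing integrals over unions of nested sets *)

Section NestedIntegral.
Context d (T : measurableType d) {R : realType} (nu : {measure set T -> \bar R}).
Implicit Types (F : seq (set T)).

Lemma measurable_union_of F : (forall Q, Q \in F -> measurable Q) ->
  measurable (union_of F).
Proof.
elim: F => [|Q F ih] mF.
  by rewrite (_ : union_of _ = set0)//; apply/seteqP; split => x // [].
rewrite (_ : union_of _ = Q `|` union_of F).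
  apply: measurableU; first by apply: mF; exact: mem_head.
  by apply: ih => P PF; apply: mF; rewrite inE PF orbT.
apply/seteqP; split => x /=.
  by move=> [P]; rewrite inE => /predU1P[->|PF] Px; [left|right; exists P].
move=> [Qx|[P PF Px]]; first by exists Q => //; exact: mem_head.
by exists P => //; rewrite inE PF orbT.
Qed.

(** The union is the disjoint union of the maximal members, on each of which the inequality holds.
    In the induction the head either lies in another member and is dropped, or absorbs the members
    inside it and is disjoint from the others. *)
Lemma nested_integral_le F (h1 h2 : T -> \bar R) : nested F ->
  (forall Q, Q \in F -> measurable Q) ->
  measurable_fun setT h1 -> measurable_fun setT h2 ->
  (forall x, 0 <= h1 x) -> (forall x, 0 <= h2 x) ->
  (forall Q, Q \in F -> \int[nu]_(x in Q) h1 x <= \int[nu]_(x in Q) h2 x) ->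
  \int[nu]_(x in union_of F) h1 x <= \int[nu]_(x in union_of F) h2 x.
Proof.
move=> + + mh1 mh2 h10 h20; have [n sF] := ubnP (size F).
elim: n F sF => // n ih [_ nF mF hF|Q F sF nF mF hF].
  rewrite (_ : union_of _ = set0) ?integral_set0//.
  by apply/seteqP; split => x // [].
have QF' : Q \in Q :: F by exact: mem_head.
have FF' P : P \in F -> P \in Q :: F by rewrite inE orbC => ->.
have [[P PF QP]|noP] := pselect (exists2 P, P \in F & Q `<=` P).
  rewrite (_ : union_of _ = union_of F); last first.
    apply/seteqP; split => x [P' P'F P'x]; last by exists P' => //; exact: FF'.
    by move: P'F; rewrite inE => /predU1P[P'Q|P'F];
      [exists P => //; apply: QP; rewrite -P'Q|exists P'].
  apply: ih => //; first exact: nested_sub nF.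
    by move=> P' /FF'; exact: mF.
  by move=> P' /FF'; exact: hF.
pose F' := [seq P <- F | ~~ `[< P `<=` Q >]].
have F'F P : P \in F' -> P \in F by rewrite mem_filter => /andP[].
have -> : union_of (Q :: F) = Q `|` union_of F'.
  apply/seteqP; split => x /=.
    move=> [P]; rewrite inE => /predU1P[->|PF] Px; first by left.
    have [PQ|PQ] := pselect (P `<=` Q); first by left; exact: PQ.
    by right; exists P => //; rewrite mem_filter PF andbT; apply/asboolPn.
  move=> [Qx|[P PF Px]]; first by exists Q.
  by exists P => //; exact/FF'/F'F.
have mF' : measurable (union_of F').
  by apply: measurable_union_of => P /F'F/FF'; exact: mF.
have dis : [disjoint Q & union_of F'].
  apply/disj_setPS => x [Qx [P PF' Px]].
  have PF := F'F _ PF'; case: (nF P Q (FF' _ PF) QF').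
  - by move: PF'; rewrite mem_filter => /andP[/asboolPn].
  - by move=> QP; apply: noP; exists P.
  - by move=> /seteqP[] /(_ x) + _; apply.
rewrite !ge0_integral_setU//; try exact: measurable_funTS; try exact: mF.
apply: leeD; first exact: hF.
apply: ih.
- by apply: (@leq_ltn_trans (size F)) => //; rewrite size_filter count_size.
- by apply: nested_sub nF => P /F'F/FF'.
- by move=> P /F'F/FF'; exact: mF.
- by move=> P /F'F/FF'; exact: hF.
Qed.

End NestedIntegral.

(** * The maximal function of a finite family *)

Section FamilyMaximal.
Context {R : realType}.

Definition family_max {T} (F : seq (set T)) (X : set T -> R) (x : T) : R :=
  \big[Num.max/0%R]_(Q <- F) (X Q * \1_Q x)%R.

Lemma family_max_ge0 T (F : seq (set T)) (X : set T -> R) x :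
  (forall Q, Q \in F -> (0 <= X Q)%R) -> (0 <= family_max F X x)%R.
Proof.
move=> X0; rewrite /family_max big_seq.
elim/big_ind : _ => // [a b a0 _|Q QF]; first by rewrite le_max a0.
by rewrite mulr_ge0 ?X0.
Qed.

Lemma lt_family_max T (F : seq (set T)) (X : set T -> R) x (l : R) : (0 <= l)%R ->
  (l < family_max F X x)%R <-> exists Q, [/\ Q \in F, Q x & (l < X Q)%R].
Proof.
move=> l0; rewrite /family_max; elim: F => [|Q F ih].
  by rewrite big_nil ltNge l0; split => // -[Q []].
rewrite big_cons lt_max; split.
  move=> /orP[|/ih[P [PF Px lP]]]; last by exists P; rewrite inE PF orbT.
  rewrite indicE; case: (boolP (x \in Q)) => [|_]; last by rewrite mulr0 ltNge l0.
  by rewrite inE mulr1 => Qx lQ; exists Q; rewrite mem_head.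
move=> [P []]; rewrite inE => /predU1P[->|PF] Px lP.
  by rewrite indicE mem_set// mulr1 lP.
by apply/orP; right; apply/ih; exists P.
Qed.

Lemma le_family_max T (F : seq (set T)) (X : set T -> R) x Q :
  (forall Q, Q \in F -> (0 <= X Q)%R) ->
  Q \in F -> Q x -> (X Q <= family_max F X x)%R.
Proof.
move=> X0 QF Qx; rewrite leNgt; apply/negP => ltX.
suff : (family_max F X x < family_max F X x)%R by rewrite ltxx.
by apply/lt_family_max; [exact: family_max_ge0|exists Q].
Qed.

Lemma family_max_attained T (F : seq (set T)) (X : set T -> R) x :
  family_max F X x = 0%R \/ exists Q, [/\ Q \in F, Q x & family_max F X x = X Q].
Proof.
rewrite /family_max; elim: F => [|Q F ih]; first by rewrite big_nil; left.
rewrite big_cons; set b := \big[_/_]_(_ <- _) _.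
case: leP => [_|_].
  rewrite -/b in ih; case: ih => [->|[P [PF Px ->]]]; first by left.
  by right; exists P; rewrite inE PF orbT.
rewrite indicE; case: (boolP (x \in Q)) => [|_]; last by rewrite mulr0; left.
by rewrite inE mulr1 => Qx; right; exists Q; rewrite mem_head.
Qed.

Lemma measurable_family_max d (T : measurableType d) (F : seq (set T))
    (X : set T -> R) :
  (forall Q, Q \in F -> measurable Q) -> measurable_fun setT (family_max F X).
Proof.
elim: F => [|Q F ih] mF.
  rewrite (_ : family_max _ _ = cst 0%R)//.
  by apply/funext => x; rewrite /family_max big_nil.
rewrite (_ : family_max _ _ =
    fun x => Num.max (X Q * \1_Q x)%R (family_max F X x)); last first.
  by apply/funext => x; rewrite /family_max big_cons.
apply: measurable_maxr; last by apply: ih => P PF; apply: mF; rewrite inE PF orbT.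
by apply: measurable_funM => //; apply: measurable_indic; apply: mF; exact: mem_head.
Qed.

End FamilyMaximal.

(** * Doob's inequality with a weight *)

Section WeightedMaximal.
Context d (T : measurableType d) {R : realType}
  (nu : {sigma_finite_measure set T -> \bar R}).

(** The set where the maximal function exceeds [l] is the union of the [Q] with [X Q > l], so
    [nested_integral_le] gives the weak-type bound: [l] times its [sigma]-mass is at most the
    integral of [g] over it. Multiplying by [p * l ^ (p - 2)] and integrating in [l] gives the claim
    by the layer-cake formula on both sides. *)
Lemma family_max_integral_le (F : seq (set T)) (X : set T -> R)
    (sigma g : T -> \bar R) (p : R) : (1 < p)%R -> nested F ->
  (forall Q, Q \in F -> measurable Q) ->
  (forall Q, Q \in F -> (0 <= X Q)%R) ->
  measurable_fun setT sigma -> measurable_fun setT g ->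
  (forall x, 0 <= sigma x) -> (forall x, 0 <= g x) ->
  (forall Q, Q \in F ->
    (X Q)%:E * \int[nu]_(x in Q) sigma x <= \int[nu]_(x in Q) g x) ->
  \int[nu]_x (sigma x * (family_max F X x)%:E `^ p) <=
    (p / (p - 1))%:E * \int[nu]_x (g x * (family_max F X x)%:E `^ (p - 1)).
Proof.
move=> p1 nF mF X0 msigma mg sigma0 g0 hF.
have p0 : (0 < p)%R by lra.
have pm0 : (0 < p - 1)%R by lra.
have mM : measurable_fun setT (fun x => (family_max F X x)%:E).
  by apply/measurable_EFinP; exact: measurable_family_max.
have M0 x : 0 <= (family_max F X x)%:E by rewrite lee_fin family_max_ge0.
rewrite (layer_cake nu msigma mM sigma0 M0 p0).
rewrite (layer_cake nu mg mM g0 M0 pm0).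
have mS (l : R) : measurable [set x | l%:E < (family_max F X x)%:E].
  by rewrite -[X in measurable X]setTI; exact: emeasurable_fun_o_infty.
have I0 (l : R) : 0 <= power_density (p - 1) l *
    \int[nu]_(x in [set x | (l%:E < (family_max F X x)%:E)%E]) g x.
  apply: mule_ge0; first exact: power_density_ge0 (ltW pm0).
  by apply: integral_ge0 => x _.
rewrite -ge0_integralZl_EFin ?divr_ge0 ?(ltW p0) ?(ltW pm0)//; last first.
  apply: emeasurable_funM; first exact: measurable_power_density.
  apply: (measurable_funS measurableT) => //.
  apply: nincr_measurable => l l' ll'.
  apply: ge0_subset_integral => //; first exact: measurable_funTS.
  by move=> x /=; apply: le_lt_trans; rewrite lee_fin.
apply: le_integral_nonneg => l; rewrite /= in_itv/= andbT => l0.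
  apply: mule_ge0; first exact: power_density_ge0 (ltW p0).
  by apply: integral_ge0 => x _.
have SE : [set x | l%:E < (family_max F X x)%:E] =
    union_of [seq Q <- F | (l < X Q)%R].
  apply/seteqP; split => x /=; rewrite lte_fin.
    move=> /(lt_family_max _ _ _ (ltW l0))[Q [QF Qx lQ]].
    by exists Q => //; rewrite mem_filter lQ.
  move=> [Q]; rewrite mem_filter => /andP[lQ QF] Qx.
  by apply/lt_family_max; [exact: ltW|exists Q].
have key : l%:E * \int[nu]_(x in [set x | (l%:E < (family_max F X x)%:E)%E]) sigma x
    <= \int[nu]_(x in [set x | (l%:E < (family_max F X x)%:E)%E]) g x.
  rewrite -ge0_integralZl_EFin ?(ltW l0)//; last exact: measurable_funTS.
  rewrite SE; apply: nested_integral_le => //.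
  - by apply: nested_sub nF => Q; rewrite mem_filter => /andP[].
  - by move=> Q; rewrite mem_filter => /andP[_]; exact: mF.
  - exact: measurable_funeM.
  - by move=> x; rewrite mule_ge0// lee_fin ltW.
  move=> Q; rewrite mem_filter => /andP[lQ QF].
  rewrite ge0_integralZl_EFin ?(ltW l0)//; [|exact: mF|exact: measurable_funTS].
  apply: le_trans (hF _ QF); apply: lee_wpmul2r; first exact: integral_ge0.
  by rewrite lee_fin ltW.
have -> : power_density p l = (p / (p - 1))%:E * power_density (p - 1) l * l%:E.
  rewrite /power_density -!EFinM; congr (_%:E).
  have -> : (p - 1 = (p - 1 - 1) + 1)%R by ring.
  rewrite powRD ?(lt0r_neq0 l0) ?implybT// powRr1 ?(ltW l0)//.
  have -> : (p - 1 - 1 + 1 = p - 1)%R by ring.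
  by field; rewrite gt_eqF.
rewrite -muleA -muleA; apply: lee_wpmul2l; first by rewrite lee_fin divr_ge0 ?ltW.
by apply: lee_wpmul2l => //; exact: power_density_ge0 (ltW pm0).
Qed.

End WeightedMaximal.

Section WeightedDoob.
Context d (T : measurableType d) {R : realType}
  (nu : {sigma_finite_measure set T -> \bar R}).

(** Hoelder's inequality for [g v] and [h / v]: the second factor becomes an L^p' norm with respect
    to the dual weight. *)
Lemma hoelder_weight (p : R) (g h v : T -> R) : (1 < p)%R ->
  measurable_fun setT g -> measurable_fun setT h -> measurable_fun setT v ->
  (forall x, (0 <= g x)%R) -> (forall x, (0 <= h x)%R) -> (forall x, (0 < v x)%R) ->
  \int[nu]_x (g x * h x)%:E <=
  (\int[nu]_x ((g x * v x) `^ p)%:E) `^ p^-1 *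
  (\int[nu]_x ((v x `^ (- (p / (p - 1))))%:E * (h x `^ (p / (p - 1)))%:E))
    `^ (p / (p - 1))^-1.
Proof.
move=> p1 mg mh mv g0 h0 v0; set q := (p / (p - 1))%R.
have p0 : (0 < p)%R by lra.
have q0 : (0 < q)%R by rewrite divr_gt0// subr_gt0.
have pq : (p^-1 + q^-1 = 1)%R.
  by rewrite /q; field; rewrite ?gt_eqF ?subr_gt0.
have miv : measurable_fun setT (fun x => v x `^ (-1))%R.
  by apply: (@measurableT_comp _ _ _ _ _ _ (fun x => x `^ (-1))%R) => //;
    exact: measurable_powR.
have ivE x : (v x `^ (-1) = (v x)^-1)%R by rewrite powR_inv1// ltW.
have mgv : measurable_fun setT (fun x => g x * v x)%R by exact: measurable_funM.
have mhv : measurable_fun setT (fun x => h x * v x `^ (-1))%R.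
  exact: measurable_funM.
have := hoelder nu mgv mhv p0 q0 pq.
rewrite Lnorm1 [in X in _ <= X -> _]unlock /Lnorm.
rewrite [leLHS](_ : _ = \int[nu]_x (g x * h x)%:E); last first.
  apply: eq_integral => x _ /=.
  rewrite ivE mulrACA divff ?gt_eqF// mulr1 ger0_norm//.
  exact: mulr_ge0.
move=> /le_trans; apply.
rewrite le_eqVlt; apply/orP; left; apply/eqP.
have I1 : \int[nu]_x (`|(EFin \o (fun x => g x * v x)%R) x| `^ p) =
    \int[nu]_x ((g x * v x) `^ p)%:E.
  by apply: eq_integral => x _ /=; rewrite ger0_norm// mulr_ge0// ltW.
rewrite I1; congr (_ * _ `^ _); apply: eq_integral => x _ /=.
rewrite -EFinM; congr (_%:E).
rewrite (ger0_norm (mulr_ge0 (h0 x) (powR_ge0 _ _))) (powRM _ (h0 x) (powR_ge0 _ _)).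
by rewrite -powRrM mulN1r mulrC.
Qed.

(** With [I] the integral on the left, the integrated weak-type bound and Hoelder give
    [I <= p' Gp^(1/p) I^(1/p')]. Dividing by [I^(1/p')] and raising to the power [p] finishes,
    provided [I] is finite. *)
Lemma weighted_doob (F : seq (set T)) (X : set T -> R) (g v : T -> R) (p : R) :
  (1 < p)%R -> nested F ->
  (forall Q, Q \in F -> measurable Q) ->
  (forall Q, Q \in F -> (0 <= X Q)%R) ->
  measurable_fun setT g -> measurable_fun setT v ->
  (forall x, (0 <= g x)%R) -> (forall x, (0 < v x)%R) ->
  (forall Q, Q \in F ->
    \int[nu]_(x in Q) (v x `^ (- (p / (p - 1))))%:E < +oo) ->
  (forall Q, Q \in F ->
    (X Q)%:E * \int[nu]_(x in Q) (v x `^ (- (p / (p - 1))))%:E <=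
      \int[nu]_(x in Q) (g x)%:E) ->
  \int[nu]_x ((v x `^ (- (p / (p - 1))))%:E * (family_max F X x `^ p)%:E) <=
    ((p / (p - 1)) `^ p)%:E * \int[nu]_x ((g x * v x) `^ p)%:E.
Proof.
move=> p1 nF mF X0 mg mv g0 v0 sF hF; set q := (p / (p - 1))%R.
have p0 : (0 < p)%R by lra.
have q0 : (0 < q)%R by rewrite divr_gt0// subr_gt0.
have pm0 : (0 < p - 1)%R by lra.
set I := \int[nu]_x _; set Gp := \int[nu]_x _.
have mM : measurable_fun setT (family_max F X) by exact: measurable_family_max.
have M0 x : (0 <= family_max F X x)%R by exact: family_max_ge0.
have ms : measurable_fun setT (fun x => (v x `^ (- q))%:E).
  apply/measurable_EFinP.
  by apply: (@measurableT_comp _ _ _ _ _ _ (fun x => x `^ (- q))%R) => //;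
    exact: measurable_powR.
have I0 : 0 <= I by apply: integral_ge0 => x _; rewrite mule_ge0 ?lee_fin ?powR_ge0.
have Gp0 : 0 <= Gp by apply: integral_ge0 => x _; rewrite lee_fin powR_ge0.
have key : I <= q%:E * (Gp `^ p^-1 * I `^ q^-1).
  have := @family_max_integral_le _ _ _ nu F X (fun x => (v x `^ (- q))%:E)
    (EFin \o g) p p1 nF mF X0 ms (proj2 (measurable_EFinP _ _) mg)
    (fun x => powR_ge0 _ _) g0 hF.
  move=> /le_trans; apply; apply: lee_wpmul2l; first by rewrite lee_fin ltW.
  have mh : measurable_fun setT (fun x => family_max F X x `^ (p - 1))%R.
    by apply: (@measurableT_comp _ _ _ _ _ _ (fun x => x `^ (p - 1))%R) => //;
      exact: measurable_powR.
  have := hoelder_weight p1 mg mh mv g0 (fun x => powR_ge0 _ _) v0.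
  have pq : ((p - 1) * q = p)%R by rewrite /q; field; rewrite gt_eqF.
  have IE : \int[nu]_x ((v x `^ (- q))%:E *
      ((family_max F X x `^ (p - 1)) `^ q)%:E) = I.
    by apply: eq_integral => x _; rewrite -powRrM pq.
  by rewrite -/q -/Gp IE; exact.
(* The [p]-th power of a finite maximum is at most the sum of the [p]-th powers, and each set of the
   family has finite [sigma]-mass. *)
have Ioo : I < +oo.
  pose t (i : 'I_(size F)) x := (X (nth set0 F i) `^ p)%:E *
    ((fun x => (v x `^ (- q))%:E) \_ (nth set0 F i)) x.
  have nF' (i : 'I_(size F)) : nth set0 F i \in F by rewrite mem_nth.
  have r0 (i : 'I_(size F)) x : 0 <= ((fun x => (v x `^ (- q))%:E) \_ (nth set0 F i)) x.
    by rewrite erestrict_ge0// => y _; rewrite lee_fin powR_ge0.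
  have mr (i : 'I_(size F)) :
      measurable_fun setT ((fun x => (v x `^ (- q))%:E) \_ (nth set0 F i)).
    by apply/(measurable_restrictT _ _).1; [exact: mF|exact: measurable_funTS].
  have t0 i x : 0 <= t i x by rewrite mule_ge0 ?lee_fin ?powR_ge0.
  have : I <= \int[nu]_x \sum_(i < size F) t i x.
    apply: le_integral_nonneg => x _; first by rewrite mule_ge0 ?lee_fin ?powR_ge0.
    case: (family_max_attained F X x) => [->|[Q [QF Qx ->]]].
      by rewrite powR0 ?gt_eqF// mule0 sume_ge0.
    move/(nthP set0) : QF Qx => [i iF <-] Qx.
    rewrite (bigD1 (Ordinal iF))//= [X in X + _]/t patchE mem_set// muleC.
    by rewrite leeDl// sume_ge0.
  move=> /le_lt_trans; apply; rewrite ge0_integral_sum//; last first.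
    by move=> i; exact: measurable_funeM.
  apply: (big_ind (fun x => x < +oo)) => //.
    by move=> x y; exact: lte_add_pinfty.
  move=> i _; rewrite ge0_integralZl_EFin ?powR_ge0//.
  rewrite -integral_mkcond; apply: lte_mul_pinfty.
  - by rewrite lee_fin powR_ge0.
  - by [].
  - exact: sF.
have [->|In0] := eqVneq I 0; first by rewrite mule_ge0 ?lee_fin ?powR_ge0.
have [->|Gpoo] := eqVneq Gp +oo; first by rewrite gt0_muley ?leey// lte_fin powR_gt0.
move: I I0 Ioo In0 key => [i| |]//; rewrite lee_fin => i0 _.
move: Gp Gp0 Gpoo => [G| |]//; rewrite lee_fin => G0 _.
rewrite eqe => i_neq0; have {}i0 : (0 < i)%R by rewrite lt0r i_neq0.
rewrite !poweR_EFin -!EFinM !lee_fin mulrA => key.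
have : (i `^ p^-1 <= q * G `^ p^-1)%R.
  have iq0 : (0 < i `^ q^-1)%R by rewrite powR_gt0.
  rewrite -(ler_pM2r iq0) -powRD; last by rewrite (lt0r_neq0 i0) implybT.
  rewrite (_ : p^-1 + q^-1 = 1)%R ?powRr1 ?(ltW i0)//.
  by rewrite /q; field; rewrite ?gt_eqF.
move=> /(ge0_ler_powR (ltW p0)); rewrite !nnegrE powR_ge0 mulr_ge0 ?powR_ge0 ?(ltW q0)//.
move=> /(_ isT isT); rewrite -powRrM mulVf ?gt_eqF// powRr1 ?(ltW i0)//.
by rewrite powRM ?powR_ge0 ?(ltW q0)// -powRrM mulVf ?gt_eqF// powRr1.
Qed.

End WeightedDoob.

(** * Bookkeeping of exponents *)

Section RealIdentities.
Context {R : realType}.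
Implicit Types p q : R.

Lemma powR_expR (x r : R) : (0 < x)%R -> (x `^ r = expR (r * ln x))%R.
Proof. by move=> x0; rewrite /powR gt_eqF. Qed.

(* The powers of the volume cancel: [beta - 1 + 1/q + 1/p' = 0]. *)
Lemma volume_cancel (V S c A p q beta : R) : (0 < V)%R -> (0 < S)%R -> (0 < c)%R ->
  (1 < p)%R -> (q^-1 = p^-1 - beta)%R ->
  (V `^ beta * (V^-1 * c) * (A * V `^ q^-1 * (S / V) `^ (- (p / (p - 1))^-1)) =
   A * (c * S `^ (- (p / (p - 1))^-1)))%R.
Proof.
move=> V0 S0 c0 p1 qE; rewrite !powR_expR ?divr_gt0// lnM ?posrE ?invr_gt0// lnV//.
rewrite -{2}(lnK V0) -expRN.
set r := (- (p / (p - 1))^-1)%R.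
transitivity (A * (c * (expR (beta * ln V) * expR (- ln V) * expR (q^-1 * ln V) *
   expR (r * (ln S - ln V)))))%R; first by ring.
rewrite -!expRD; congr (_ * (_ * expR _))%R.
rewrite qE /r invf_div; field; rewrite ?gt_eqF//; lra.
Qed.

(** With [y = c S^(-1/p')], the identity [p / p' = p - 1] gives [y ^ p = (c / S) ^ p * S]; the
    excess factor [y ^ (q - p)] is bounded through [y <= G]. *)
Lemma weighted_power_le (S c G p q : R) : (0 < S)%R -> (0 < c)%R -> (1 < p)%R ->
  (p <= q)%R -> (c * S `^ (- (p / (p - 1))^-1) <= G)%R ->
  ((c * S `^ (- (p / (p - 1))^-1)) `^ q <= G `^ (q - p) * ((c / S) `^ p * S))%R.
Proof.
move=> S0 c0 p1 pq; set y := (c * _)%R => yG.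
have y0 : (0 < y)%R by rewrite mulr_gt0 ?powR_gt0.
have -> : (y `^ q = y `^ (q - p) * y `^ p)%R.
  by rewrite -powRD ?subrK// (lt0r_neq0 y0) implybT.
have -> : ((c / S) `^ p * S = y `^ p)%R.
  rewrite /y !powRM ?powR_ge0 ?invr_ge0 ?(ltW c0) ?(ltW S0)// -mulrA; congr (_ * _)%R.
  rewrite -(powR_inv1 (ltW S0)) -!powRrM -[X in (_ * X)%R](powRr1 (ltW S0)).
  rewrite -powRD ?(lt0r_neq0 S0) ?implybT//; congr (_ `^ _)%R.
  by rewrite invf_div; field; rewrite gt_eqF//; lra.
apply: ler_wpM2r; first exact: powR_ge0.
by apply: ge0_ler_powR; rewrite ?subr_ge0// ?nnegrE ?(ltW y0)// (le_trans (ltW y0)).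
Qed.

(** As [W <= V] and [beta >= 0], the powers [W ^ beta] and [V ^ beta] can be cancelled, which
    compares plain averages. The conclusion bounds a volume by a fixed multiple of an integral, a
    form that passes to unions of nested cubes. *)
Lemma lower_density_le (V W a b beta : R) : (0 < V)%R -> (0 < W)%R -> (W <= V)%R ->
  (0 < a)%R -> (0 <= b)%R -> (0 <= beta)%R ->
  (2 * (V `^ beta * (V^-1 * a)) < W `^ beta * (W^-1 * b))%R ->
  (W <= V / (2 * a) * b)%R.
Proof.
move=> V0 W0 WV a0 b0 beta0 /ltW h.
have Wb : (W `^ beta * (W^-1 * b) <= V `^ beta * (W^-1 * b))%R.
  apply: ler_wpM2r; first by rewrite mulr_ge0// invr_ge0 ltW.
  by apply: ge0_ler_powR; rewrite ?nnegrE ?(ltW V0) ?(ltW W0).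
have := le_trans h Wb; rewrite mulrCA ler_pM2l ?powR_gt0// => {}h.
rewrite mulrAC ler_pdivlMr ?mulr_gt0//.
rewrite -(ler_pM2l (mulr_gt0 V0 W0)) in h.
rewrite [leLHS](_ : _ = V * W * (2 * (V^-1 * a)))%R; last by field; rewrite gt_eqF.
by rewrite (le_trans h)// le_eqVlt; apply/orP; left; apply/eqP; field; rewrite gt_eqF.
Qed.

End RealIdentities.

(** * The estimate for a finite nested family of cubes *)

Section FiniteFamilies.
Context {R : realType} {d : nat}.
Local Notation T := (Rd R d).
Local Notation mu := (@lebesgue_d R d).
Context (p q beta : R) (s : \bar R) (v g : T -> R).
Hypothesis p1 : (1 < p)%R.
Hypothesis pq : (p <= q)%R.
Hypothesis beta0 : (0 <= beta)%R.
Hypothesis qE : (q^-1 = p^-1 - beta)%R.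
Hypothesis qs : q%:E <= s.
Hypothesis mv : measurable_fun [set: T] v.
Hypothesis mg : measurable_fun [set: T] g.
Hypothesis v0 : forall x, (0 < v x)%R.
Hypothesis g0 : forall x, (0 <= g x)%R.

Let pc := (p / (p - 1))%R.
Let sigma x := (v x `^ (- pc))%:E.
Let vol (Q : set T) : R := fine (mu Q).
Let sig (Q : set T) : R := fine (\int[mu]_(x in Q) sigma x).
Let mass (Q : set T) : R := fine (\int[mu]_(x in Q) (g x)%:E).
Let Gp := \int[mu]_x ((g x * v x) `^ p)%:E.

Hypothesis Gpoo : Gp < +oo.
Hypothesis sigoo : forall Q, cube Q -> \int[mu]_(x in Q) sigma x < +oo.

Let p0 : (0 < p)%R. Proof. by have := p1; lra. Qed.
Let pc0 : (0 < pc)%R. Proof. by rewrite divr_gt0// subr_gt0. Qed.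
Let q0 : (0 < q)%R. Proof. exact: lt_le_trans pq. Qed.
Let Gp0 : 0 <= Gp.
Proof. by apply: integral_ge0 => x _; rewrite lee_fin powR_ge0. Qed.

Let msigma : measurable_fun setT sigma.
Proof.
apply/measurable_EFinP.
by apply: (@measurableT_comp _ _ _ _ _ _ (fun x => x `^ (- pc))%R) => //;
  exact: measurable_powR.
Qed.

Let sigma_ge0 x : 0 <= sigma x. Proof. by rewrite lee_fin powR_ge0. Qed.

Let volE (Q : set T) : cube Q -> mu Q = (vol Q)%:E /\ (0 < vol Q)%R.
Proof. by move=> /lebesgue_cube_fine[V V0 VE]; rewrite /vol VE. Qed.

Let sigE (Q : set T) : cube Q ->
  \int[mu]_(x in Q) sigma x = (sig Q)%:E /\ (0 < sig Q)%R.
Proof.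
move=> cQ; have mQ := measurable_cube cQ.
have s0 : 0 <= \int[mu]_(x in Q) sigma x by apply: integral_ge0 => x _.
have sfin : \int[mu]_(x in Q) sigma x \is a fin_num by rewrite ge0_fin_numE ?sigoo.
split; first by rewrite /sig fineK.
rewrite /sig fine_gt0// sigoo// andbT.
apply: positive_integral; [exact: mQ|exact: msigma| |].
  by move=> x; rewrite lte_fin powR_gt0.
by have /andP[] := lebesgue_cube_gt0 cQ.
Qed.

(** Hoelder against the indicator of [Q]; besides the bound, it shows that [g] is integrable on
    cubes. *)
Let massE (Q : set T) : cube Q -> [/\ \int[mu]_(x in Q) (g x)%:E = (mass Q)%:E,
  (0 <= mass Q)%R & ((mass Q)%:E <= Gp `^ p^-1 * (sig Q)%:E `^ pc^-1)].
Proof.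
move=> cQ; have mQ := measurable_cube cQ.
have i0 : 0 <= \int[mu]_(x in Q) (g x)%:E by apply: integral_ge0 => x _; rewrite lee_fin.
have m1 : measurable_fun setT (\1_Q : T -> R) by exact: measurable_indic.
have h : \int[mu]_(x in Q) (g x)%:E <= Gp `^ p^-1 * (sig Q)%:E `^ pc^-1.
  have i1 x : (0 <= \1_Q x :> R)%R by rewrite indicE.
  have := hoelder_weight (@lebesgue_sf R d) p1 mg m1 mv g0 i1 v0.
  rewrite -/pc -/Gp [leLHS](_ : _ = \int[mu]_(x in Q) (g x)%:E); last first.
    rewrite [RHS]integral_mkcond; apply: eq_integral => x _.
    by rewrite patchE indicE; case: (x \in Q); rewrite ?mulr1 ?mulr0.
  rewrite [X in _ <= _ * X `^ _](_ : _ = (sig Q)%:E)// -(sigE cQ).1.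
  rewrite [RHS]integral_mkcond; apply: eq_integral => x _.
  rewrite patchE indicE; case: (x \in Q); rewrite ?powR1 ?mule1//.
  by rewrite powR0 ?mule0// gt_eqF.
have ioo : \int[mu]_(x in Q) (g x)%:E < +oo.
  apply: le_lt_trans h _; apply: lte_mul_pinfty.
  - exact: poweR_ge0.
  - by apply: fin_num_poweR; rewrite ge0_fin_numE.
  - by rewrite poweR_EFin ltry.
have ifin : \int[mu]_(x in Q) (g x)%:E \is a fin_num by rewrite ge0_fin_numE.
split; [by rewrite /mass fineK|by rewrite /mass fine_ge0|].
by rewrite /mass fineK.
Qed.

Lemma integral_cube_fin (Q : set T) : cube Q ->
  \int[mu]_(x in Q) (g x)%:E = (mass Q)%:E.
Proof. by move=> /massE[]. Qed.

Definition cube_value (Q : set T) : R := (vol Q `^ beta * ((vol Q)^-1 * mass Q))%R.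

Lemma cube_value_ge0 (Q : set T) : (0 <= cube_value Q)%R.
Proof.
apply: mulr_ge0; first exact: powR_ge0.
apply: mulr_ge0; first by rewrite invr_ge0; apply: fine_ge0; exact: measure_ge0.
by apply: fine_ge0; apply: integral_ge0 => x _; rewrite lee_fin.
Qed.

(* [cube_value] is the quantity maximised by [fractional_maximal]. *)
Lemma cube_valueE (Q : set T) : cube_value Q =
  (fine (mu Q) `^ beta * ((fine (mu Q))^-1 * fine (\int[mu]_(x in Q) (g x)%:E)))%R.
Proof. by []. Qed.

Context (A K : R) (F : seq (set T)).
Hypothesis A0 : (0 <= A)%R.
Hypothesis K0 : (0 <= K)%R.
Hypothesis nF : nested F.
Hypothesis cF : forall Q, Q \in F -> cube Q.
Hypothesis hA : forall Q, cube Q -> lorentz_norm q s ((EFin \o v) \_ Q) <=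
  (A * vol Q `^ q^-1 * (sig Q / vol Q) `^ (- pc^-1))%:E.
Hypothesis hK : forall Q E, cube Q -> measurable E -> E `<=` Q ->
  (2^-1)%:E * mu Q <= mu E ->
  \int[mu]_(x in Q) sigma x <= K%:E * \int[mu]_(x in E) sigma x.

(** Cubes of value 0 contribute nothing to the maximum; without them every [mass P] is positive and
    can be divided by. *)
Let F0 := [seq Q <- F | (0 < cube_value Q)%R].
Let X (Q : set T) : R := (mass Q / sig Q)%R.

Let F0F Q : Q \in F0 -> Q \in F. Proof. by rewrite mem_filter => /andP[]. Qed.

Let mass_gt0 Q : Q \in F0 -> (0 < mass Q)%R.
Proof.
move=> QF0; have cQ := cF (F0F QF0); move: QF0; rewrite mem_filter => /andP[+ _].
have [_ V0] := volE cQ; rewrite /cube_value pmulr_rgt0 ?powR_gt0//.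
by rewrite pmulr_rgt0// invr_gt0.
Qed.

Let X_ge0 Q : Q \in F0 -> (0 <= X Q)%R.
Proof.
move=> QF0; have cQ := cF (F0F QF0); have [_ S0] := sigE cQ.
by rewrite divr_ge0 ?ltW// mass_gt0.
Qed.

Let sparse_part (P : set T) : set T :=
  P `\` union_of [seq Q <- F0 | `[< Q `<=` P >] && (2 * cube_value P < cube_value Q)%R].

Let measurable_sparse_part P : P \in F0 -> measurable (sparse_part P).
Proof.
move=> PF0; apply: measurableD; first exact/measurable_cube/cF/F0F.
apply: measurable_union_of => Q; rewrite mem_filter => /andP[_ QF0].
exact/measurable_cube/cF/F0F.
Qed.

(** The constant [c] is chosen so that the integral of [c g] over [P] is [|P| / 2]. Each removed [Q]
    has volume at most its own integral of [c g] by [lower_density_le], and nestedness carries this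
    over to the union [U]. *)
Let sparse_part_half P : P \in F0 -> (2^-1)%:E * mu P <= mu (sparse_part P).
Proof.
move=> PF0; have cP := cF (F0F PF0); have mP := measurable_cube cP.
have [PV V0] := volE cP; have [PG _ _] := massE cP.
have G0 := mass_gt0 PF0.
pose U := union_of
  [seq Q <- F0 | `[< Q `<=` P >] && (2 * cube_value P < cube_value Q)%R].
have UP : U `<=` P.
  by move=> x [Q]; rewrite mem_filter => /andP[/andP[/asboolP QP _] _] /QP.
have mU : measurable U.
  apply: measurable_union_of => Q; rewrite mem_filter => /andP[_ QF0].
  exact/measurable_cube/cF/F0F.
pose c := (vol P / (2 * mass P))%R.
have c0 : (0 <= c)%R by rewrite divr_ge0 ?ltW// mulr_gt0.
have mcg : measurable_fun setT (fun x => c%:E * (g x)%:E).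
  by apply: measurable_funeM; exact/measurable_EFinP.
have cg0 x : 0 <= c%:E * (g x)%:E by rewrite mule_ge0 ?lee_fin.
have int_cg Q : measurable Q ->
    \int[mu]_(x in Q) (c%:E * (g x)%:E) = c%:E * \int[mu]_(x in Q) (g x)%:E.
  move=> mQ; have mgQ : measurable_fun Q (fun x => (g x)%:E).
    by apply: measurable_funTS; exact/measurable_EFinP.
  have gQ0 x : Q x -> 0 <= (g x)%:E by move=> _; rewrite lee_fin.
  exact: (@ge0_integralZl_EFin _ T R mu Q mQ _ gQ0 mgQ c c0).
have Uhalf : mu U <= (vol P / 2)%:E.
  have : \int[mu]_(x in U) (cst 1) x <= \int[mu]_(x in U) (c%:E * (g x)%:E).
    apply: nested_integral_le => //.
    - by apply: nested_sub nF => Q; rewrite mem_filter => /andP[_ /F0F].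
    - move=> Q; rewrite mem_filter => /andP[_ QF0].
      exact/measurable_cube/cF/F0F.
    move=> Q; rewrite mem_filter => /andP[/andP[/asboolP QP aQ] QF0].
    have cQ := cF (F0F QF0); have mQ := measurable_cube cQ.
    have [QV W0] := volE cQ; have [QG _ _] := massE cQ.
    rewrite (integral_cst mu mQ 1) mul1e QV int_cg// QG -EFinM lee_fin.
    apply: lower_density_le aQ => //.
      by rewrite -lee_fin -QV -PV; exact: le_lebesgue_d.
    by apply: ltW; exact: mass_gt0.
  rewrite (integral_cst mu mU 1) mul1e => /le_trans; apply.
  apply: le_trans (_ : \int[mu]_(x in P) (c%:E * (g x)%:E) <= _).
    exact: (@ge0_subset_integral _ T R mu U P mU mP _
      (measurable_funTS mcg) (fun x _ => cg0 x) UP).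
  rewrite (int_cg _ mP) PG -EFinM lee_fin /c le_eqVlt; apply/orP; left; apply/eqP.
  by field; rewrite gt_eqF.
have : mu P <= mu (sparse_part P) + mu U.
  apply: le_trans (lebesgue_dU _ _); apply: le_lebesgue_d => x Px.
  by have [Ux|nUx] := pselect (U x); [right|left].
rewrite PV => h.
have {h} : (vol P)%:E <= mu (sparse_part P) + (vol P / 2)%:E.
  by apply: le_trans h _; exact: leeD2l.
rewrite -leeBlDr// -EFinB -EFinM; apply: le_trans; rewrite lee_fin; lra.
Qed.

Let sum_disjoint_le (S : seq (set T)) (E : set T -> set T) (f : set T -> R) x (B : R) :
  uniq S -> (0 <= B)%R ->
  (forall P P', P \in S -> P' \in S -> P != P' -> E P x -> ~ E P' x) ->
  (forall P, P \in S -> E P x -> (f P <= B)%R) ->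
  (\sum_(P <- S) f P * \1_(E P) x <= B)%R.
Proof.
move=> uS B0 dis fB.
have [[P [PS EPx]]|noP] := pselect (exists P, P \in S /\ E P x).
  rewrite (bigD1_seq P)//= big_seq_cond big1 ?addr0; last first.
    move=> P' /andP[P'S P'P]; rewrite indicE memNset ?mulr0//.
    by apply: (dis P) => //; rewrite eq_sym.
  by rewrite indicE mem_set// mulr1 fB.
rewrite big_seq big1// => P PS; rewrite indicE memNset ?mulr0// => EPx.
by apply: noP; exists P.
Qed.

(* The sparse parts of the principal cubes are disjoint, and each carries a
   fixed proportion of the [sigma]-mass of its cube. *)
Let carleson_sum (S : seq (set T)) : uniq S -> {subset S <= F0} ->
  (forall P P', P \in S -> P' \in S -> P' `<=` P -> P' != P ->
    (2 * cube_value P < cube_value P')%R) ->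
  \sum_(P <- S) (X P `^ p * sig P)%:E <= (K * pc `^ p)%:E * Gp.
Proof.
move=> uS SF0 Sprin.
(* The empty default makes [E P] measurable for every index, as integrating the sum term by term
   requires. *)
pose E P := if P \in S then sparse_part P else set0.
have mE P : measurable (E P).
  by rewrite /E; case: ifPn => // /SF0; exact: measurable_sparse_part.
(* If two principal cubes meet, one contains the other, and the smaller one has more than twice the
   value of the larger: it was removed from the larger one's sparse part. *)
have dis P P' x : P \in S -> P' \in S -> P != P' -> E P x -> ~ E P' x.
  move=> PS P'S PP'; rewrite /E PS P'S => -[Px nPx] [P'x nP'x].
  case: (nF (F0F (SF0 _ PS)) (F0F (SF0 _ P'S))) => [sub|sub|/seteqP[/(_ x)+ _]].
  - apply: nP'x; exists P => //; rewrite mem_filter SF0// andbT.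
    by apply/andP; split; [exact/asboolP|exact: Sprin].
  - apply: nPx; exists P' => //; rewrite mem_filter SF0// andbT.
    by apply/andP; split; [exact/asboolP|apply: Sprin; rewrite // eq_sym].
  - exact.
have step P : P \in S -> (X P `^ p * sig P)%:E <=
    K%:E * ((X P `^ p)%:E * \int[mu]_(x in E P) sigma x).
  move=> PS; have cP := cF (F0F (SF0 _ PS)); have [SE _] := sigE cP.
  rewrite muleCA EFinM; apply: lee_wpmul2l; first by rewrite lee_fin powR_ge0.
  rewrite -SE /E PS; apply: hK => //.
  - exact/measurable_sparse_part/SF0.
  - by move=> x [].
  - exact/sparse_part_half/SF0.
have fE P x : (sigma x * (X P `^ p * \1_(E P) x)%:E) =
    (X P `^ p)%:E * (sigma \_ (E P)) x.
  rewrite patchE indicE; case: (x \in E P); rewrite ?mulr1 ?mulr0 ?mule0//.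
  by rewrite muleC.
have sE0 P x : 0 <= (X P `^ p)%:E * (sigma \_ (E P)) x.
  by rewrite mule_ge0 ?erestrict_ge0// lee_fin powR_ge0.
have mrest P : measurable_fun setT (sigma \_ (E P)).
  by apply/(measurable_restrictT _ _).1 => //; exact: measurable_funTS.
apply: (@le_trans _ _ (K%:E * \sum_(P <- S) ((X P `^ p)%:E * \int[mu]_(x in E P) sigma x))).
  rewrite ge0_sume_distrr; last first.
    by move=> P _; rewrite mule_ge0 ?integral_ge0 ?lee_fin ?powR_ge0.
  by rewrite big_seq [leRHS]big_seq; apply: lee_sum => P; exact: step.
rewrite EFinM -muleA; apply: lee_wpmul2l; first by rewrite lee_fin.
rewrite [leLHS](_ : _ =
    \int[mu]_x \sum_(P <- S) ((X P `^ p)%:E * (sigma \_ (E P)) x)); last first.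
  have mf P : measurable_fun setT (fun x => (X P `^ p)%:E * (sigma \_ (E P)) x).
    exact: measurable_funeM.
  rewrite (ge0_integral_sum (lebesgue_d R d) measurableT mf (fun P x _ => sE0 P x)).
  apply: eq_bigr => P _.
  have r0 x : setT x -> 0 <= (sigma \_ (E P)) x by move=> _; rewrite erestrict_ge0.
  rewrite (@ge0_integralZl_EFin _ T R mu _ measurableT _ r0 (mrest P) _ (powR_ge0 _ _)).
  by rewrite -integral_mkcond.
have F0cube Q : Q \in F0 -> cube Q by move=> /F0F/cF.
have hX Q : Q \in F0 ->
    (X Q)%:E * \int[mu]_(x in Q) sigma x <= \int[mu]_(x in Q) (g x)%:E.
  move=> QF0; have [SE S0] := sigE (F0cube Q QF0).
  have [GE _ _] := massE (F0cube Q QF0).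
  by rewrite SE GE -EFinM lee_fin /X divfK// gt_eqF.
have doob := @weighted_doob _ _ _ (@lebesgue_sf R d) F0 X g v p p1 (nested_sub F0F nF)
  (fun Q QF => measurable_cube (F0cube Q QF)) X_ge0 mg mv g0 v0
  (fun Q QF => sigoo (F0cube Q QF)) hX.
apply: le_trans doob.
apply: le_integral_nonneg => x _; first by rewrite sume_ge0.
under eq_bigr do rewrite -fE.
rewrite -ge0_sume_distrr; last first.
  by move=> P _; rewrite lee_fin mulr_ge0 ?powR_ge0.
apply: lee_wpmul2l; first exact: sigma_ge0.
(* At each point at most one term survives, and its [X P] is a competitor in the maximal
   function. *)
rewrite sumEFin lee_fin; apply: sum_disjoint_le => //.
- exact: powR_ge0.
- by move=> P P'; exact: dis.
move=> P PS; rewrite /E PS => -[Px _].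
apply: ge0_ler_powR; rewrite ?nnegrE ?(ltW p0) ?X_ge0 ?SF0//.
  exact/family_max_ge0/X_ge0.
by apply: le_family_max => //; exact: SF0.
Qed.

Lemma finite_family_bound :
  lorentz_norm q s (fun x => (family_max F cube_value x * v x)%:E) `^ q <=
    ((2 * A) `^ q * K * pc `^ p)%:E * Gp `^ (q / p).
Proof.
have a0 Q : Q \in F0 -> (0 < cube_value Q)%R by rewrite mem_filter => /andP[].
have [S [uS SF0 F0S Sprin]] := @principal_family _ _ F0 cube_value (fun Q QF => ltW (a0 Q QF)).
have s0 : 0 < s by apply: lt_le_trans qs; rewrite lte_fin.
(* The defaults off [S] keep [h P] measurable with finite distribution function for every index. *)
pose W P := if P \in S then (2 * cube_value P)%R else 1%R.
pose E P := if P \in S then P else set0.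
have W0 P : (0 < W P)%R.
  by rewrite /W; case: ifPn => // /SF0/a0 ?; rewrite mulr_gt0.
have mE P : measurable (E P).
  by rewrite /E; case: ifPn => // /SF0/F0F/cF/measurable_cube.
pose h P : T -> \bar R := fun x => (W P)%:E * ((EFin \o v) \_ (E P)) x.
have mr P : measurable_fun setT ((EFin \o v) \_ (E P)).
  by apply/(measurable_restrictT _ _).1 => //; apply: measurable_funTS; exact/measurable_EFinP.
have mh P : measurable_fun setT (h P) by exact: measurable_funeM.
have hf P l : (0 < l)%R -> distribution_fun (h P) l < +oo.
  move=> l0; apply: (@le_lt_trans _ _ (mu (E P))).
    apply: le_lebesgue_d => x /=; rewrite /h patchE; case: ifPn; rewrite ?inE//.
    by rewrite mule0 abse0 lte_fin ltNge ltW.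
  rewrite /E; case: ifPn => [/SF0/F0F/cF/lebesgue_cube_gt0/andP[]//|_].
  by rewrite measure0.
have := lorentz_norm_bigmaxe S q0 qs mh hf.
have le1 : lorentz_norm q s (fun x => (family_max F cube_value x * v x)%:E) <=
    lorentz_norm q s (fun x => \big[maxe/0]_(P <- S) `|h P x|).
  apply: le_lorentz_norm => //; first exact: ltW.
  move=> x; have big0 : 0 <= \big[maxe/0]_(P <- S) `|h P x|.
    by elim/big_ind : _ => // y z y0 z0; rewrite le_max y0.
  rewrite [leRHS]gee0_abs//.
  case: (family_max_attained F cube_value x) => [->|[Q [QF Qx ->]]].
    by rewrite mul0r abse0.
  have [aQ|aQ] := leP (cube_value Q) 0%R.
    have : (0 <= cube_value Q)%R.
      have cQ := cF QF; have [_ V0] := volE cQ; have [_ G0 _] := massE cQ.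
      by rewrite /cube_value !mulr_ge0 ?powR_ge0// invr_ge0 ltW.
    by move=> a0'; rewrite (_ : cube_value Q = 0%R) ?mul0r ?abse0//; apply/le_anti; rewrite aQ.
  have QF0 : Q \in F0 by rewrite mem_filter aQ.
  have [P [PS QP aQP]] := F0S _ QF0.
  apply: (@le_trans _ _ `|h P x|); last first.
    elim: (S) PS => // P' S' ih; rewrite inE big_cons le_max => /predU1P[<-|/ih->].
      by rewrite lexx.
    by rewrite orbT.
  rewrite /h /W /E PS patchE mem_set/=; last exact: QP.
  have hv : (0 <= v x)%R by exact: ltW.
  have ha : (0 <= 2 * cube_value P)%R by rewrite mulr_ge0// ltW// a0// SF0.
  rewrite lee_fin (ger0_norm (mulr_ge0 (ltW aQ) hv)) (ger0_norm (mulr_ge0 ha hv)).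
  exact: ler_wpM2r.
move=> le2; apply: le_trans (_ : \sum_(P <- S) lorentz_norm q s (h P) `^ q <= _).
  apply: le_trans le2; apply: lee_poweR le1; first exact: ltW.
  by apply: lorentz_norm_ge0; exact: ltW.
(* If [Gp = 0], Hoelder forces every mass to vanish and no cube is principal. Otherwise [G > 0],
   which justifies splitting [G ^ q] into [G ^ (q - p) * G ^ p] at the end. *)
have [G0|Gn0] := eqVneq Gp 0.
  have S0 : S = [::].
    case: (S) SF0 => // P S' SF0'; have PF0 : P \in F0 by apply: SF0'; exact: mem_head.
    have [_ _] := massE (cF (F0F PF0)); rewrite G0 poweR0r ?invr_neq0 ?gt_eqF// mul0e.
    by rewrite lee_fin leNgt mass_gt0.
  rewrite S0 big_nil; apply: mule_ge0; last exact: poweR_ge0.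
  by rewrite lee_fin !mulr_ge0 ?powR_ge0.
have Gfin : Gp \is a fin_num by rewrite ge0_fin_numE.
pose G := (fine Gp `^ p^-1)%R.
have GpE : Gp = (G `^ p)%:E.
  by rewrite /G -powRrM mulVf ?gt_eqF// powRr1 ?fine_ge0// fineK.
have Gge0 : (0 <= G)%R by exact: powR_ge0.
have GE : Gp `^ p^-1 = G%:E.
  by rewrite GpE poweR_EFin -powRrM mulfV ?gt_eqF// powRr1.
have term P : P \in S -> lorentz_norm q s (h P) `^ q <=
    ((2 * A) `^ q * G `^ (q - p))%:E * (X P `^ p * sig P)%:E.
  move=> PS; have PF0 := SF0 _ PS; have cP := cF (F0F PF0).
  have [_ V0] := volE cP; have [_ S0] := sigE cP; have [_ _ GS] := massE cP.
  have m0 := mass_gt0 PF0.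
  rewrite /h lorentz_normZ// /W /E PS.
  have h1 : (2 * cube_value P)%:E * lorentz_norm q s ((EFin \o v) \_ P) <=
      (2 * A * (mass P * sig P `^ (- pc^-1)))%:E.
    apply: (@le_trans _ _ ((2 * cube_value P)%:E *
        (A * vol P `^ q^-1 * (sig P / vol P) `^ (- pc^-1))%:E)).
      apply: lee_wpmul2l; last exact: hA.
      by rewrite lee_fin mulr_ge0// ltW// a0.
    rewrite -EFinM lee_fin -[leLHS]mulrA -[leRHS]mulrA.
    by rewrite /cube_value /pc (volume_cancel A V0 S0 m0 p1 qE).
  apply: (@le_trans _ _ ((2 * A * (mass P * sig P `^ (- pc^-1))) `^ q)%:E).
    rewrite -poweR_EFin; apply: lee_poweR h1; first exact: ltW.
    by rewrite mule_ge0 ?lorentz_norm_ge0 ?(ltW s0)// lee_fin mulr_ge0// ltW// a0.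
  rewrite -EFinM lee_fin powRM ?mulr_ge0 ?powR_ge0 ?(ltW m0)// -mulrA.
  apply: ler_wpM2l; first exact: powR_ge0.
  apply: weighted_power_le => //.
  rewrite powRN ler_pdivrMr ?powR_gt0//.
  by move: GS; rewrite GE poweR_EFin -EFinM lee_fin.
apply: (@le_trans _ _ (((2 * A) `^ q * G `^ (q - p))%:E *
    \sum_(P <- S) (X P `^ p * sig P)%:E)).
  rewrite ge0_sume_distrr.
    by rewrite big_seq [leRHS]big_seq; apply: lee_sum => P; exact: term.
  move=> P _; rewrite lee_fin; apply: mulr_ge0; first exact: powR_ge0.
  by apply: fine_ge0; apply: integral_ge0 => x _; exact: sigma_ge0.
apply: (@le_trans _ _ (((2 * A) `^ q * G `^ (q - p))%:E * ((K * pc `^ p)%:E * Gp))).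
  by apply: lee_wpmul2l; [rewrite lee_fin mulr_ge0 ?powR_ge0|exact: carleson_sum].
rewrite GpE poweR_EFin -!EFinM lee_fin -powRrM (mulrC p) divfK ?gt_eqF//.
have [G00|Gpos] := eqVneq G 0%R.
  by move: Gn0; rewrite GpE G00 powR0 ?eqxx// gt_eqF.
rewrite (_ : (G `^ q = G `^ (q - p) * G `^ p)%R).
  by rewrite le_eqVlt; apply/orP; left; apply/eqP; ring.
by rewrite -powRD ?subrK// Gpos implybT.
Qed.

End FiniteFamilies.

(** * Shifted dyadic grids *)

Section DyadicGrids.
Context {R : realType}.

(* Side [2^k], corners in [2^k m + (-2)^k u/3]; the alternating sign makes the
   endpoints of each generation endpoints of all finer ones. *)
Definition dyadic_cube (d : nat) (u : 'I_d -> 'I_3) (k : int) (m : 'I_d -> int) :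
    set (Rd R d) :=
  cube_at (fun i => 2 ^ k * (m i)%:~R + (- 2) ^ k * ((u i)%:R / 3))%R (2 ^ k)%R.

Lemma sign_exprz (k : int) :
  exists2 e : int, (e = 1 \/ e = - 1)%R & ((- 2) ^ k = e%:~R * 2 ^ k :> R)%R.
Proof.
have eM : ((- 2) ^ k = (- 1) ^ k * 2 ^ k :> R)%R by rewrite -mulN1r expfzMl.
have sgn (n : nat) : ((- 1) ^+ n = 1 :> R \/ (- 1) ^+ n = -1 :> R)%R.
  by rewrite -signr_odd; case: odd; rewrite ?expr1 ?expr0; [right|left].
have [E|E] : ((- 1) ^ k = 1 :> R \/ (- 1) ^ k = -1 :> R)%R.
- case: (k) => n; first exact: sgn.
  by rewrite NegzE -exprnN; case: (sgn n.+1) => ->; rewrite ?invr1 ?invrN1; [left|right].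
- by exists 1%R; [left|rewrite eM E].
- by exists (- 1)%R; [right|rewrite eM E mulrN1z].
Qed.

(** Because [-2] is congruent to 1 modulo 3, multiplying the shift [u/3] by [(-2)^n] changes it by
    an integer; this is why coarse grid points are also fine ones. *)
Lemma modulo_three (n : nat) :
  exists t : int, ((- 2) ^+ n = 1 + 3 * t%:~R :> R)%R.
Proof.
elim: n => [|n [t tE]]; first by exists 0%R; rewrite expr0 mulr0 addr0.
by exists (- 1 - 2 * t)%R; rewrite exprS tE; ring.
Qed.

Lemma grid_refine (k : int) (n : nat) (m : int) (u : nat) : exists j : int,
  (2 ^ (k + n) * m%:~R + (- 2) ^ (k + n) * (u%:R / 3) =
   2 ^ k * j%:~R + (- 2) ^ k * (u%:R / 3) :> R)%R.
Proof.
have [e _ eE] := sign_exprz k; have [t tE] := modulo_three n.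
exists (2 ^+ n * m + e * t * u%:Z)%R.
rewrite !exprzDr ?unitfE ?oppr_eq0 ?pnatr_eq0// -!exprnP.
rewrite tE eE !intrD !intrM rmorphXn /=; by field.
Qed.

(** The one-third trick: an interval of length at most [h/3] that leaves the unshifted cell
    containing [a] crosses its right end, hence lies in that cell moved right by [h/3]. *)
Lemma floor_cover (a l h : R) (e : int) : (0 < l)%R -> (3 * l <= h)%R ->
  (e = 1 \/ e = - 1)%R -> exists (u : 'I_3) (m : int),
  (h * m%:~R + e%:~R * h * (u%:R / 3) <= a)%R /\
  (a + l <= h * m%:~R + e%:~R * h * (u%:R / 3) + h)%R.
Proof.
move=> l0 lh eE; have h0 : (0 < h)%R by lra.
pose m := Num.floor (a / h); have /andP[m1 m2] := floor_itv (a / h).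
have fE : (a = h * (a / h))%R by field; rewrite gt_eqF.
have hm1 : (h * m%:~R <= a)%R by rewrite [leRHS]fE ler_pM2l.
have hm2 : (a < h * m%:~R + h)%R.
  rewrite [ltLHS]fE (_ : h * m%:~R + h = h * (m + 1)%:~R)%R ?ltr_pM2l//.
  by rewrite intrD; ring.
have [am|am] := leP (a + l)%R (h * m%:~R + h)%R.
  by exists ord0, m; rewrite mul0r mulr0 addr0.
case: eE => ->.
  exists (inord 1), m; rewrite inordK// mul1r; split; lra.
(* For the negative sign the move by [h/3] is written [h - 2h/3]: next cell, [u = 2]. *)
exists (inord 2), (m + 1)%R; rewrite inordK// intrD mulrN1z; split; lra.
Qed.

(** No grid point lies inside a cell: the inequalities at [x] give [j <= m] and [m + 1 <= j'] by
    integrality, and these bound the whole cell. *)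
Lemma grid_interval (h r x y : R) (m j j' : int) : (0 < h)%R ->
  (h * m%:~R + r <= x < h * m%:~R + r + h)%R ->
  (h * j%:~R + r <= x < h * j'%:~R + r)%R ->
  (h * m%:~R + r <= y < h * m%:~R + r + h)%R ->
  (h * j%:~R + r <= y < h * j'%:~R + r)%R.
Proof.
move=> h0 /andP[mx xm] /andP[jx xj] /andP[my ym].
have jm : (j <= m)%R.
  rewrite -ltzD1 -(ltr_int R) intrD -(ltr_pM2l h0) mulrDr mulr1; lra.
have mj : (m + 1 <= j')%R.
  rewrite -[leLHS]/(m + 1)%R lezD1 -(ltr_int R) -(ltr_pM2l h0); lra.
have hjm : (h * j%:~R <= h * m%:~R)%R by rewrite ler_pM2l// ler_int.
have : (h * (m + 1)%:~R <= h * j'%:~R)%R by rewrite ler_pM2l// ler_int.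
by rewrite intrD mulrDr mulr1 => hmj; apply/andP; split; lra.
Qed.

(** In each coordinate the ends of the coarser side are grid points of the finer generation, so a
    finer cube meeting the coarser one lies inside it. *)
Lemma dyadic_nested (d : nat) (u : 'I_d -> 'I_3) k k' m m' :
  [\/ dyadic_cube u k m `<=` dyadic_cube u k' m',
      dyadic_cube u k' m' `<=` dyadic_cube u k m
    | dyadic_cube u k m `&` dyadic_cube u k' m' = set0].
Proof.
wlog kk' : k k' m m' / (k <= k')%R.
  move=> H; have [/H//|/ltW/(H _ _ m' m)[]] := leP k k'.
  - by move=> ?; apply: Or32.
  - by move=> ?; apply: Or31.
  - by rewrite setIC => ?; apply: Or33.
have [[x [xP xQ]]|disj] :=
    pselect (exists x, dyadic_cube u k m x /\ dyadic_cube u k' m' x); last first.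
  apply: Or33; apply/seteqP; split => x // -[xP xQ].
  by apply: disj; exists x.
have [n k'E] : exists n : nat, k' = (k + n)%R.
  by exists `|k' - k|%N; rewrite gez0_abs ?subr_ge0//; ring.
apply: Or31 => y yP i; move: (xP i) (xQ i) (yP i); rewrite k'E.
have [j ->] := grid_refine k n (m' i) (u i).
have h0 : (0 < 2 ^ k :> R)%R by rewrite exprz_gt0.
have -> : (2 ^ k * j%:~R + (- 2) ^ k * ((u i)%:R / 3) + 2 ^ (k + n) =
    2 ^ k * (j + 2 ^+ n)%:~R + (- 2) ^ k * ((u i)%:R / 3) :> R)%R.
  by rewrite exprzDr ?unitfE// -exprnP intrD rmorphXn /=; ring.
exact: grid_interval.
Qed.

Lemma exists_scale (l : R) : (0 < l)%R -> exists k : int, (l <= 2 ^ k < 2 * l)%R.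
Proof.
move=> l0; have ln2 : (0 < ln 2 :> R)%R by rewrite ln_gt0// ltr1n.
pose k := Num.ceil (ln l / ln 2); exists k.
have two k' : (2 ^ k' = expR (k'%:~R * ln 2) :> R)%R.
  by rewrite -powR_intmul// powR_expR.
have /andP[k1 k2] := ceil_itv (ln l / ln 2); rewrite -/k in k1 k2.
rewrite two -{1}(lnK l0) ler_expR -ler_pdivrMr// k2/=.
rewrite (_ : k%:~R * ln 2 = ln 2 + (k - 1)%:~R * ln 2)%R; last first.
  by rewrite intrB; ring.
rewrite expRD lnK ?posrE// ltr_pM2l// -[ltRHS](lnK l0) ltr_expR -ltr_pdivlMr//.
Qed.

Lemma dyadic_cover (d : nat) (a : 'I_d -> R) (l : R) : (0 < l)%R ->
  exists (u : 'I_d -> 'I_3) (k : int) (m : 'I_d -> int),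
    cube_at a l `<=` dyadic_cube u k m /\ (2 ^ k <= 6 * l)%R.
Proof.
(* A scale of at least [3 l] is what the one-third trick needs; staying below [6 l] is the origin of
   the factor [6 ^ d]. *)
move=> l0; have [|k /andP[k1 k2]] := @exists_scale (3 * l); first by rewrite mulr_gt0.
have [e eE ke] := sign_exprz k.
have /choice[um umP] : forall i, exists um : 'I_3 * int,
    (2 ^ k * um.2%:~R + e%:~R * 2 ^ k * (um.1%:R / 3) <= a i)%R /\
    (a i + l <= 2 ^ k * um.2%:~R + e%:~R * 2 ^ k * (um.1%:R / 3) + 2 ^ k)%R.
  move=> i; have [u [m um]] := floor_cover (a i) l0 k1 eE.
  by exists (u, m).
exists (fun i => (um i).1), k, (fun i => (um i).2); split; last by lra.
move=> x xa i; have /andP[x1 x2] := xa i; have [u1 u2] := umP i.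
by rewrite ke; apply/andP; split; [exact: le_trans x1|exact: lt_le_trans u2].
Qed.

End DyadicGrids.

(** * From finite families to the full maximal function *)

Section DyadicMaximal.
Context {R : realType} {d : nat}.
Local Notation T := (Rd R d).
Local Notation mu := (@lebesgue_d R d).

Lemma measurable_ereal_sup (h : nat -> T -> \bar R) :
  (forall n, measurable_fun setT (h n)) ->
  measurable_fun setT (fun x => ereal_sup (range (h^~ x))).
Proof.
move=> mh; apply: (measurability _ (ErealGenOInfty.measurableE R)) => // _ [_ [l ->] <-].
rewrite setTI (_ : _ @^-1` _ = \bigcup_n (setT `&` [set x | l%:E < h n x])).
  by apply: bigcup_measurable => n _; exact: emeasurable_fun_o_infty.
apply/seteqP; split => x /=; rewrite in_itv/= andbT.
  by move=> /ereal_sup_gt[_ [n _ <-]] lh; exists n.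
move=> [n _ [_ /=]] /lt_le_trans; apply.
by apply: ereal_sup_ubound; exists n.
Qed.

Lemma fractional_maximal_ge0 (alpha : R) (f : T -> \bar R) x :
  0 <= fractional_maximal alpha f x.
Proof.
pose Q := cube_at (coordinate x) 1.
apply: (@le_trans _ _ (mu Q `^ (alpha / d%:R) * average Q (fun y => `|f y|))).
  rewrite mule_ge0 ?poweR_ge0// mule_ge0 ?inve_ge0 ?measure_ge0//.
  by apply: integral_ge0.
apply: ereal_sup_ubound; exists Q => //; split; first by exists (coordinate x), 1%R.
by move=> i; rewrite lexx ltrDl ltr01.
Qed.

Lemma lebesgue_union_lty (F : seq (set T)) : (forall Q, Q \in F -> cube Q) ->
  mu (union_of F) < +oo.
Proof.
elim: F => [|Q F ih] cF.
  rewrite (_ : union_of _ = set0) ?measure0//.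
  by apply/seteqP; split => x // [].
apply: (@le_lt_trans _ _ (mu Q + mu (union_of F))).
  apply: le_trans (lebesgue_dU _ _); apply: le_lebesgue_d => x [P].
  by rewrite inE => /predU1P[->|PF] Px; [left|right; exists P].
apply: lte_add_pinfty; last by apply: ih => P PF; apply: cF; rewrite inE PF orbT.
by have /andP[] := lebesgue_cube_gt0 (cF _ (mem_head _ _)).
Qed.

(** Pairs of a generation and a corner are countable; those with code below [n] form a finite family
    that increases to the whole grid. Corners are finite functions so that they can be decoded. *)
Definition grid_part (u : {ffun 'I_d -> 'I_3}) (n : nat) : seq (set T) :=
  [seq dyadic_cube u km.1 (fun i => (km.2 : {ffun 'I_d -> int}) i) |
    km <- pmap (fun i => unpickle i : option (int * {ffun 'I_d -> int})) (iota 0 n)].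

Lemma grid_part_cube u n (Q : set T) : Q \in grid_part u n -> cube Q.
Proof.
move=> /mapP[[k m] _ ->] /=.
exists (fun i => 2 ^ k * (m i)%:~R + (- 2) ^ k * ((u i)%:R / 3))%R, (2 ^ k)%R.
by split; first by rewrite exprz_gt0.
Qed.

Lemma grid_part_nested u n : nested (grid_part u n).
Proof.
by move=> _ _ /mapP[[k m] _ ->] /mapP[[k' m'] _ ->]; exact: dyadic_nested.
Qed.

Lemma grid_part_sub u n n' : (n <= n')%N -> {subset grid_part u n <= grid_part u n'}.
Proof.
move=> nn' _ /mapP[km kmn ->]; apply: map_f; move: kmn; rewrite !mem_pmap.
move=> /mapP[i ni ->]; apply: map_f; move: ni; rewrite !mem_iota !add0n/=.
by move=> /leq_trans; apply.
Qed.

Lemma grid_part_exists (u : {ffun 'I_d -> 'I_3}) (k : int) (m : 'I_d -> int) :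
  exists n, (dyadic_cube u k m : set T) \in grid_part u n.
Proof.
pose km : int * {ffun 'I_d -> int} := (k, [ffun i => m i]).
exists (pickle km).+1; apply/mapP; exists km.
  rewrite mem_pmap; apply/mapP; exists (pickle km); first by rewrite mem_iota ltnSn.
  by rewrite pickleK.
by congr dyadic_cube; apply/funext => i; rewrite ffunE.
Qed.

Context (p q beta : R) (s : \bar R) (v g : T -> R).
Hypothesis p1 : (1 < p)%R.
Hypothesis pq : (p <= q)%R.
Hypothesis beta0 : (0 <= beta)%R.
Hypothesis qE : (q^-1 = p^-1 - beta)%R.
Hypothesis qs : q%:E <= s.
Hypothesis mv : measurable_fun [set: T] v.
Hypothesis mg : measurable_fun [set: T] g.
Hypothesis v0 : forall x, (0 < v x)%R.
Hypothesis g0 : forall x, (0 <= g x)%R.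

Local Notation pc := (p / (p - 1))%R.
Local Notation sigma := (fun x => (v x `^ (- pc))%:E).
Local Notation Gp := (\int[mu]_x ((g x * v x) `^ p)%:E).

Hypothesis Gpoo : Gp < +oo.
Hypothesis sigoo : forall Q, cube Q -> \int[mu]_(x in Q) sigma x < +oo.

Context (A K : R).
Hypothesis A0 : (0 <= A)%R.
Hypothesis K0 : (0 <= K)%R.
Hypothesis hA : forall Q, cube Q -> lorentz_norm q s ((EFin \o v) \_ Q) <=
  (A * fine (mu Q) `^ q^-1 *
   (fine (\int[mu]_(x in Q) sigma x) / fine (mu Q)) `^ (- pc^-1))%:E.
Hypothesis hK : forall Q E, cube Q -> measurable E -> E `<=` Q ->
  (2^-1)%:E * mu Q <= mu E ->
  \int[mu]_(x in Q) sigma x <= K%:E * \int[mu]_(x in E) sigma x.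

Let value := cube_value beta g.

Let value_ge0 Q : (0 <= value Q)%R. Proof. exact: cube_value_ge0. Qed.

Let grid_max n (u : {ffun 'I_d -> 'I_3}) x : \bar R :=
  (family_max (grid_part u n) value x * v x)%:E.

Let grids_max n x : \bar R := \big[maxe/0]_(u : {ffun 'I_d -> 'I_3}) `|grid_max n u x|.

Let p0 : (0 < p)%R. Proof. by have := p1; lra. Qed.
Let q0 : (0 < q)%R. Proof. exact: lt_le_trans pq. Qed.
Let s0 : 0 < s. Proof. by apply: lt_le_trans qs; rewrite lte_fin. Qed.

Let measurable_grid_max n u : measurable_fun setT (grid_max n u).
Proof.
have mM : measurable_fun setT (family_max (grid_part u n) value).
  by apply: measurable_family_max => Q QF; exact: measurable_cube (grid_part_cube QF).
exact: (proj2 (measurable_EFinP _ _) (measurable_funM mM mv)).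
Qed.

Let le_grids_max n u x : `|grid_max n u x| <= grids_max n x.
Proof. by rewrite /grids_max (bigD1 u)//= le_max lexx. Qed.

Let grids_max_ge0 n x : 0 <= grids_max n x.
Proof. by rewrite /grids_max; elim/big_ind : _ => // y z y0 z0; rewrite le_max y0. Qed.

Let measurable_grids_max n : measurable_fun setT (grids_max n).
Proof.
rewrite /grids_max; elim: (index_enum _) => [|u r ih].
  rewrite (_ : (fun _ => _) = cst 0); first exact: measurable_cst.
  by apply/funext => x; rewrite big_nil.
rewrite (_ : (fun _ => _) =
    fun x => maxe `|grid_max n u x| (\big[maxe/0]_(u <- r) `|grid_max n u x|)); last first.
  by apply/funext => x; rewrite big_cons.
apply: measurable_maxe; last exact: ih.
by apply: measurableT_comp => //; exact: measurable_grid_max.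
Qed.

Let grids_max_nd x : {homo grids_max^~ x : n m / (n <= m)%N >-> n <= m}.
Proof.
move=> n m nm; rewrite /grids_max; elim: (index_enum _) => [|u r ih].
  by rewrite !big_nil.
rewrite !big_cons ge_max !le_max ih orbT andbT; apply/orP; left.
rewrite /grid_max !gee0_abs ?lee_fin ?mulr_ge0 ?family_max_ge0 ?(ltW (v0 _))//.
apply: ler_wpM2r; first exact: ltW.
case: (family_max_attained (grid_part u n) value x) => [->|[Q [QF Qx ->]]].
  exact: family_max_ge0.
by apply: le_family_max => //; exact: grid_part_sub QF.
Qed.

Let grid_count : R := #|{: {ffun 'I_d -> 'I_3}}|%:R.
Let cB := (grid_count * ((2 * A) `^ q * K * pc `^ p))%R.

Let grids_max_norm n :
  lorentz_norm q s (grids_max n) <= (cB%:E * Gp `^ (q / p)) `^ q^-1.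
Proof.
have Gp0 : 0 <= Gp by apply: integral_ge0 => x _; rewrite lee_fin powR_ge0.
have cB0 : (0 <= cB)%R by rewrite !mulr_ge0 ?powR_ge0.
rewrite poweR_lee_inv ?mule_ge0 ?poweR_ge0 ?lorentz_norm_ge0 ?(ltW s0)//.
have fin u l : (0 < l)%R -> distribution_fun (grid_max n u) l < +oo.
  move=> l0; apply: (@le_lt_trans _ _ (mu (union_of (grid_part u n)))); last first.
    by apply: lebesgue_union_lty => Q; exact: grid_part_cube.
  apply: le_lebesgue_d => x /=; rewrite /grid_max.
  case: (family_max_attained (grid_part u n) value x) => [->|[Q [QF Qx _]]].
    by rewrite mul0r normr0 lte_fin ltNge ltW.
  by move=> _; exists Q.
apply: le_trans (lorentz_norm_bigmaxe _ q0 qs (measurable_grid_max n) fin) _.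
apply: (@le_trans _ _ (\sum_(u : {ffun 'I_d -> 'I_3})
    ((2 * A) `^ q * K * pc `^ p)%:E * Gp `^ (q / p))).
  apply: lee_sum => u _; apply: finite_family_bound => //.
  - exact: grid_part_nested.
  - by move=> Q; exact: grid_part_cube.
pose B := ((2 * A) `^ q * K * pc `^ p)%:E * Gp `^ (q / p).
rewrite /cB (EFinM grid_count) -muleA -/B.
have B0 : 0 <= B by rewrite mule_ge0 ?poweR_ge0// lee_fin !mulr_ge0 ?powR_ge0.
have iterB N : iter N (fun x => B + x) 0 = N%:R%:E * B.
  elim: N => [|N ih]; first by rewrite mul0e.
  by rewrite iterS ih -nat1r EFinD ge0_muleDl ?mul1e ?lee_fin.
by rewrite big_const -iterB.
Qed.

(** Replacing [Q] by a dyadic [Q'] containing it increases both [|Q| ^ beta] and the integral; only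
    the division by the volume costs, by the factor [|Q'| / |Q| <= 6 ^ d]. *)
Lemma fractional_maximal_le (alpha : R) (x : T) : (beta = alpha / d%:R)%R ->
  fractional_maximal alpha (EFin \o g) x * (v x)%:E <=
    (6 ^+ d)%:E * ereal_sup (range (grids_max^~ x)).
Proof.
move=> betaE; rewrite muleC; pose B := ereal_sup (range (grids_max^~ x)); rewrite -/B.
have B0 : 0 <= B.
  by apply: le_trans (grids_max_ge0 0 x) _; apply: ereal_sup_ubound; exists 0%N.
have C0 : (0 < 6 ^+ d :> R)%R by rewrite exprn_gt0.
rewrite -lee_pdivlMl//; apply: ge_ereal_sup => _ [_ [[a [l [l0 ->]]] xQ] <-].
rewrite lee_pdivlMl//.
have [u [k [m [sub kl]]]] := dyadic_cover a l0.
pose u' : {ffun 'I_d -> 'I_3} := [ffun i => u i].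
have uE : dyadic_cube u k m = (dyadic_cube u' k m : set T).
  by congr dyadic_cube; apply/funext => i; rewrite ffunE.
rewrite uE in sub; have [n Qn] := grid_part_exists u' k m.
set Q := cube_at a l in sub xQ *; set Q' := dyadic_cube _ _ _ in sub Qn.
have cQ : cube Q by exists a, l.
have cQ' : cube Q' := grid_part_cube Qn.
have mQ' := measurable_cube cQ'; have mQ := measurable_cube cQ.
have k0 : (0 < 2 ^ k :> R)%R by rewrite exprz_gt0.
have VE : mu Q = (l ^+ d)%:E by exact: lebesgue_cube_at.
have VE' : mu Q' = ((2 ^ k) ^+ d)%:E by exact: lebesgue_cube_at.
have gE : \int[mu]_(y in Q) (`|(EFin \o g) y|) = \int[mu]_(y in Q) (g y)%:E.
  by apply: eq_integral => y _ /=; rewrite ger0_norm.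
have gQ' := integral_cube_fin p1 mv mg v0 g0 Gpoo sigoo cQ'.
have gQ := integral_cube_fin p1 mv mg v0 g0 Gpoo sigoo cQ.
have ld0 : (0 < l ^+ d)%R by rewrite exprn_gt0.
have kd0 : (0 < (2 ^ k) ^+ d :> R)%R by rewrite exprn_gt0.
apply: (@le_trans _ _ ((6 ^+ d)%:E * grids_max n x)); last first.
  apply: lee_wpmul2l; first by rewrite lee_fin ltW.
  by apply: ereal_sup_ubound; exists n.
apply: (@le_trans _ _ ((6 ^+ d)%:E * grid_max n u' x)); last first.
  apply: lee_wpmul2l; first by rewrite lee_fin ltW.
  apply: le_trans (le_grids_max n u' x).
  by rewrite gee0_abs// lee_fin mulr_ge0 ?family_max_ge0 ?(ltW (v0 _)).
rewrite /average gE gQ VE inver (gt_eqF ld0) poweR_EFin -!EFinM lee_fin.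
have QQ' : (l ^+ d <= (2 ^ k) ^+ d :> R)%R.
  by rewrite -lee_fin -VE -VE'; exact: le_lebesgue_d.
have k6 : ((2 ^ k) ^+ d <= 6 ^+ d * l ^+ d :> R)%R.
  by rewrite -exprMn lerXn2r// nnegrE ?(ltW k0)// mulr_ge0// ltW.
have [m1 m2] : (0 <= fine (\int[mu]_(y in Q) (g y)%:E))%R /\
    (fine (\int[mu]_(y in Q) (g y)%:E) <= fine (\int[mu]_(y in Q') (g y)%:E))%R.
  split; first by apply: fine_ge0; apply: integral_ge0 => y _; rewrite lee_fin.
  rewrite -lee_fin -gQ -gQ'.
  have gm : measurable_fun Q' (fun y => (g y)%:E).
    by apply: measurable_funTS; exact/measurable_EFinP.
  have gp y : Q' y -> 0 <= (g y)%:E by move=> _; rewrite lee_fin.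
  exact: (@ge0_subset_integral _ T R mu Q Q' mQ mQ' _ gm gp sub).
have valQ' : (value Q' <= family_max (grid_part u' n) value x)%R.
  by apply: le_family_max => //; exact: sub.
rewrite [leLHS]mulrC [leRHS]mulrA.
apply: ler_wpM2r; first exact: ltW.
apply: (@le_trans _ _ (6 ^+ d * value Q')%R); last by rewrite ler_pM2l.
have fV : fine (mu Q') = ((2 ^ k) ^+ d)%R by rewrite VE'.
rewrite /value cube_valueE fV [leRHS]mulrCA.
apply: ler_pM; [exact: powR_ge0|by rewrite mulr_ge0// invr_ge0 ltW| |].
  by rewrite -betaE; apply: ge0_ler_powR; rewrite ?nnegrE ?(ltW ld0) ?(ltW kd0).
rewrite mulrA; apply: ler_pM => //; first by rewrite invr_ge0 ltW.
by rewrite ler_pdivlMr// mulrC ler_pdivrMr.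
Qed.

Lemma dyadic_maximal_bound (alpha : R) : (beta = alpha / d%:R)%R ->
  lorentz_norm q s
    (fun x => fractional_maximal alpha (EFin \o g) x * (v x)%:E) <=
  ((6 ^+ d * (grid_count `^ q^-1 * (2 * pc `^ (p / q)))) *
   (A * K `^ q^-1))%:E * Gp `^ p^-1.
Proof.
move=> betaE; have Gp0 : 0 <= Gp.
  by apply: integral_ge0 => x _; rewrite lee_fin powR_ge0.
have cB0 : (0 <= cB)%R by rewrite !mulr_ge0 ?powR_ge0.
pose H x := ereal_sup (range (grids_max^~ x)).
have mH : measurable_fun setT H by exact: measurable_ereal_sup.
have H0 x : 0 <= H x.
  by apply: le_trans (grids_max_ge0 0 x) _; apply: ereal_sup_ubound; exists 0%N.
have C0 : (0 < 6 ^+ d :> R)%R by rewrite exprn_gt0.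
have M0 x : 0 <= fractional_maximal alpha (EFin \o g) x * (v x)%:E.
  apply: mule_ge0; last by rewrite lee_fin ltW.
  exact: fractional_maximal_ge0.
(* The maximal function is traded at once for [H], which is measurable as a countable supremum and
   an increasing limit of the [grids_max n]. *)
apply: (@le_trans _ _ (lorentz_norm q s (fun x => (6 ^+ d)%:E * H x))).
  apply: le_lorentz_norm => //; first exact: ltW.
  move=> x; rewrite (gee0_abs (M0 x)) gee0_abs; first exact: fractional_maximal_le.
  by rewrite mule_ge0// lee_fin ltW.
rewrite (@lorentz_normZ _ _ q (6 ^+ d)%R s H q0 s0 C0) -mulrA EFinM -muleA; apply: lee_wpmul2l.
  by rewrite lee_fin ltW.
apply: (@le_trans _ _ ((cB%:E * Gp `^ (q / p)) `^ q^-1)).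
  apply: (@lorentz_norm_fatou _ _ _ _ _ grids_max) => //.
  - exact: poweR_ge0.
  - by move=> x n m nm; rewrite !gee0_abs//; exact: grids_max_nd.
  - move=> n x; rewrite !gee0_abs//; by apply: ereal_sup_ubound; exists n.
  - move=> x l; rewrite gee0_abs// => /ereal_sup_gt[_ [n _ <-]] lh.
    by exists n; rewrite gee0_abs.
rewrite poweRM ?poweR_ge0 ?lee_fin// -poweRrM (_ : (q / p * q^-1 = p^-1)%R); last first.
  by field; rewrite !gt_eqF.
apply: lee_wpmul2r; first exact: poweR_ge0.
rewrite poweR_EFin lee_fin /cB le_eqVlt; apply/orP; left; apply/eqP.
have h2A : (0 <= 2 * A)%R by rewrite mulr_ge0.
have hq : (0 <= (2 * A) `^ q)%R by exact: powR_ge0.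
have hp : (0 <= pc `^ p)%R by exact: powR_ge0.
rewrite powRM ?mulr_ge0 ?ler0n// powRM ?mulr_ge0// powRM// -!powRrM.
by rewrite mulfV ?gt_eqF// powRr1//; ring.
Qed.

End DyadicMaximal.

Lemma conj_expE (R : realType) (p : R) : (1 < p)%R -> conj_exp p = (p / (p - 1))%R.
Proof.
move=> p1; rewrite /conj_exp /hoelder_conjugate /= eqe gt_eqF; last by lra.
by rewrite -EFinB inver subr_eq0 gt_eqF.
Qed.

(** * Null sets and weights positive everywhere *)

Section NullSets.
Context {R : realType} {d : nat}.
Local Notation T := (Rd R d).
Local Notation mu := (@lebesgue_d R d).
Implicit Types (f g w : T -> \bar R) (N : set T).

Lemma rearrangement_null f g N t : mu N = 0 -> (forall x, ~ N x -> f x = g x) ->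
  rearrangement f t = rearrangement g t.
Proof.
move=> N0 fg; congr ereal_inf; apply/seteqP.
have le f' g' y : (forall x, ~ N x -> f' x = g' x) ->
    mu [set x | y < `|f' x|] <= mu [set x | y < `|g' x|].
  move=> fg'; rewrite -[leRHS]adde0 -N0; apply: le_trans (lebesgue_dU _ _).
  apply: le_lebesgue_d => x /= yf.
  by have [Nx|Nx] := pselect (N x); [right|left; rewrite -fg'].
split => y /= [y0]; split => //.
  by apply: le_trans (le g f y _) _ => // x /fg.
exact: le_trans (le f g y fg) _.
Qed.

Lemma lorentz_norm_null (a : R) (b : \bar R) f g N : mu N = 0 ->
  (forall x, ~ N x -> f x = g x) -> lorentz_norm a b f = lorentz_norm a b g.
Proof.
move=> N0 fg; rewrite /lorentz_norm.
suff -> : rearrangement f = rearrangement g by [].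
by apply/funext => t; exact: rearrangement_null fg.
Qed.

Lemma null_measurable N : mu N = 0 -> measurable N.
Proof. by move=> N0; exact: lebesgue_d_complete N0. Qed.

Lemma integral_null f g N (D : set T) : mu N = 0 -> measurable D ->
  measurable_fun D f -> measurable_fun D g ->
  (forall x, 0 <= f x) -> (forall x, 0 <= g x) ->
  (forall x, ~ N x -> f x = g x) ->
  \int[mu]_(x in D) f x = \int[mu]_(x in D) g x.
Proof.
move=> N0 mD mf mg f0 g0 fg; apply: ge0_ae_eq_integral => //.
exists N; split => //; first exact: null_measurable.
by move=> x /= /not_implyP[_ fgx]; apply: contrapT => /fg.
Qed.

(** Where [w] is 0 or infinite, a null set, its value is changed to 1. *)
Lemma weight_version w : weight w -> exists v : T -> R,
  [/\ measurable_fun setT v, forall x, (0 < v x)%R &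
      exists2 N, mu N = 0 & forall x, ~ N x -> w x = (v x)%:E].
Proof.
move=> [mw [N [mN N0 wN]]].
pose u x := if (0 < w x) && (w x < +oo) then w x else 1.
have mu' : measurable_fun setT u.
  have mc (c : \bar R) : measurable_fun setT (cst c : T -> \bar R).
    exact: measurable_cst.
  apply: measurable_fun_ifT; [|exact: mw|exact: mc].
  exact: (measurable_and (measurable_fun_lte (mc 0) mw) (measurable_fun_lte mw (mc +oo))).
exists (fine \o u); split.
- exact: measurableT_comp.
- move=> x /=; rewrite /u; case: ifPn => [/andP[w0 woo]|_] /=; last by [].
  by rewrite fine_gt0// w0.
exists N => // x Nx /=; have /andP[w0 woo] : 0 < w x < +oo.
  by apply: contrapT => wx; apply: Nx; exact: wN.
by rewrite /u w0 woo/= fineK// gt0_fin_numE.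
Qed.

Lemma measurable_dual_weight (p : R) w : measurable_fun setT w ->
  measurable_fun setT (dual_weight p w).
Proof.
move=> mw; apply: (@measurableT_comp _ _ _ _ _ _ (fun x => x `^ (- conj_exp p))) => //.
exact: measurable_poweR.
Qed.

Lemma density_version (p : R) w (v : T -> R) N (E : set T) : measurable_fun setT w ->
  measurable_fun setT v -> mu N = 0 -> (forall x, ~ N x -> w x = (v x)%:E) ->
  measurable E ->
  density (dual_weight p w) E = density (dual_weight p (EFin \o v)) E.
Proof.
move=> mw mv N0 wv mE; have mvE : measurable_fun setT (EFin \o v).
  exact/measurable_EFinP.
exact: (integral_null N0 mE
  (measurable_funTS (measurable_dual_weight p mw))
  (measurable_funTS (measurable_dual_weight p mvE))
  (fun x => poweR_ge0 _ _) (fun x => poweR_ge0 _ _)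
  (fun x Nx => congr1 (fun y => y `^ (- conj_exp p)) (wv x Nx))).
Qed.

Lemma constants_version w : weight w -> exists v : T -> R,
  [/\ measurable_fun setT v, forall x, (0 < v x)%R &
    forall (p q : R) (s : \bar R) (c alpha : R), (1 < p)%R ->
    [/\ A_const p q s w = A_const p q s (EFin \o v),
      operator_norm (fractional_maximal alpha) (weighted_lorentz_norm w p p%:E)
        (weighted_lorentz_norm w q s) =
      operator_norm (fractional_maximal alpha)
        (weighted_lorentz_norm (EFin \o v) p p%:E)
        (weighted_lorentz_norm (EFin \o v) q s) &
      reverse_const c (density (dual_weight p w)) =
      reverse_const c (density (dual_weight p (EFin \o v)))]].
Proof.
move=> ww; have [v [mv v0 [N N0 wv]]] := weight_version ww; have [mw _] := ww.
exists v; split; [exact: mv|exact: v0|move=> p q s c alpha p1].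
have densE E : measurable E ->
    density (dual_weight p w) E = density (dual_weight p (EFin \o v)) E.
  exact: (density_version p mw mv N0 wv).
have densQ Q : cube Q ->
    density (dual_weight p w) Q = density (dual_weight p (EFin \o v)) Q.
  by move=> cQ; apply: densE; exact: measurable_cube.
have normE a b : weighted_lorentz_norm w a b = weighted_lorentz_norm (EFin \o v) a b.
  apply/funext => f; apply: (lorentz_norm_null _ _ N0) => x /wv wx /=.
  by rewrite wx.
split.
- apply: (congr1 (@ereal_sup R)); apply/seteqP.
  have AE Q : cube Q -> local_lorentz_norm Q q s w *
      average Q (dual_weight p w) `^ (conj_exp p)^-1 =
      local_lorentz_norm Q q s (EFin \o v) *
      average Q (dual_weight p (EFin \o v)) `^ (conj_exp p)^-1.
    move=> cQ; rewrite /local_lorentz_norm /average.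
    have LE : lorentz_norm q s (w \_ Q) = lorentz_norm q s ((EFin \o v) \_ Q).
      by apply: (lorentz_norm_null _ _ N0) => x /wv wx; rewrite !patchE wx.
    have IE := densQ Q cQ; rewrite /density in IE.
    by rewrite LE IE.
  split => _ [Q cQ <-]; exists Q; [exact: cQ|exact: esym (AE Q cQ)|exact: cQ|exact: AE].
- by rewrite !normE.
- have lfE : locally_finite_on_cubes (density (dual_weight p w)) =
      locally_finite_on_cubes (density (dual_weight p (EFin \o v))).
    by apply/propext; split => lf Q cQ; have := lf Q cQ; rewrite densQ.
  rewrite /reverse_const lfE.
  case: `[< locally_finite_on_cubes _ >]; last exact: erefl.
  apply: (congr1 (@ereal_sup R)); apply/seteqP.
  split => _ [[Q E] /= [cQ mE EQ cE] <-]; exists (Q, E).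
  - by split; [exact: cQ|exact: mE|exact: EQ|exact: cE].
  - by rewrite /= (densE _ mE) (densQ _ cQ).
  - by split; [exact: cQ|exact: mE|exact: EQ|exact: cE].
  - by rewrite /= (densE _ mE) (densQ _ cQ).
Qed.

End NullSets.

(** If [c = +oo] and [x > 0], a single [l] forces [B = +oo]. This case matters for necessity, where
    the local norm of the weight is not yet known to be finite. *)
Lemma lee_approxMr {R : realType} (x c B : \bar R) : 0 <= x -> 0 <= c -> 0 <= B ->
  (forall l : R, (0 < l)%R -> l%:E < x -> l%:E * c <= B) -> x * c <= B.
Proof.
move=> x0 + B0 h; case: c h => [c h|h _|//]; last first.
  have [->|xn0] := eqVneq x 0; first by rewrite mul0e.
  have [l [l0 lx]] : exists l : R, (0 < l)%R /\ l%:E < x.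
    case: x x0 xn0 {h} => [x| |//]; last by exists 1%R; rewrite ltry.
    rewrite lee_fin eqe => x0 xn0; exists (x / 2)%R; rewrite lte_fin.
    have {x0 xn0} : (0 < x)%R by rewrite lt0r xn0.
    by move=> x0; split; lra.
  by have := h _ l0 lx; rewrite gt0_muley ?lte_fin// => /(le_trans (leey _)).
rewrite lee_fin le_eqVlt => /predU1P[<-|c0]; first by rewrite mule0.
by rewrite muleC; apply: lee_approxZ => // l l0 lx; rewrite muleC; exact: h.
Qed.

Lemma powR_inv_le {R : realType} (x y r : R) : (0 < x)%R -> (0 < y)%R -> (0 < r)%R ->
  (x `^ (- r) <= y)%R -> (y `^ (- r^-1) <= x)%R.
Proof.
move=> x0 y0 r0 xy; rewrite powRN -[leRHS]invrK.
rewrite lef_pV2 ?posrE ?invr_gt0 ?powR_gt0//.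
rewrite -(powR_inv1 (ltW x0)) -(mulfV (lt0r_neq0 r0)) -mulNr powRrM.
by apply: ge0_ler_powR; rewrite ?invr_ge0 ?nnegrE ?powR_ge0 ?(ltW y0) ?(ltW r0).
Qed.

(* Here [W = |E|], [e = sigma(E)], [S = sigma(Q)], [V = |Q|]: by Chebyshev the
   dual weight is at most [2 e / W] on half of [E], which bounds the Lorentz
   norm [L] of the weight on [Q] from below. *)
Lemma reverse_real {R : realType} (p q V W S e L A : R) : (1 < p)%R -> (0 < q)%R ->
  (0 < V)%R -> (0 < S)%R -> (0 < e)%R -> (V / 2 <= W)%R ->
  ((2 * e / W) `^ (- (p / (p - 1))^-1) / 2 * (V / 4) `^ q^-1 <= L)%R ->
  (V `^ (- q^-1) * L * (V^-1 * S) `^ (p / (p - 1))^-1 <= A)%R ->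
  (S / e <= 4 * 2 `^ (p / (p - 1)) * 4 `^ (p / (p - 1) / q) * A `^ (p / (p - 1)))%R.
Proof.
move=> p1 q0 V0 S0 e0 VW hL hA; set pc := (p / (p - 1))%R in hL hA *.
have pc0 : (0 < pc)%R by rewrite divr_gt0 ?subr_gt0//; lra.
have W0 : (0 < W)%R by lra.
have eW : (0 < 2 * e / W)%R by rewrite divr_gt0// mulr_gt0.
have VS : (0 < V^-1 * S)%R by rewrite mulr_gt0 ?invr_gt0.
(* [z] is the resulting lower bound for [A]: the power of [V] in [(V / 4) ^ (1/q)] cancels the
   normalisation of the local norm. *)
pose z := (2^-1 * 4 `^ (- q^-1) * (2 * e / W) `^ (- pc^-1) * (V^-1 * S) `^ pc^-1)%R.
have zA : (z <= A)%R.
  apply: le_trans hA; apply: (@le_trans _ _ (V `^ (- q^-1) *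
      ((2 * e / W) `^ (- pc^-1) / 2 * (V / 4) `^ q^-1) * (V^-1 * S) `^ pc^-1)%R).
    have h4 : ((V / 4) `^ q^-1 = V `^ q^-1 * 4 `^ (- q^-1))%R.
      by rewrite powRM ?invr_ge0 ?(ltW V0)// -(powR_inv1 (ler0n _ 4)) -powRrM mulN1r.
    have hV : (V `^ (- q^-1) * V `^ q^-1 = 1)%R.
      by rewrite -powRD ?(lt0r_neq0 V0) ?implybT// addNr powRr0.
    rewrite h4 /z -[leLHS]mul1r -hV le_eqVlt; apply/orP; left; apply/eqP; ring.
  apply: ler_wpM2r; first exact: powR_ge0.
  by apply: ler_wpM2l; first exact: powR_ge0.
have z0 : (0 < z)%R by rewrite !mulr_gt0 ?powR_gt0 ?invr_gt0.
have : (z `^ pc <= A `^ pc)%R.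
  by apply: ge0_ler_powR; rewrite ?nnegrE ?(ltW z0) ?(ltW pc0)// (le_trans (ltW z0)).
have -> : (z `^ pc = (2 `^ pc)^-1 * (4 `^ (pc / q))^-1 * (W / (2 * e)) * (V^-1 * S))%R.
  have pcn : (pc != 0)%R by rewrite gt_eqF.
  have h1 : (2^-1 `^ pc = (2 `^ pc)^-1 :> R)%R.
    by rewrite -(powR_inv1 (ler0n _ 2)) -powRrM mulN1r powRN.
  have h2 : ((4 `^ (- q^-1)) `^ pc = (4 `^ (pc / q))^-1 :> R)%R.
    by rewrite -powRrM mulNr powRN (mulrC q^-1%R).
  have h3 : (((2 * e / W) `^ (- pc^-1)) `^ pc = W / (2 * e))%R.
    by rewrite -powRrM mulNr mulVf// powRN powRr1 ?(ltW eW)// invf_div.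
  have h4 : (((V^-1 * S) `^ pc^-1) `^ pc = V^-1 * S)%R.
    by rewrite -powRrM mulVf// powRr1 ?(ltW VS).
  rewrite -h1 -h2 -h3 -h4 /z.
  have x1 : (0 <= 4 `^ (- q^-1) :> R)%R by exact: powR_ge0.
  have x2 : (0 <= (2 * e / W) `^ (- pc^-1))%R by exact: powR_ge0.
  have x3 : (0 <= (V^-1 * S) `^ pc^-1)%R by exact: powR_ge0.
  move: x1 x2 x3; move: (4 `^ _)%R ((2 * e / W) `^ _)%R ((V^-1 * S) `^ _)%R => x y t x0 y0 t0.
  by rewrite !powRM ?mulr_ge0 ?invr_ge0.
set a := (2 `^ pc)%R; set b := (4 `^ (pc / q))%R => hz.
have a0 : (0 < a)%R by rewrite powR_gt0.
have b0 : (0 < b)%R by rewrite powR_gt0.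
have ab0 : (0 <= 4 * a * b)%R by rewrite !mulr_ge0 ?ltW.
apply: le_trans (ler_wpM2l ab0 hz).
(* The factor 4 is chosen so that [2 W / V] appears, which is at least 1 since [W >= V / 2]. *)
rewrite (_ : 4 * a * b * _ = (2 * W / V) * (S / e))%R; last first.
  by field; rewrite !gt_eqF.
rewrite ler_peMl ?divr_ge0 ?(ltW S0) ?(ltW e0)// ler_pdivlMr//; lra.
Qed.

(** * Finiteness, the reverse constant and necessity *)

Section WeightConstants.
Context {R : realType} {d : nat}.
Local Notation T := (Rd R d).
Local Notation mu := (@lebesgue_d R d).
Context (p q beta : R) (s : \bar R) (v : T -> R).
Hypothesis p1 : (1 < p)%R.
Hypothesis q0 : (0 < q)%R.
Hypothesis s0 : 0 < s.
Hypothesis qE : (q^-1 = p^-1 - beta)%R.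
Hypothesis mv : measurable_fun [set: T] v.
Hypothesis v0 : forall x, (0 < v x)%R.

Local Notation pc := (p / (p - 1))%R.
Local Notation sigma := (fun x => (v x `^ (- pc))%:E).
Let mass (Q : set T) := \int[mu]_(x in Q) sigma x.
Let size (Q : set T) := lorentz_norm q s ((EFin \o v) \_ Q).

Let p0 : (0 < p)%R. Proof. by have := p1; lra. Qed.
Let pc0 : (0 < pc)%R. Proof. by rewrite divr_gt0// subr_gt0. Qed.

Let mvE : measurable_fun setT (EFin \o v).
Proof. exact/measurable_EFinP. Qed.

Let mvQ (Q : set T) : measurable Q -> measurable_fun setT ((EFin \o v) \_ Q).
Proof.
by move=> mQ; apply/(measurable_restrictT _ _).1; [exact: mQ|exact: measurable_funTS].
Qed.

Let msigma : measurable_fun setT sigma.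
Proof.
apply/measurable_EFinP.
by apply: (@measurableT_comp _ _ _ _ _ _ (fun x => x `^ (- pc))%R) => //;
  exact: measurable_powR.
Qed.

Let sigma_gt0 x : 0 < (v x `^ (- pc))%:E.
Proof. by rewrite lte_fin powR_gt0. Qed.

Let sigma_ge0 x : 0 <= (v x `^ (- pc))%:E. Proof. exact: ltW. Qed.

Let mass_ge0 Q : 0 <= mass Q.
Proof. by apply: integral_ge0 => x _; exact: sigma_ge0. Qed.

Let size_ge0 Q : 0 <= size Q.
Proof. by apply: lorentz_norm_ge0; exact: ltW. Qed.

Let mass_le (D E : set T) : measurable D -> measurable E -> D `<=` E ->
  mass D <= mass E.
Proof.
move=> mD mE DE.
exact: (@ge0_subset_integral _ T R mu D E mD mE _ (measurable_funTS msigma)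
  (fun x _ => sigma_ge0 x) DE).
Qed.

Let mass_gt0 Q : cube Q -> 0 < mass Q.
Proof.
move=> cQ; apply: positive_integral => //; first exact: measurable_cube.
by have /andP[] := lebesgue_cube_gt0 cQ.
Qed.

(** Here the dual weight is bounded, so its mass is finite before anything is known about the
    A-constant; as [v > 0], these sets increase to [Q]. *)
Let above (Q : set T) (n : nat) := Q `&` [set x | (n.+1%:R^-1 < v x)%R].

Let measurable_above Q n : measurable Q -> measurable (above Q n).
Proof.
move=> mQ; apply: measurableI => //.
have := @emeasurable_fun_o_infty _ T R setT (EFin \o v) measurableT mvE (n.+1%:R^-1)%:E.
by rewrite setTI.
Qed.

Let above_nd Q : {homo (above Q) : n m / (n <= m)%N >-> (n <= m)%O}.
Proof.
move=> n m nm; apply/subsetPset => x [Qx /= nv]; split => //=.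
by apply: le_lt_trans nv; rewrite lef_pV2 ?posrE// ler_nat ltnS.
Qed.

Let bigcup_above Q : \bigcup_n above Q n = Q.
Proof.
apply/seteqP; split => [x [n _ []]//|x Qx].
have [n] := ltr_add_invr (v0 x); rewrite add0r => nv.
by exists n.
Qed.

Let cvg_mu_above Q : measurable Q -> mu (above Q n) @[n --> \oo] --> mu Q.
Proof.
move=> mQ; rewrite -{2}(bigcup_above Q).
apply: nondecreasing_cvg_mu.
- by move=> n; exact: measurable_above.
- by rewrite bigcup_above.
- exact: above_nd.
Qed.

Let cvg_mass_above Q : measurable Q -> mass (above Q n) @[n --> \oo] --> mass Q.
Proof.
move=> mQ; rewrite /mass -{2}(bigcup_above Q).
apply: (@ge0_nondecreasing_set_cvg_integral _ T R (above Q) sigma mu).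
- exact: above_nd.
- by move=> n; exact: measurable_above.
- by move=> n; exact: measurable_funTS.
- by move=> n x _; exact: sigma_ge0.
Qed.

Let above_gt0 Q : cube Q -> exists n, 0 < mu (above Q n).
Proof.
move=> cQ; have mQ := measurable_cube cQ; apply: contrapT => no.
have : mu Q <= 0.
  apply: (cvge_le _ (cvg_mu_above mQ)); apply: nearW => n.
  by rewrite leNgt; apply/negP => h; apply: no; exists n.
by rewrite leNgt; have /andP[->] := lebesgue_cube_gt0 cQ.
Qed.

Let size_lower Q (l : R) (E : set T) : measurable Q -> (0 < l)%R -> E `<=` Q ->
  (forall x, E x -> (l < v x)%R) -> l%:E * mu E `^ q^-1 <= size Q.
Proof.
move=> mQ l0 EQ Ev; apply: le_trans (lorentz_norm_lower q0 s0 (mvQ mQ) l0).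
apply: lee_wpmul2l; first by rewrite lee_fin ltW.
apply: lee_poweR; first by rewrite invr_ge0 ltW.
  exact: measure_ge0.
apply: le_lebesgue_d => x Ex /=; rewrite patchE mem_set; last exact: EQ.
by rewrite /= lte_fin gtr0_norm ?Ev.
Qed.

Let size_gt0 Q : cube Q -> 0 < size Q.
Proof.
move=> cQ; have [n En] := above_gt0 cQ.
have n0 : (0 < n.+1%:R^-1 :> R)%R by rewrite invr_gt0.
apply: lt_le_trans (size_lower (measurable_cube cQ) n0 _ (_ : forall x, above Q n x -> _)).
- by rewrite mule_gt0 ?lte_fin// poweR_gt0.
- by move=> x [].
- by move=> x [].
Qed.

Definition cube_constant (Q : set T) : \bar R :=
  mu Q `^ (- q^-1) * size Q * ((mu Q)^-1 * mass Q) `^ pc^-1.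

Lemma A_constE : A_const p q s (EFin \o v) = ereal_sup [set cube_constant Q | Q in cube].
Proof.
apply: (congr1 (@ereal_sup R)); apply: eq_imagel => Q cQ.
rewrite /cube_constant /local_lorentz_norm /average /dual_weight conj_expE//.
Qed.

Let inv_vol_gt0 (Q : set T) : cube Q -> 0 < (mu Q)^-1.
Proof.
move=> /lebesgue_cube_fine[V V0 ->].
by rewrite inver gt_eqF// lte_fin invr_gt0.
Qed.

Lemma cube_constant_gt0 Q : cube Q -> 0 < cube_constant Q.
Proof.
move=> cQ; have /andP[V0 _] := lebesgue_cube_gt0 cQ.
rewrite /cube_constant; apply: mule_gt0.
  by apply: mule_gt0; [exact: poweR_gt0|exact: size_gt0].
by apply: poweR_gt0; apply: mule_gt0; [exact: inv_vol_gt0|exact: mass_gt0].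
Qed.

Lemma A_const_ge Q : cube Q -> cube_constant Q <= A_const p q s (EFin \o v).
Proof. by move=> cQ; rewrite A_constE; apply: ereal_sup_ubound; exists Q. Qed.

Lemma A_const_gt0 : 0 < A_const p q s (EFin \o v).
Proof.
have cQ : cube (cube_at (fun=> 0%R) 1 : set T) by exists (fun=> 0%R), 1%R.
exact: lt_le_trans (cube_constant_gt0 cQ) (A_const_ge cQ).
Qed.

(** The local norm of [v] is strictly positive, so an infinite mass would make the constant of that
    cube infinite. *)
Lemma mass_lty Q : A_const p q s (EFin \o v) < +oo -> cube Q -> mass Q < +oo.
Proof.
move=> Aoo cQ; rewrite ltNge leye_eq; apply/negP => /eqP moo.
have := le_lt_trans (A_const_ge cQ) Aoo.
have /andP[V0 _] := lebesgue_cube_gt0 cQ.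
rewrite /cube_constant moo gt0_muley ?inv_vol_gt0// poweRyr ?invr_neq0 ?gt_eqF//.
by rewrite gt0_muley ?ltxx// mule_gt0 ?poweR_gt0 ?size_gt0.
Qed.

Lemma cube_constant_fin Q (V S L : R) : (0 < V)%R -> (0 <= S)%R ->
  mu Q = V%:E -> mass Q = S%:E -> size Q = L%:E ->
  cube_constant Q = (V `^ (- q^-1) * L * (V^-1 * S) `^ pc^-1)%:E.
Proof.
by move=> V0 S0 VE SE LE; rewrite /cube_constant VE SE LE inver gt_eqF.
Qed.

Lemma size_le Q : A_const p q s (EFin \o v) < +oo -> cube Q ->
  size Q <= (fine (A_const p q s (EFin \o v)) * fine (mu Q) `^ q^-1 *
    (fine (mass Q) / fine (mu Q)) `^ (- pc^-1))%:E.
Proof.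
move=> Aoo cQ; have [V V0 VE] := lebesgue_cube_fine cQ.
have Afin : A_const p q s (EFin \o v) \is a fin_num.
  by rewrite ge0_fin_numE ?Aoo// ltW// A_const_gt0.
have Sfin : mass Q \is a fin_num by rewrite ge0_fin_numE ?mass_lty.
have S0 : (0 < fine (mass Q))%R by rewrite fine_gt0// mass_gt0// mass_lty.
have := A_const_ge cQ; rewrite /cube_constant -{1}(fineK Sfin) -{1}(fineK Afin) VE.
rewrite inver gt_eqF// -EFinM !poweR_EFin muleAC -EFinM muleC => h.
set c := (V `^ (- q^-1) * (V^-1 * fine (mass Q)) `^ pc^-1)%R in h.
have c0 : (0 < c)%R by rewrite mulr_gt0 ?powR_gt0 ?mulr_gt0 ?invr_gt0.
move: h; rewrite muleC -lee_pdivlMl// => /le_trans; apply.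
rewrite -EFinM lee_fin le_eqVlt; apply/orP; left; apply/eqP.
rewrite /c invfM -!powRN opprK mulrC -mulrA; congr (_ * (_ * _ `^ _))%R.
by rewrite mulrC.
Qed.

Lemma reverse_ratio_le Q E : A_const p q s (EFin \o v) < +oo -> cube Q ->
  measurable E -> E `<=` Q -> (2^-1)%:E * mu Q <= mu E ->
  mass Q / mass E <=
    (4 * 2 `^ pc * 4 `^ (pc / q))%:E * A_const p q s (EFin \o v) `^ pc.
Proof.
move=> Aoo cQ mE EQ QE; have mQ := measurable_cube cQ.
have [V V0 VE] := lebesgue_cube_fine cQ.
have Efin : mu E \is a fin_num.
  rewrite ge0_fin_numE ?measure_ge0//; apply: le_lt_trans (le_lebesgue_d EQ) _.
  by rewrite VE ltry.
have : exists W, mu E = W%:E by exists (fine (mu E)); rewrite fineK.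
move=> [W WE]; have VW : (V / 2 <= W)%R.
  by move: QE; rewrite VE WE -EFinM lee_fin mulrC.
have W0 : (0 < W)%R by lra.
have Soo := mass_lty Aoo cQ.
have [S SE] : exists S, mass Q = S%:E.
  by exists (fine (mass Q)); rewrite fineK// ge0_fin_numE.
have [e eE] : exists e, mass E = e%:E.
  exists (fine (mass E)); rewrite fineK// ge0_fin_numE//.
  exact: le_lt_trans (mass_le mE mQ EQ) Soo.
have S0 : (0 < S)%R by rewrite -lte_fin -SE mass_gt0.
have e0 : (0 < e)%R.
  rewrite -lte_fin -eE; apply: positive_integral => //.
  by rewrite WE lte_fin.
have eW : (0 < 2 * e / W)%R by rewrite divr_gt0// mulr_gt0.
have Afin : A_const p q s (EFin \o v) \is a fin_num.
  by rewrite ge0_fin_numE ?Aoo// ltW// A_const_gt0.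
pose B := E `&` [set x | (2 * e / W)%:E < (v x `^ (- pc))%:E].
have mB : measurable B.
  exact: (@emeasurable_fun_o_infty _ T R E sigma mE (measurable_funTS msigma)).
have Bhalf : mu B <= (W / 2)%:E.
  have : (2 * e / W)%:E * mu B <= e%:E.
    rewrite -(integral_cst mu mB) -eE; apply: le_trans (mass_le mB mE _).
      apply: le_integral_nonneg => x; first by move=> _ /=; rewrite lee_fin ltW.
      by move=> [_ /ltW].
    exact: subIsetl.
  rewrite -lee_pdivlMl// => /le_trans; apply.
  rewrite -EFinM lee_fin le_eqVlt; apply/orP; left; apply/eqP.
  by field; rewrite !gt_eqF.
pose m := ((2 * e / W) `^ (- pc^-1))%R.
have m0 : (0 < m)%R by rewrite powR_gt0.
have EB : (V / 4)%:E <= mu (E `\` B).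
  have : mu E <= mu (E `\` B) + mu B.
    apply: le_trans (lebesgue_dU _ _); apply: le_lebesgue_d => x Ex.
    by have [Bx|nBx] := pselect (B x); [right|left].
  move=> /le_trans/(_ (leeD2l _ Bhalf)); rewrite WE -leeBlDr// -EFinB.
  by apply: le_trans; rewrite lee_fin; lra.
have Lm : (m / 2 * (V / 4) `^ q^-1)%:E <= size Q.
  (* Outside [B] only [m <= v] is known, whereas superlevel sets are strict. Halving [m] restores
     strictness and is the source of the factor [2 ^ pc]. *)
  have m20 : (0 < m / 2)%R by rewrite divr_gt0.
  apply: le_trans (size_lower mQ m20 (_ : E `\` B `<=` Q) _).
  - rewrite EFinM -poweR_EFin; apply: lee_wpmul2l; first by rewrite lee_fin ltW.
    apply: lee_poweR EB; first by rewrite invr_ge0 ltW.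
    by rewrite lee_fin divr_ge0 ?ltW.
  - by move=> x [/EQ].
  move=> x [Ex nBx]; apply: (@lt_le_trans _ _ m); first by lra.
  have : (v x `^ (- pc) <= 2 * e / W)%R.
    by rewrite leNgt; apply/negP => h; apply: nBx; split => //=; rewrite lte_fin.
  exact: powR_inv_le.
have Lfin : size Q \is a fin_num.
  rewrite ge0_fin_numE ?size_ge0//; apply: le_lt_trans (size_le Aoo cQ) _.
  by rewrite ltry.
have [L LE] : exists L, size Q = L%:E by exists (fine (size Q)); rewrite fineK.
have hA := A_const_ge cQ.
rewrite (cube_constant_fin V0 (ltW S0) VE SE LE) -(fineK Afin) lee_fin in hA.
rewrite LE lee_fin in Lm.
rewrite SE eE inver gt_eqF// -EFinM -(fineK Afin) poweR_EFin -EFinM lee_fin.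
exact: (reverse_real p1 q0 V0 S0 e0 VW Lm hA).
Qed.

(** For [f = sigma 1_E] the identity [sigma^p v^p = sigma] gives norm [sigma(E)^(1/p)], while the
    maximal function is at least [|Q|^(beta - 1) sigma(E)] on [Q]. Dividing by [sigma(E)], finite
    thanks to the truncation, leaves [sigma(E)^(1/p')] times the local norm; then [E] increases to
    [Q]. *)
Lemma necessity (alpha : R) (C : R) : (beta = alpha / d%:R)%R -> (0 <= C)%R ->
  (forall f : T -> \bar R, measurable_fun setT f ->
    weighted_lorentz_norm (EFin \o v) p p%:E f < +oo ->
    weighted_lorentz_norm (EFin \o v) q s (fractional_maximal alpha f) <=
      C%:E * weighted_lorentz_norm (EFin \o v) p p%:E f) ->
  A_const p q s (EFin \o v) <= C%:E.
Proof.
move=> betaE C0 hC; rewrite A_constE; apply: ge_ereal_sup => _ [Q cQ <-].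
have mQ := measurable_cube cQ; have [V V0 VE] := lebesgue_cube_fine cQ.
have key : mass Q `^ pc^-1 * size Q <= (C * V `^ (1 - beta))%:E.
  have B0 : (0 <= C * V `^ (1 - beta))%R by rewrite mulr_ge0 ?powR_ge0.
  apply: lee_approxMr => //; first exact: poweR_ge0.
  move=> l l0 lS.
  have [n ln] : exists n, l%:E < mass (above Q n) `^ pc^-1.
    apply: contrapT => no; move: lS; rewrite ltNge; apply/negP/negPn.
    have ndm : {homo (fun n => mass (above Q n)) : n m / (n <= m)%N >-> n <= m}.
      move=> n m nm; apply: mass_le; [exact: measurable_above|exact: measurable_above|].
      exact/subsetPset/above_nd.
    have pci : (0 < pc^-1)%R by rewrite invr_gt0.
    apply: (cvge_le _ (poweR_nd_cvg pci (fun n => mass_ge0 _) ndm (cvg_mass_above mQ))).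
    by apply: nearW => n; rewrite leNgt; apply/negP => h; apply: no; exists n.
  have mA := measurable_above n mQ.
  pose f x := (sigma \_ (above Q n)) x.
  have mf : measurable_fun setT f.
    by apply/(measurable_restrictT _ _).1; [exact: mA|exact: measurable_funTS].
  have Soo : mass (above Q n) < +oo.
    pose c : R := ((n.+1%:R^-1 `^ pc)^-1)%R.
    apply: (@le_lt_trans _ _ (\int[mu]_(x in above Q n) cst c%:E x)).
      apply: le_integral_nonneg => x; first by move=> _; exact: sigma_ge0.
      move=> [_ /= nv]; rewrite lee_fin powRN lef_pV2 ?posrE ?powR_gt0 ?invr_gt0//.
      by apply: ge0_ler_powR; rewrite ?(ltW pc0) ?nnegrE ?invr_ge0 ?(ltW (v0 x)) ?(ltW nv).
    rewrite (integral_cst mu mA); apply: lte_mul_pinfty.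
    - by rewrite lee_fin invr_ge0 powR_ge0.
    - by [].
    apply: le_lt_trans (_ : mu Q < +oo); last by rewrite VE ltry.
    by apply: le_lebesgue_d => x [].
  have [S SE] : exists S, mass (above Q n) = S%:E.
    by exists (fine (mass (above Q n))); rewrite fineK// ge0_fin_numE.
  have S0 : (0 < S)%R.
    rewrite -lte_fin -SE; apply: (@gt0_poweR _ _ pc^-1) => //; first by rewrite invr_gt0.
    by apply: lt_trans ln; rewrite lte_fin.
  have N1 : weighted_lorentz_norm (EFin \o v) p p%:E f = (S `^ p^-1)%:E.
    have mfv : measurable_fun setT (f \* (EFin \o v)) by exact: emeasurable_funM mf mvE.
    rewrite /weighted_lorentz_norm (lorentz_norm_pp p0 mfv).
    rewrite -poweR_EFin -SE /mass [in RHS]integral_mkcond; congr (_ `^ _).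
    apply: eq_integral => x _; rewrite /f !patchE; case: ifPn => _; last first.
      by rewrite mul0e abse0 poweR0r// gt_eqF.
    rewrite /= ger0_norm ?mulr_ge0 ?powR_ge0 ?(ltW (v0 x))//.
    rewrite powRM ?powR_ge0 ?(ltW (v0 x))// -powRrM -powRD; last first.
      by rewrite (lt0r_neq0 (v0 x)) implybT.
    by congr ((_ `^ _)%:E); field; rewrite gt_eqF// subr_gt0.
  have := hC f mf; rewrite N1 ltry => /(_ isT) N2.
  have fS : \int[mu]_(y in Q) `|f y| = S%:E.
    rewrite -SE -(_ : Q `&` above Q n = above Q n); last first.
      by apply/seteqP; split => x // -[Qx].
    rewrite /mass integral_mkcondr; apply: eq_integral => x _.
    by rewrite gee0_abs// /f erestrict_ge0.
  have c0 : (0 < V `^ beta * (V^-1 * S))%R by rewrite !mulr_gt0 ?powR_gt0 ?invr_gt0.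
  have low : (V `^ beta * (V^-1 * S))%:E * size Q <=
      weighted_lorentz_norm (EFin \o v) q s (fractional_maximal alpha f).
    rewrite /size -(@lorentz_normZ _ _ q _ s ((EFin \o v) \_ Q) q0 s0 c0).
    apply: le_lorentz_norm q0 (ltW s0) _.
    move=> x; have M0 := fractional_maximal_ge0 alpha f x.
    rewrite [leRHS]gee0_abs; last by rewrite mule_ge0// lee_fin ltW.
    rewrite patchE; case: ifPn => [|_]; last first.
      by rewrite mule0 abse0 mule_ge0// lee_fin ltW.
    rewrite inE => Qx; rewrite gee0_abs; last first.
      by rewrite -EFinM lee_fin !mulr_ge0 ?powR_ge0 ?invr_ge0// ltW.
    apply: lee_wpmul2r; first by rewrite lee_fin ltW.
    apply: ereal_sup_ubound; exists Q => //; rewrite /average VE inver gt_eqF//.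
    rewrite fS betaE poweR_EFin -!EFinM//.
  have {}N2 := le_trans low N2.
  move: N2; rewrite -EFinM -lee_pdivlMl// => N2.
  apply: (@le_trans _ _ ((S `^ pc^-1)%:E * size Q)).
    apply: lee_wpmul2r; first exact: size_ge0.
    by apply: ltW; rewrite -poweR_EFin -SE.
  have S1 : 0 <= (S `^ pc^-1)%:E by rewrite lee_fin powR_ge0.
  apply: le_trans (lee_wpmul2l S1 N2) _.
  rewrite -!EFinM lee_fin le_eqVlt; apply/orP; left; apply/eqP.
  have SS : (S `^ pc^-1 * S `^ p^-1 = S)%R.
    rewrite -powRD ?(lt0r_neq0 S0) ?implybT// (_ : _ + _ = 1)%R ?powRr1 ?(ltW S0)//.
    by field; rewrite !gt_eqF// subr_gt0.
  rewrite powRB ?(lt0r_neq0 V0) ?implybT// powRr1 ?(ltW V0)//.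
  have Vb : (V `^ beta != 0)%R by rewrite gt_eqF// powR_gt0.
  transitivity (C * (S `^ pc^-1 * S `^ p^-1) * (V `^ beta * (V^-1 * S))^-1)%R.
    by ring.
  by rewrite SS; field; rewrite Vb !gt_eqF.
rewrite /cube_constant VE inver gt_eqF// poweRM ?lee_fin ?invr_ge0 ?(ltW V0)//.
rewrite !poweR_EFin -muleA [X in _ * X]muleC -!muleA muleA -EFinM.
apply: (@le_trans _ _ ((V `^ (- q^-1) * V^-1 `^ pc^-1)%:E * (C * V `^ (1 - beta))%:E)).
  by apply: lee_wpmul2l => //; rewrite lee_fin mulr_ge0 ?powR_ge0.
rewrite -EFinM lee_fin -(powR_inv1 (ltW V0)) -powRrM mulrCA -!powRD; last 2 first.
- by rewrite (lt0r_neq0 V0) implybT.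
- by rewrite (lt0r_neq0 V0) implybT.
(* The total power of [V] is [1 - beta - 1/q - 1/p' = 0]. *)
rewrite (_ : _ + _ = 0)%R ?powRr0 ?mulr1//.
have pn : (p != 0)%R by rewrite gt_eqF.
have pn1 : (p - 1 != 0)%R by rewrite gt_eqF// subr_gt0.
by rewrite qE; field; rewrite ?pn ?pn1.
Qed.

End WeightConstants.

(** * Sufficiency for weights positive everywhere *)

Section Sufficiency.
Context {R : realType} {d : nat}.
Local Notation T := (Rd R d).
Local Notation mu := (@lebesgue_d R d).
Context (p q beta alpha : R) (s : \bar R) (v : T -> R).
Hypothesis p1 : (1 < p)%R.
Hypothesis pq : (p <= q)%R.
Hypothesis beta0 : (0 <= beta)%R.
Hypothesis qE : (q^-1 = p^-1 - beta)%R.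
Hypothesis qs : q%:E <= s.
Hypothesis betaE : (beta = alpha / d%:R)%R.
Hypothesis mv : measurable_fun [set: T] v.
Hypothesis v0 : forall x, (0 < v x)%R.

Local Notation pc := (p / (p - 1))%R.
Local Notation sigma := (fun x => (v x `^ (- pc))%:E).
Local Notation A := (A_const p q s (EFin \o v)).
Local Notation Rc := (reverse_const 2^-1 (density (dual_weight p (EFin \o v)))).

Let p0 : (0 < p)%R. Proof. by have := p1; lra. Qed.
Let pc0 : (0 < pc)%R. Proof. by rewrite divr_gt0// subr_gt0. Qed.
Let q0 : (0 < q)%R. Proof. exact: lt_le_trans pq. Qed.
Let s0 : 0 < s. Proof. by apply: lt_le_trans qs; rewrite lte_fin. Qed.

Let densityE E : density (dual_weight p (EFin \o v)) E = \int[mu]_(x in E) sigma x.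
Proof. by rewrite /density /dual_weight conj_expE. Qed.

Let sigma_gt0 x : 0 < (v x `^ (- pc))%:E.
Proof. by rewrite lte_fin powR_gt0. Qed.

Let msigma : measurable_fun setT sigma.
Proof.
apply/measurable_EFinP.
by apply: (@measurableT_comp _ _ _ _ _ _ (fun x => x `^ (- pc))%R) => //;
  exact: measurable_powR.
Qed.

Lemma reverse_const_ge (Q E : set T) :
  cube Q -> measurable E -> E `<=` Q -> (2^-1)%:E * mu Q <= mu E ->
  (\int[mu]_(x in Q) sigma x) / (\int[mu]_(x in E) sigma x) <= Rc.
Proof.
move=> cQ mE EQ QE; rewrite /reverse_const; case: ifPn => _; last exact: leey.
apply: ereal_sup_ubound; exists (Q, E); first by split.
by rewrite /= !densityE.
Qed.

Lemma reverse_const_lty : Rc < +oo ->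
  forall Q : set T, cube Q -> \int[mu]_(x in Q) sigma x < +oo.
Proof.
rewrite /reverse_const; case: ifPn => [/asboolP lf _ Q cQ|]; last by rewrite ltxx.
by rewrite -densityE; exact: lf.
Qed.

Let mass_gt0 (E : set T) : measurable E -> 0 < mu E ->
  0 < \int[mu]_(x in E) sigma x.
Proof. by move=> mE E0; exact: positive_integral. Qed.

(** The pair [E = Q] already gives the ratio 1. Positivity excludes the product [0 * +oo = 0] in the
    upper bound. *)
Lemma reverse_const_gt0 : 0 < Rc.
Proof.
have cQ : cube (cube_at (fun=> 0%R) 1 : set T) by exists (fun=> 0%R), 1%R.
set Q := cube_at _ _ in cQ.
have [->|Roo] := eqVneq Rc +oo; first exact: ltry.
have Soo : \int[mu]_(x in Q) sigma x < +oo.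
  by apply: reverse_const_lty cQ; rewrite lt_neqAle leey andbT.
have mQ := measurable_cube cQ; have /andP[V0 Voo] := lebesgue_cube_gt0 cQ.
have S0 := mass_gt0 mQ V0.
have half : (2^-1)%:E * mu Q <= mu Q.
  by rewrite -[leRHS]mul1e; apply: lee_wpmul2r; rewrite ?lee_fin ?(ltW V0)//; lra.
have := reverse_const_ge cQ mQ (@subset_refl _ Q) half.
by rewrite divee ?ge0_fin_numE ?(ltW S0) ?gt_eqF//; apply: lt_le_trans.
Qed.

Let A_gt0 : 0 < A. Proof. exact: A_const_gt0. Qed.

(** As [v > 0], a finite weighted norm makes [f] finite almost everywhere; the maximal function only
    sees integrals of [|f|], so [f] can be replaced by a nonnegative real function. *)
Let finite_version (f : T -> \bar R) : measurable_fun setT f ->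
  weighted_lorentz_norm (EFin \o v) p p%:E f < +oo ->
  exists g : T -> R, [/\ measurable_fun setT g, forall x, (0 <= g x)%R,
    fractional_maximal alpha f = fractional_maximal alpha (EFin \o g),
    \int[mu]_x ((g x * v x) `^ p)%:E < +oo &
    weighted_lorentz_norm (EFin \o v) p p%:E f =
      (\int[mu]_x ((g x * v x) `^ p)%:E) `^ p^-1].
Proof.
move=> mf; have mvE : measurable_fun setT (EFin \o v) by exact/measurable_EFinP.
have mfv : measurable_fun setT (f \* (EFin \o v)) by exact: emeasurable_funM mf mvE.
rewrite /weighted_lorentz_norm (lorentz_norm_pp p0 mfv).
have mh : measurable_fun setT (fun x => `|(f \* (EFin \o v)) x| `^ p).
  apply: (@measurableT_comp _ _ _ _ _ _ (fun x => x `^ p)).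
    exact: measurable_poweR.
  exact: (measurableT_comp _ mfv).
move=> /(lty_poweRy (invr_neq0 (lt0r_neq0 p0))) foo.
have : mu.-integrable setT (fun x => `|(f \* (EFin \o v)) x| `^ p).
  apply/integrableP; split; first exact: mh.
  apply: le_lt_trans foo; rewrite le_eqVlt; apply/orP; left; apply/eqP.
  by apply: eq_integral => x _; rewrite gee0_abs// poweR_ge0.
move=> /(integrable_ae measurableT)[N [mN N0 fN]].
have ffin x : ~ N x -> f x \is a fin_num.
  move=> Nx; have /(_ I) : setT x -> `|(f \* (EFin \o v)) x| `^ p \is a fin_num.
    by apply: contrapT => h; apply: Nx; exact: fN.
  case: (f x) => [r| |]//=.
    by rewrite gt0_mulye ?lte_fin//= (gt_eqF p0).
  by rewrite gt0_mulNye ?lte_fin//= (gt_eqF p0).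
have mabs : measurable_fun setT (fun x => `|f x|) by exact: measurableT_comp.
pose g x := fine `|f x|.
have mg : measurable_fun setT g.
  exact: (@measurableT_comp _ _ _ _ _ _ (@fine R) _ (fun x => `|f x|)).
have g0 x : (0 <= g x)%R by rewrite fine_ge0.
have gE x : ~ N x -> `|f x| = (g x)%:E.
  by move=> /ffin fx; rewrite /g fineK// fin_num_abs abse_id -fin_num_abs.
have IE : \int[mu]_x (`|(f \* (EFin \o v)) x| `^ p) =
    \int[mu]_x ((g x * v x) `^ p)%:E.
  have mgv : measurable_fun setT (fun x => ((g x * v x) `^ p)%:E).
    apply/measurable_EFinP.
    apply: (@measurableT_comp _ _ _ _ _ _ (fun x => x `^ p)%R).
      exact: measurable_powR.
    exact: measurable_funM.
  apply: (integral_null N0 measurableT mh mgv).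
  - by move=> x; exact: poweR_ge0.
  - by move=> x; rewrite lee_fin powR_ge0.
  - by move=> x /gE fx /=; rewrite abseM fx gee0_abs ?lee_fin ?ltW.
exists g; split.
- exact: mg.
- exact: g0.
- apply/funext => x; apply: (congr1 (@ereal_sup R)).
  apply: eq_imagel => Q [cQ _]; have mQ := measurable_cube cQ.
  rewrite /average; congr (_ * (_ * _)).
  apply: (integral_null N0 mQ).
  + exact: measurable_funTS mabs.
  + apply: measurable_funTS.
    have mgE : measurable_fun setT (EFin \o g) by exact/measurable_EFinP.
    exact: measurableT_comp mgE.
  + by move=> y; exact: abse_ge0.
  + by move=> y; exact: abse_ge0.
  + by move=> y /gE -> /=; rewrite ger0_norm.
- by rewrite -IE.
- by rewrite IE.
Qed.

Lemma sufficiency :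
  operator_norm (fractional_maximal alpha) (weighted_lorentz_norm (EFin \o v) p p%:E)
    (weighted_lorentz_norm (EFin \o v) q s) <=
  (6 ^+ d * (#|{: {ffun 'I_d -> 'I_3}}|%:R `^ q^-1 * (2 * pc `^ (p / q))))%:E *
    (A * Rc `^ q^-1).
Proof.
set C := (6 ^+ d * _)%R.
have C0 : (0 < C)%R.
  rewrite mulr_gt0 ?exprn_gt0// mulr_gt0 ?powR_gt0 ?ltr0n ?mulr_gt0 ?powR_gt0//.
  by apply/card_gt0P; exists [ffun=> ord0].
(* The real-variable estimates need finite constants. If one of them is infinite, the other is
   positive and the right-hand side is [+oo]. *)
have [Aoo|Aoo] := eqVneq A +oo.
  rewrite Aoo gt0_mulye ?poweR_gt0 ?reverse_const_gt0//.
  by rewrite gt0_muley ?leey// lte_fin.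
have [Roo|Roo] := eqVneq Rc +oo.
  rewrite Roo poweRyr ?invr_neq0 ?gt_eqF// gt0_muley//.
  by rewrite gt0_muley ?leey// lte_fin.
have Alty : A < +oo by rewrite lt_neqAle Aoo leey.
have Rlty : Rc < +oo by rewrite lt_neqAle Roo leey.
have Afin : A \is a fin_num by rewrite ge0_fin_numE// ltW.
have Rfin : Rc \is a fin_num by rewrite ge0_fin_numE// ltW// reverse_const_gt0.
have A0 : (0 <= fine A)%R by rewrite fine_ge0// ltW.
have K0 : (0 <= fine Rc)%R by rewrite fine_ge0// ltW// reverse_const_gt0.
have sigoo := reverse_const_lty Rlty.
have hA Q : cube Q -> lorentz_norm q s ((EFin \o v) \_ Q) <=
    (fine A * fine (mu Q) `^ q^-1 *
     (fine (\int[mu]_(x in Q) sigma x) / fine (mu Q)) `^ (- pc^-1))%:E.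
  exact: size_le.
have hK Q E : cube Q -> measurable E -> E `<=` Q -> (2^-1)%:E * mu Q <= mu E ->
    \int[mu]_(x in Q) sigma x <= (fine Rc)%:E * \int[mu]_(x in E) sigma x.
  move=> cQ mE EQ QE; have := reverse_const_ge cQ mE EQ QE.
  have /andP[V0 _] := lebesgue_cube_gt0 cQ.
  have E0 : 0 < \int[mu]_(x in E) sigma x.
    apply: mass_gt0 => //; apply: lt_le_trans QE.
    by rewrite mule_gt0// lte_fin invr_gt0.
  have Eoo : \int[mu]_(x in E) sigma x < +oo.
    apply: le_lt_trans (sigoo Q cQ).
    exact: (@ge0_subset_integral _ T R mu E Q mE (measurable_cube cQ) _
      (measurable_funTS msigma) (fun x _ => ltW (sigma_gt0 x)) EQ).
  have [e eE] : exists e, \int[mu]_(x in E) sigma x = e%:E.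
    by exists (fine (\int[mu]_(x in E) sigma x)); rewrite fineK// ge0_fin_numE// ltW.
  rewrite eE in E0 *; rewrite lte_fin in E0.
  by rewrite inver gt_eqF// fineK// lee_pdivrMr.
rewrite -(fineK Afin) -(fineK Rfin) poweR_EFin -!EFinM.
apply: ereal_inf_lbound; exists (C * (fine A * fine Rc `^ q^-1))%R; last exact: erefl.
split.
  by rewrite !mulr_ge0 ?powR_ge0// ltW.
move=> f mf Nf; have [g [mg g0 ME Gpoo NE]] := finite_version mf Nf.
rewrite ME NE.
exact: (dyadic_maximal_bound p1 pq beta0 qE qs mv mg v0 g0 Gpoo sigoo A0 K0 hA hK betaE).
Qed.

End Sufficiency.

(** * The four estimates for general weights *)

Lemma lesssim_version (R : realType) (d : nat)
    (F G : (Rd R d -> \bar R) -> \bar R) (C : R) : (0 < C)%R ->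
  (forall w, weight w -> exists v : Rd R d -> R,
     [/\ measurable_fun [set: Rd R d] v, forall x, (0 < v x)%R,
       F w = F (EFin \o v) & G w = G (EFin \o v)]) ->
  (forall v : Rd R d -> R, measurable_fun [set: Rd R d] v ->
     (forall x, (0 < v x)%R) -> F (EFin \o v) <= C%:E * G (EFin \o v)) ->
  lesssim F G.
Proof.
move=> C0 FG H; exists C => // w ww; have [v [mv v0 -> ->]] := FG w ww.
exact: H.
Qed.

Theorem theorem4p13 (R : realType) (d : nat) (hd : (0 < d)%N) :
  exists2 c : R, (0 < c < 1)%R &
    forall (alpha p q : R) (s : \bar R),
      (0 <= alpha < d%:R)%R -> (1 < p)%R ->
      (q^-1 = p^-1 - alpha / d%:R)%R -> (0 < q^-1)%R ->
      q%:E <= s ->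
      let A := fun w : Rd R d -> \bar R => A_const p q s w in
      let N := fun w : Rd R d -> \bar R =>
        operator_norm (fractional_maximal alpha) (weighted_lorentz_norm w p p%:E)
          (weighted_lorentz_norm w q s) in
      let Rc := fun w : Rd R d -> \bar R =>
        reverse_const c (density (dual_weight p w)) in
      [/\ lesssim A N,
          lesssim N (fun w => A w * Rc w `^ q^-1),
          lesssim Rc (fun w => A w `^ conj_exp p)
        & lesssim N (fun w => A w `^ (1 + conj_exp p / q)%R)].
Proof.
exists 2^-1%R; first by rewrite invr_gt0 invf_lt1// ltr0n ltr1n.
move=> alpha p q s /andP[alpha0 _] p1 qE; rewrite invr_gt0 => q0 qs A N Rc.
have pcE := conj_expE p1; set pc := (p / (p - 1))%R in pcE.
have p0 : (0 < p)%R by lra.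
have pc0 : (0 < pc)%R by rewrite divr_gt0// subr_gt0.
have s0 : 0 < s by apply: lt_le_trans qs; rewrite lte_fin.
have beta0 : (0 <= alpha / d%:R)%R by rewrite divr_ge0.
have pq : (p <= q)%R by rewrite -lef_pV2 ?posrE// qE gerBl.
have version w : weight w -> exists v : Rd R d -> R,
    [/\ measurable_fun [set: Rd R d] v, forall x, (0 < v x)%R,
      A w = A (EFin \o v), N w = N (EFin \o v) & Rc w = Rc (EFin \o v)].
  move=> /constants_version[v [mv v0 H]]; exists v.
  by have [HA HN HR] := H p q s 2^-1%R alpha p1; split.
pose C2 := (6 ^+ d * (#|{: {ffun 'I_d -> 'I_3}}|%:R `^ q^-1 * (2 * pc `^ (p / q))))%R.
have C20 : (0 < C2)%R.
  rewrite mulr_gt0 ?exprn_gt0// mulr_gt0 ?powR_gt0 ?ltr0n ?mulr_gt0 ?powR_gt0//.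
  by apply/card_gt0P; exists [ffun=> ord0].
pose C3 := (4 * 2 `^ pc * 4 `^ (pc / q) : R)%R.
have C30 : (0 < C3)%R by rewrite !mulr_gt0 ?powR_gt0.
have part2 (v : Rd R d -> R) : measurable_fun [set: Rd R d] v -> (forall x, (0 < v x)%R) ->
    N (EFin \o v) <= C2%:E * (A (EFin \o v) * Rc (EFin \o v) `^ q^-1).
  by move=> mv v0; exact: (sufficiency p1 pq beta0 qE qs erefl mv v0).
have part3 (v : Rd R d -> R) : measurable_fun [set: Rd R d] v -> (forall x, (0 < v x)%R) ->
    Rc (EFin \o v) <= C3%:E * A (EFin \o v) `^ pc.
  move=> mv v0; have A0 : 0 < A (EFin \o v) by exact: (A_const_gt0 p1 q0 s0 mv v0).
  have [Aoo|Aoo] := eqVneq (A (EFin \o v)) +oo.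
    by rewrite Aoo poweRyr ?gt_eqF// gt0_muley ?leey// lte_fin.
  have Alty : A (EFin \o v) < +oo by rewrite lt_neqAle Aoo leey.
  have densE E : density (dual_weight p (EFin \o v)) E =
      \int[@lebesgue_d R d]_(x in E) (v x `^ (- pc))%:E.
    by rewrite /density /dual_weight pcE.
  (* The branch [+oo] is excluded: a finite A-constant makes the dual weight integrable on cubes. *)
  rewrite /Rc /reverse_const; case: ifPn => [_|/asboolPn lf]; last first.
    exfalso; apply: lf => Q cQ; rewrite densE.
    exact: (mass_lty p1 q0 s0 mv v0 Alty cQ).
  apply: ge_ereal_sup => _ [[Q E] /= [cQ mE EQ QE] <-].
  rewrite !densE; exact: (reverse_ratio_le p1 q0 s0 mv v0 Alty cQ mE EQ QE).
split.
- apply: (@lesssim_version _ _ A N 1%R ltr01).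
    move=> w /version[v [mv v0 HA HN _]].
    by exists v; split; [exact: mv|exact: v0|exact: HA|exact: HN].
  move=> v mv v0; rewrite mul1e; apply: le_ereal_inf_tmp => _ [C [C0 hC] <-].
  exact: (necessity p1 q0 s0 qE mv v0 erefl C0 hC).
- apply: (@lesssim_version _ _ N _ C2 C20); last exact: part2.
  move=> w /version[v [mv v0 HA HN HR]].
  by exists v; split; [exact: mv|exact: v0|exact: HN|rewrite HA HR].
- rewrite pcE; apply: (@lesssim_version _ _ Rc _ C3 C30); last exact: part3.
  move=> w /version[v [mv v0 HA HN HR]].
  by exists v; split; [exact: mv|exact: v0|exact: HR|rewrite HA].
have C230 : (0 < C2 * C3 `^ q^-1)%R by rewrite mulr_gt0 ?powR_gt0.
rewrite pcE; apply: (@lesssim_version _ _ N _ _ C230).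
  move=> w /version[v [mv v0 HA HN HR]].
  by exists v; split; [exact: mv|exact: v0|exact: HN|rewrite HA].
move=> v mv v0; apply: le_trans (part2 v mv v0) _.
have A0 : 0 < A (EFin \o v) by exact: (A_const_gt0 p1 q0 s0 mv v0).
have R0 : 0 < Rc (EFin \o v) by exact: (reverse_const_gt0 p1 mv v0).
rewrite (EFinM C2) -(muleA C2%:E); apply: lee_wpmul2l; first by rewrite lee_fin (ltW C20).
have e0 : (0 < 1 + pc / q)%R by exact: (addr_gt0 ltr01 (divr_gt0 pc0 q0)).
rewrite poweRD; last by apply: add_neq0_poweRD_def; exact/lt0r_neq0.
rewrite (poweRe1 (ltW A0)).
rewrite muleCA; apply: lee_wpmul2l; first exact: (ltW A0).
rewrite -poweR_EFin poweRrM -poweRM ?poweR_ge0 ?lee_fin ?(ltW C30)//.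
by apply: lee_poweR (part3 v mv v0); rewrite ?invr_ge0 ltW.
Qed.
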